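(* Let $F$ be an $\mathcal F_T$-measurable real random variable such that $E[e^{p\alpha F^+}]<\infty$ and $E[e^{\varepsilon F^-}]<\infty$ for some integer $p>1$ and some $\varepsilon>0$. Let $(Y,Z)$ be the unique solution of BSDE$(F,f)$. Then the value function $$V(0,x)=\sup_{\pi\in\mathcal A_D^{conv}}E\left[-\exp\left(-\alpha\left(X_T^{\pi}-F\right)\right)\right],\qquad x\in\mathbb R,$$ is given by $$V(0,x)=-\exp(-\alpha(x-Y_0)),$$ and there exists an optimal trading strategy $\pi^\star\in\mathcal A_D^{conv}$ such that $$\sigma_t^{tr}\pi_t^\star=\mathrm{Proj}_{\sigma_t^{tr}\mathcal C}\left(Z_t+\frac{\theta_t}{\alpha}\right),\quad \mathbb P\text{-a.s., for } t\in[0,T].$$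
   Context: Fix $T>0$, integers $1\le d\le m$ and $\alpha>0$. $B$ is a standard $m$-dimensional Brownian motion on a complete probability space $(\Omega,\mathcal F,\mathbb P)$ with augmented natural filtration $(\mathcal F_t)$; predictability is with respect to this filtration, $E$ is expectation under $\mathbb P$, and $A^{tr}$ is the transpose of $A$. The processes $b$ ($\mathbb R^d$-valued) and $\sigma$ ($\mathbb R^{d\times m}$-valued) are predictable and bounded, $\sigma_t\sigma_t^{tr}$ is invertible, and $\theta_t=\sigma_t^{tr}(\sigma_t\sigma_t^{tr})^{-1}b_t$ is bounded. $\mathcal C\subset\mathbb R^d$ is closed and convex with $0\in\mathcal C$. For a closed convex set $K\subset\mathbb R^m$, $\mathrm{dist}_K$ and $\mathrm{Proj}_K$ are the Euclidean distance to and projection onto $K$; $\sigma_t^{tr}\mathcal C=\{\sigma_t^{tr}\pi:\pi\in\mathcal C\}$. Wealth: $X_t^\pi=x+\int_0^t\pi_u^{tr}\sigma_u(dB_u+\theta_u\,du)$. Generator: for $(t,z)\in[0,T]\times\mathbb R^m$, $$f(t,z)=\frac{\alpha}{2}\mathrm{dist}^2_{\sigma_t^{tr}\mathcal C}\left(z+\frac1\alpha\theta_t\right)-z^{tr}\theta_t-\frac{1}{2\alpha}|\theta_t|^2 .$$ A solution of BSDE$(F,f)$ is a pair of predictable processes $(Y,Z)$ with values in $\mathbb R\times\mathbb R^m$, $Y$ continuous, $\int_0^T|Z_t|^2dt<\infty$ and $\int_0^T|f(t,Z_t)|dt<\infty$ a.s., and $Y_t=F+\int_t^Tf(s,Z_s)ds-\int_t^TZ_s^{tr}dB_s$,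 $t\in[0,T]$. The ''unique solution'' is the one which is unique in the class $E[e^{p\alpha Y^+_\star}+e^{\varepsilon Y^-_\star}+\int_0^T|Z_s|^2ds]<\infty$, where $Y^\pm_\star=\sup_{t\in[0,T]}Y_t^\pm$, $y^+=\max\{y,0\}$, $y^-=\max\{-y,0\}$. Admissible set: $\mathcal A_D^{conv}$ is the set of $\mathbb R^d$-valued predictable processes $\pi$ with $\int_0^T|\sigma_t^{tr}\pi_t|^2dt<\infty$ a.s., $\pi_t\in\mathcal C$ $\mathbb P$-a.s. for $t\in[0,T]$, and such that the family $\{\exp(-\alpha(X_\tau^\pi-Y_\tau)):\tau\text{ a stopping time with values in }[0,T]\}$ is uniformly integrable. *)

(* Defs.v *)
From HB Require Import structures.
From mathcomp Require Import all_boot all_order all_algebra.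
From mathcomp Require Import all_classical all_reals all_analysis.
Set Implicit Arguments.
Unset Strict Implicit.
Unset Printing Implicit Defensive.
Import Order.TTheory GRing.Theory Num.Theory.
Import numFieldNormedType.Exports.

Local Open Scope classical_set_scope.
Local Open Scope ring_scope.

(* The canonical norm of MathComp-Analysis on matrices is the sup norm, so the
   Euclidean (for matrices: Frobenius) norm is introduced separately. *)
Section euclidean.
Context {R : realType}.

Definition dotv (n : nat) (u v : 'cV[R]_n) : R := \sum_(i < n) u i ord0 * v i ord0.

Definition enorm (p q : nat) (A : 'M[R]_(p, q)) : R :=
  Num.sqrt (\sum_(i < p) \sum_(j < q) A i j ^+ 2).

Definition edist (n : nat) (K : set 'cV[R]_n) (x : 'cV[R]_n) : R :=
  inf [set enorm (x - y) | y in K].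

(* The projection exists and is unique when K is nonempty, closed and convex;
   the default value 0 is only relevant outside of this case. *)
Definition eproj (n : nat) (K : set 'cV[R]_n) (x : 'cV[R]_n) : 'cV[R]_n :=
  xget 0 [set y | K y /\ forall y', K y' -> enorm (x - y) <= enorm (x - y')].

End euclidean.

Section processes.
Context {d : measure_display} {Omega : measurableType d} {R : realType}.
Variable P : probability Omega R.
Variable T : R.

Definition measurable_wrt (G : set (set Omega)) (X : Omega -> R) : Prop :=
  forall A : set R, measurable A -> G (X @^-1` A).

Definition continuous_paths (X : R -> Omega -> R) : Prop :=
  \forall w \ae P, {within `[0%R, T], continuous (fun t => X t w)}.

Definition bounded_process (p q : nat) (H : R -> Omega -> 'M[R]_(p, q)) : Prop :=
  exists K : R, forall t w, 0 <= t <= T -> enorm (H t w) <= K.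

Definition cvg_in_probability0 (xi : nat -> Omega -> \bar R) : Prop :=
  forall e : R, 0 < e ->
    (fun n => P [set w | (e%:E <= xi n w)%E]) @ \oo --> 0%E.

Definition uniformly_integrable (S : set (Omega -> R)) : Prop :=
  forall e : R, 0 < e -> exists c : R, forall X, S X ->
    (\int[P]_(w in [set w | (c <= `|X w|)%R]) `|X w|%:E <= e%:E)%E.

Variable m : nat.
Variable B : R -> Omega -> 'cV[R]_m.

Definition natural_filtration (t : R) : set (set Omega) :=
  <<s [set E | exists s i A, [/\ 0 <= s <= t, measurable A
                               & E = (fun w => B s w i ord0) @^-1` A]] >>.

Definition augmented_filtration (t : R) : set (set Omega) :=
  <<s natural_filtration t `|` [set N | P.-negligible N] >>.

(* Independence of B_t - B_s from the past, independence of its coordinates and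
   their N(0, t - s) law are expressed by one product formula; normal_prob takes
   the standard deviation as second parameter. *)
Definition brownian_motion : Prop :=
  [/\ forall t i, 0 <= t <= T -> measurable_fun setT (fun w => B t w i ord0),
      \forall w \ae P, B 0 w = 0,
      forall i, continuous_paths (fun t w => B t w i ord0)
    & forall (s t : R) (E : set Omega) (A : 'I_m -> set R),
        0 <= s -> s < t -> t <= T ->
        natural_filtration s E -> (forall i, measurable (A i)) ->
        P (E `&` [set w | forall i, A i (B t w i ord0 - B s w i ord0)]) =
        (P E * \prod_(i < m) normal_prob 0 (Num.sqrt (t - s)) (A i))%E].

Local Notation Ft := augmented_filtration.

Definition adapted (X : R -> Omega -> R) : Prop :=
  forall t, 0 <= t <= T -> measurable_wrt (Ft t) (X t).

Definition stopping_time (tau : Omega -> R) : Prop :=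
  (forall w, 0 <= tau w <= T) /\
  (forall t, 0 <= t <= T -> Ft t [set w | tau w <= t]).

(* Processes are total functions of time; only their values on [0, T] matter.
   The predictable sigma-algebra lives on [0, T] x Omega. *)
Definition predictable_rectangles : set (set (R * Omega)) :=
  [set D | (exists2 E, Ft 0 E & D = [set 0] `*` E) \/
           (exists s t E, [/\ 0 <= s, s < t, t <= T, Ft s E
                            & D = `]s, t] `*` E])].

Definition predictable (X : R -> Omega -> R) : Prop :=
  forall A : set R, measurable A ->
    <<s `[0, T] `*` setT, predictable_rectangles >>
      ((`[0, T] `*` setT) `&` [set tw | A (X tw.1 tw.2)]).

Definition mx_predictable (p q : nat) (H : R -> Omega -> 'M[R]_(p, q)) : Prop :=
  forall i j, predictable (fun t w => H t w i j).

Definition square_integrable_paths (H : R -> Omega -> 'cV[R]_m) : Prop :=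
  \forall w \ae P,
    (\int[lebesgue_measure]_(t in `[0%R, T]) (enorm (H t w) ^+ 2)%:E < +oo)%E.

(* xi_0 1_]t_0,t_1] + ... + xi_(n-1) 1_]t_(n-1),t_n] *)
Record simple_process := SimpleProcess {
  sp_size : nat;
  sp_time : nat -> R;
  sp_val : nat -> Omega -> 'cV[R]_m }.

Definition simple_predictable (S : simple_process) : Prop :=
  [/\ forall i, (i <= sp_size S)%N -> 0 <= sp_time S i <= T,
      forall i, (i < sp_size S)%N -> sp_time S i <= sp_time S i.+1,
      forall i j, (i < sp_size S)%N ->
        measurable_wrt (Ft (sp_time S i)) (fun w => sp_val S i w j ord0)
    & forall i, (i < sp_size S)%N ->
        exists K : R, forall w, enorm (sp_val S i w) <= K].

Definition sp_eval (S : simple_process) (t : R) (w : Omega) : 'cV[R]_m :=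
  \sum_(i < sp_size S)
    (t \in `]sp_time S i, sp_time S i.+1])%:R *: sp_val S i w.

Definition sp_integral (S : simple_process) (t : R) (w : Omega) : R :=
  \sum_(i < sp_size S)
    dotv (sp_val S i w)
         (B (Num.min (sp_time S i.+1) t) w - B (Num.min (sp_time S i) t) w).

(* I is (a version of) the Ito integral process t |-> int_0^t H_u^tr dB_u: the
   continuous adapted limit, uniformly on [0, T] in probability, of the integrals
   of simple predictable processes S_n with int_0^T |S_n - H|^2 dt -> 0 in
   probability. *)
Definition is_stochastic_integral (H : R -> Omega -> 'cV[R]_m)
    (I : R -> Omega -> R) : Prop :=
  [/\ continuous_paths I, adapted I
    & exists S : nat -> simple_process,
      [/\ forall n, simple_predictable (S n),
          cvg_in_probability0 (fun n w =>
            (\int[lebesgue_measure]_(t in `[0%R, T])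
               (enorm (sp_eval (S n) t w - H t w) ^+ 2)%:E)%E)
        & cvg_in_probability0 (fun n w =>
            ereal_sup [set `|sp_integral (S n) t w - I t w|%:E | t in `[0%R, T]])]].

(* Every predictable H with square-integrable paths has a stochastic integral,
   unique up to indistinguishability; a version is chosen, and the default
   process 0 is only relevant for other integrands. *)
Definition stochastic_integral (H : R -> Omega -> 'cV[R]_m) : R -> Omega -> R :=
  xget (fun _ _ => 0) [set I | is_stochastic_integral H I].

Definition bsde_solution (F : Omega -> R) (f : R -> Omega -> 'cV[R]_m -> R)
    (Y : R -> Omega -> R) (Z : R -> Omega -> 'cV[R]_m) : Prop :=
  [/\ predictable Y /\ mx_predictable Z,
      continuous_paths Y,
      square_integrable_paths Z,
      \forall w \ae P,
        (\int[lebesgue_measure]_(t in `[0%R, T]) `|f t w (Z t w)|%:E < +oo)%E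
    & \forall w \ae P, forall t, 0 <= t <= T ->
        Y t w = F w + \int[lebesgue_measure]_(s in `[t, T]) f s w (Z s w)
                - (stochastic_integral Z T w - stochastic_integral Z t w)].

Definition bsde_class (a e : R)
    (Y : R -> Omega -> R) (Z : R -> Omega -> 'cV[R]_m) : Prop :=
  (\int[P]_w
     ((expR (a * sup [set Num.max (Y t w) 0 | t in `[0%R, T]]))%:E
      + (expR (e * sup [set Num.max (- Y t w) 0 | t in `[0%R, T]]))%:E
      + \int[lebesgue_measure]_(s in `[0%R, T]) (enorm (Z s w) ^+ 2)%:E)
   < +oo)%E.

Variable k : nat.
Variable alpha : R.
Variable b : R -> Omega -> 'cV[R]_k.
Variable sigma : R -> Omega -> 'M[R]_(k, m).
Variable C : set 'cV[R]_k.

Definition theta (t : R) (w : Omega) : 'cV[R]_m :=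
  (sigma t w)^T *m invmx (sigma t w *m (sigma t w)^T) *m b t w.

Definition constraint (t : R) (w : Omega) : set 'cV[R]_m :=
  [set (sigma t w)^T *m c | c in C].

Definition generator (t : R) (w : Omega) (z : 'cV[R]_m) : R :=
  alpha / 2 * edist (constraint t w) (z + alpha^-1 *: theta t w) ^+ 2
  - dotv z (theta t w) - (2 * alpha)^-1 * enorm (theta t w) ^+ 2.

Definition wealth (x : R) (pi : R -> Omega -> 'cV[R]_k) (t : R) (w : Omega) : R :=
  x + stochastic_integral (fun u v => (sigma u v)^T *m pi u v) t w
  + \int[lebesgue_measure]_(u in `[0, t])
      dotv ((sigma u w)^T *m pi u w) (theta u w).

Definition admissible (Y : R -> Omega -> R) (x : R)
    (pi : R -> Omega -> 'cV[R]_k) : Prop :=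
  [/\ mx_predictable pi,
      square_integrable_paths (fun t w => (sigma t w)^T *m pi t w),
      forall t, 0 <= t <= T -> \forall w \ae P, C (pi t w)
    & uniformly_integrable
        [set (fun w => expR (- alpha * (wealth x pi (tau w) w - Y (tau w) w)))
        | tau in stopping_time]].

Definition expected_utility (F : Omega -> R) (x : R)
    (pi : R -> Omega -> 'cV[R]_k) : \bar R :=
  'E_P[fun w => - expR (- alpha * (wealth x pi T w - F w))].

Definition value (F : Omega -> R) (Y : R -> Omega -> R) (x : R) : \bar R :=
  ereal_sup [set expected_utility F x pi | pi in admissible Y x].

End processes.

(* Main.v *)
(** Let [u(H)_t = exp(- alpha (X_t - x) + alpha (Y_t - Y_0))] where [X] is the wealth of a
strategy with [H = sigma^T pi]. Completing the square in the generator gives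
[u(H) = exp(int G dB - 1/2 int |G|^2) * exp(int gap)] with [G = alpha (Z - H)], where [gap >= 0]
is [alpha^2 / 2] times the difference between [|Z + theta / alpha - H|^2] and the squared distance
of [Z + theta / alpha] to the constraint set; it vanishes when [H] is the projection.
The exponential factor has expectation 1 at stopping times up to which
[int |H|^2 + |Z|^2] is bounded: this holds for simple integrands by the independence of Brownian
increments, and in general by approximation. So [E u(H)_tau >= 1] at such times, with equality for
the projection, and uniform integrability allows to pass to the terminal time.

It remains to see that the optimal strategy is admissible. If [H] is the projection, then [l H]
satisfies the constraint for [0 <= l <= 1] and [u(l H) = u(H)^l exp((1 - l) W)] with
[W = alpha (Y - Y_0)]. Hence [E u^(1-r) exp(r W) >= 1 = E u] for all [0 < r <= 1], and the
derivative at [r = 0] yields [E u ln u <= E u W]. By Young's inequality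
[p u W <= u ln u - u + exp(p W)], and the exponential moments of [Y] bound
[E u ln u] uniformly over stopping times, which is uniform integrability. *)
Require Import Defs.
From HB Require Import structures.
From mathcomp Require Import all_boot all_order all_algebra.
From mathcomp Require Import all_classical all_reals all_analysis.
From mathcomp Require Import measurable_realfun ring lra.
Set Implicit Arguments.
Unset Strict Implicit.
Unset Printing Implicit Defensive.
Import Order.TTheory GRing.Theory Num.Theory.
Import numFieldNormedType.Exports.
Local Open Scope classical_set_scope.
Local Open Scope ring_scope.

(** * Independent increments of Brownian motion *)

(** Expectation 1 survives both limits, from grid times to stopping times and from simple to general
    integrands, because the square of an exponential with bounded quadratic variation is at most a
    constant times the exponential of the doubled integrand. The approximating integrals are stopped
    before their quadratic variation exceeds a bound, so that this applies to them.

    The obstacle is the uniform integrability of [u(H)] for the optimal [H], whose wealth has no a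
    priori moments. Since [0] lies in [C], the function [r -> E u^(1-r) exp(r W)] is minimal at
    [r = 0], whence the sign of its derivative. The strict inequality [p > 1] then permits
    absorption: [p E u ln u <= p E u W <= E u ln u - 1 + E exp(p W)] leaves the factor [p - 1]. As
    [u ln u] is not known beforehand to be integrable, this is carried out with nonnegative
    integrands.

    Two null set questions remain. The sigma-algebra at time 0 is trivial, so [Y_0] is almost surely
    a number. A constraint that holds almost surely at each time holds, by Fubini, at almost every
    time of almost every path. *)

Section density.
Local Open Scope ereal_scope.
Context d (T : measurableType d) (R : realType).
Variables (mu nu : {measure set T -> \bar R}) (g : T -> R).
Hypothesis g0 : forall x, (0 <= g x)%R.
Hypothesis mg : measurable_fun setT g.
Hypothesis nuE : forall A, measurable A -> nu A = \int[mu]_(x in A) (g x)%:E.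
Import HBNNSimple.

(** Monotone approximation by simple functions reduces the identity to indicators, where it is
    [nuE]. *)
Lemma ge0_integral_density (f : T -> \bar R) : (forall x, 0 <= f x) ->
  measurable_fun setT f -> \int[nu]_x f x = \int[mu]_x (f x * (g x)%:E).
Proof.
have mg' : measurable_fun setT (EFin \o g) by exact/measurable_EFinP.
move=> f0 mf; pose h := nnsfun_approx measurableT mf.
have hE x : EFin (h n x) @[n --> \oo] --> f x by exact: cvg_nnsfun_approx.
have mh n : measurable_fun setT (EFin \o h n).
  by apply/measurable_EFinP; exact/measurable_funP.
have h0 n x : 0 <= (h n x)%:E by rewrite lee_fin.
have ndh x : {homo (fun n => (h n x)%:E) : a b / (a <= b)%N >-> a <= b}.
  by move=> a b ab; rewrite lee_fin; exact/lefP/nd_nnsfun_approx.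
have nnsfunE (k : {nnsfun T >-> R}) :
    \int[nu]_x (k x)%:E = \int[mu]_x ((k x)%:E * (g x)%:E).
  under eq_integral do rewrite fimfunE -fsumEFin//.
  rewrite ge0_integral_fsum//; last 2 first.
  - by move=> r; exact/measurable_EFinP/measurableT_comp.
  - by move=> n x _; rewrite EFinM nnfun_muleindic_ge0.
  under [RHS]eq_integral.
    move=> x xD; rewrite fimfunE -fsumEFin// ge0_mule_fsuml; last first.
      by move=> r; rewrite EFinM nnfun_muleindic_ge0.
    over.
  rewrite [RHS]ge0_integral_fsum//; last 2 first.
  - move=> r; apply: emeasurable_funM => //.
    by apply/measurable_EFinP; exact/measurableT_comp.
  - by move=> n x _; rewrite mule_ge0 ?lee_fin//; have := nnfun_muleindic_ge0 k n x; rewrite -EFinM lee_fin.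
  apply: eq_fsbigr => r rk.
  under eq_integral do rewrite EFinM.
  rewrite integralZl_indic_nnsfun//.
  under [RHS]eq_integral do rewrite EFinM -muleA.
  rewrite ge0_integralZl//; first last.
  - by move: rk; rewrite inE => -[t _ <-]; rewrite lee_fin.
  - by move=> t _; rewrite mule_ge0 ?lee_fin.
  - by apply: emeasurable_funM => //; exact/measurable_EFinP.
  congr (_ * _); rewrite integral_indic// setIT nuE//.
  rewrite integral_mkcond; apply: eq_integral => x _.
  by rewrite (_ : (fun x => (g x)%:E) = EFin \o g)// epatch_indic muleC.
transitivity (limn (fun n => \int[nu]_x (h n x)%:E)).
  rewrite -monotone_convergence//.
  by apply: eq_integral => x _; apply/esym/cvg_lim.
under eq_fun do rewrite nnsfunE.
rewrite -monotone_convergence//.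
- apply: eq_integral => x _; apply/cvg_lim => //.
  by apply: cvgeZr.
- by move=> n; apply: emeasurable_funM; [exact: mh|exact: mg'].
- by move=> n x _; rewrite mule_ge0 ?lee_fin.
- by move=> x _ a b ab; rewrite lee_wpmul2r ?lee_fin//; exact: ndh.
Qed.

End density.

Section freezing.
Context {R : realType}.

(** Completing the square turns the integrand times the centred density into the normal density with
    mean [c * s ^+ 2]. *)
Lemma normal_mgf (s c : R) : s != 0 ->
  (\int[normal_prob 0 s]_x (expR (c * x - c ^+ 2 * s ^+ 2 / 2))%:E = 1)%E.
Proof.
move=> s0; rewrite (@ge0_integral_density _ _ _ lebesgue_measure _ 
  (normal_pdf 0 s)); first last.
- apply/measurable_EFinP; apply: measurableT_comp => //.
  by apply: measurable_funB => //; exact: measurable_funM.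
- by move=> x; rewrite lee_fin expR_ge0.
- by move=> A mA; rewrite /normal_prob.
- exact: measurable_normal_pdf.
- by move=> x; exact: normal_pdf_ge0.
rewrite -(integral_normal_pdf (c * s ^+ 2) s); apply: eq_integral => x _.
rewrite !normal_pdfE//= -EFinM mulrCA; congr (_ * _)%:E.
rewrite /normal_fun -expRD; congr expR.
by rewrite -mulr_natr; field.
Qed.

Context d (Omega : measurableType d).
Variable P : probability Omega R.

Let G_sub (G : set (set Omega)) : G `<=` measurable -> <<s G >> `<=` measurable.
Proof. by move=> GM; apply: smallest_sub => //; exact: sigma_algebra_measurable. Qed.

(** The law of the pair formed by the sample point, seen through [<<s G>>], and [X] is a product
    measure, because it is one on rectangles by [indep]. By Tonelli [X] is integrated first, with
    [xi] and [U] frozen, and this inner integral is [normal_mgf]. *)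
Lemma freezing (G : set (set Omega)) (X : Omega -> R) (s : R) (xi U : Omega -> R) :
  G `<=` measurable -> measurable_fun setT X -> s != 0 ->
  (forall E A, <<s G >> E -> measurable A ->
    P (E `&` X @^-1` A) = (P E * normal_prob 0 s A)%E) ->
  measurable_wrt <<s G >> xi -> measurable_wrt <<s G >> U ->
  (forall w, 0 <= U w) ->
  (\int[P]_w (U w * expR (xi w * X w - xi w ^+ 2 * s ^+ 2 / 2))%:E =
   \int[P]_w (U w)%:E)%E.
Proof.
move=> GM mX s0 indep mxi mU U0.
have mid : measurable_fun setT (id : Omega -> g_sigma_algebraType G).
  by move=> _ A mA; rewrite setTI preimage_id; exact: (G_sub GM).
have mphi : measurable_fun setT (fun w : Omega => (w : g_sigma_algebraType G, X w : measurableTypeR R)).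
  by apply: measurable_fun_pair.
have mxi' : measurable_fun setT (xi : g_sigma_algebraType G -> R).
  by move=> _ A mA; rewrite setTI; exact: mxi.
have mU' : measurable_fun setT (U : g_sigma_algebraType G -> R).
  by move=> _ A mA; rewrite setTI; exact: mU.
pose h (z : g_sigma_algebraType G * measurableTypeR R) : \bar R :=
  (U z.1 * expR (xi z.1 * z.2 - xi z.1 ^+ 2 * s ^+ 2 / 2))%:E.
have mh : measurable_fun setT h.
  have m1 : measurable_fun setT (xi \o fst : g_sigma_algebraType G * measurableTypeR R -> R).
    exact: (measurableT_comp mxi').
  have m2 : measurable_fun setT (U \o fst : g_sigma_algebraType G * measurableTypeR R -> R).
    exact: (measurableT_comp mU').
  apply/measurable_EFinP; apply: measurable_funM => //.
  apply: measurableT_comp => //; apply: measurable_funB.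
    exact: measurable_funM.
  by do 2 apply: measurable_funM => //; exact: measurable_funX.
have h0 z : (0 <= h z)%E by rewrite lee_fin mulr_ge0// expR_ge0.
pose fid : {mfun Omega >-> g_sigma_algebraType G} := mfun_Sub (mem_set mid).
pose fphi : {mfun Omega >-> (g_sigma_algebraType G * measurableTypeR R)%type} :=
  mfun_Sub (mem_set mphi).
transitivity (\int[distribution P fphi]_z h z)%E.
  by rewrite ge0_integral_distribution.
transitivity (\int[distribution P fid \x normal_prob 0 s]_z h z)%E.
  apply: eq_measure_integral => A mA _; apply/esym.
  by apply: product_measure_unique.
rewrite fubini_tonelli1//= /fubini_F /h/=.
have inner w : (\int[normal_prob 0 s]_x
    (U w * expR (xi w * x - xi w ^+ 2 * s ^+ 2 / 2))%:E)%E = (U w)%:E.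
  under eq_integral do rewrite EFinM.
  rewrite ge0_integralZl//.
  - by rewrite normal_mgf// mule1.
  - apply/measurable_EFinP; apply: measurableT_comp => //.
    by apply: measurable_funB => //; exact: measurable_funM.
  - by rewrite lee_fin.
under eq_integral do rewrite inner.
rewrite ge0_integral_distribution//.
exact/measurable_EFinP.
Qed.

End freezing.

Section indep_extend.
Context {R : realType} d (Omega : measurableType d).
Variable P : probability Omega R.

(** [E -> P (E & D)] and [c P] are finite measures that agree on a pi-system containing the whole
    space. *)
Lemma indep_g_sigma_algebra (Pi : set (set Omega)) (D : set Omega) (c : R) :
  0 <= c -> setI_closed Pi -> Pi setT -> Pi `<=` measurable -> measurable D ->
  (forall E, Pi E -> P (E `&` D) = (P E * c%:E)%E) ->
  forall E, <<s Pi >> E -> P (E `&` D) = (P E * c%:E)%E.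
Proof.
move=> c0 PiI PiT Pim mD indep E.
pose m1 : {measure set Omega -> \bar R} := mrestr P mD.
pose m2 : {measure set Omega -> \bar R} := mscale (NngNum c0) P.
rewrite [RHS]muleC -[LHS]/(m1 E) -[RHS]/(m2 E).
apply: (g_sigma_algebra_measure_unique Pi Pim (fun=> setT)) => //.
- by rewrite bigcup_const//; exists 0%N.
- by move=> A PA; rewrite /m1 /m2/= /mrestr /mscale/= indep// muleC.
- move=> _; rewrite /m1/= /mrestr (@le_lt_trans _ _ 1%E)// ?ltry//.
  by rewrite probability_le1// setTI.
Qed.

End indep_extend.

Section sigma_algebra_facts.
Context (T : pointedType) (G : set (set T)).

Lemma g_sigma_algebraI A B : <<s G >> A -> <<s G >> B -> <<s G >> (A `&` B).
Proof. exact: (@measurableI _ (g_sigma_algebraType G)). Qed.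

Lemma g_sigma_algebraS (H : set (set T)) : G `<=` <<s H >> -> <<s G >> `<=` <<s H >>.
Proof. by apply: smallest_sub; exact: smallest_sigma_algebra. Qed.

Lemma g_sigma_algebraT : <<s G >> setT.
Proof. exact: (@measurableT _ (g_sigma_algebraType G)). Qed.

End sigma_algebra_facts.

Lemma measurable_wrtP d (Omega : measurableType d) (R : realType)
    (G : set (set Omega)) (X : Omega -> R) :
  measurable_wrt <<s G >> X <-> measurable_fun setT (X : g_sigma_algebraType G -> R).
Proof.
split => [mX _ A mA|mX A mA]; first by rewrite setTI; exact: mX.
by rewrite -[X in <<s _ >> X]setTI; apply: (mX measurableT).
Qed.

Section euclidean_facts.
Context {R : realType} {n : nat}.
Implicit Types u v w : 'cV[R]_n.

Lemma dotvC u v : dotv u v = dotv v u.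
Proof. by apply: eq_bigr => i _; rewrite mulrC. Qed.

Lemma dotvDl u v w : dotv (u + v) w = dotv u w + dotv v w.
Proof. by rewrite /dotv -big_split; apply: eq_bigr => i _; rewrite !mxE mulrDl. Qed.

Lemma dotvZl a u v : dotv (a *: u) v = a * dotv u v.
Proof. by rewrite /dotv mulr_sumr; apply: eq_bigr => i _; rewrite !mxE mulrA. Qed.

Lemma dotvNl u v : dotv (- u) v = - dotv u v.
Proof. by rewrite -scaleN1r dotvZl mulN1r. Qed.

Lemma dotvDr u v w : dotv w (u + v) = dotv w u + dotv w v.
Proof. by rewrite dotvC dotvDl !(dotvC w). Qed.

Lemma dotvZr a u v : dotv u (a *: v) = a * dotv u v.
Proof. by rewrite dotvC dotvZl dotvC. Qed.

Lemma dotvNr u v : dotv u (- v) = - dotv u v.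
Proof. by rewrite dotvC dotvNl dotvC. Qed.

Lemma dot0v u : dotv 0 u = 0.
Proof. by rewrite -(scale0r u) dotvZl mul0r. Qed.

Lemma dotv0 u : dotv u 0 = 0.
Proof. by rewrite dotvC dot0v. Qed.

Lemma dotv_sumr I (r : seq I) (Q : pred I) (f : I -> 'cV[R]_n) u :
  dotv u (\sum_(i <- r | Q i) f i) = \sum_(i <- r | Q i) dotv u (f i).
Proof. by apply: (big_morph _ (fun v w => dotvDr v w u) (dotv0 u)). Qed.

Lemma dotv_suml I (r : seq I) (Q : pred I) (f : I -> 'cV[R]_n) u :
  dotv (\sum_(i <- r | Q i) f i) u = \sum_(i <- r | Q i) dotv (f i) u.
Proof. by rewrite dotvC dotv_sumr; apply: eq_bigr => i _; rewrite dotvC. Qed.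

Lemma enorm_ge0 u : 0 <= enorm u. Proof. exact: sqrtr_ge0. Qed.

Lemma enorm2 u : enorm u ^+ 2 = dotv u u.
Proof.
rewrite sqr_sqrtr; last by apply: sumr_ge0 => i _; apply: sumr_ge0 => j _; rewrite sqr_ge0.
by apply: eq_bigr => i _; rewrite big_ord1.
Qed.

Lemma dotvv_ge0 u : 0 <= dotv u u.
Proof. by rewrite -enorm2 sqr_ge0. Qed.

Lemma enormN u : enorm (- u) = enorm u.
Proof.
by apply: (pexpIrn (n := 2)); rewrite ?nnegrE ?enorm_ge0// !enorm2 dotvNl dotvNr opprK.
Qed.

Lemma enorm0 : enorm (0 : 'cV[R]_n) = 0.
Proof. by apply/eqP; rewrite -sqrf_eq0 enorm2 dot0v. Qed.

Lemma dotv_le u v : 2 * dotv u v <= dotv u u + dotv v v.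
Proof.
have := dotvv_ge0 (u - v).
by rewrite dotvDl !dotvDr !dotvNl !dotvNr (dotvC v u); lra.
Qed.

Lemma enorm2D_le u v : enorm (u + v) ^+ 2 <= 2 * enorm u ^+ 2 + 2 * enorm v ^+ 2.
Proof.
rewrite !enorm2 dotvDl !dotvDr (dotvC v u); have := dotv_le u v; lra.
Qed.

(** Writing [u = v + h], the difference is [2 <v, h> + |h|^2], and Young's inequality with weight
    [e] bounds the cross term. The auxiliary [H] is used with [a = 1] and [a = -1] for the two
    signs. *)
Lemma enorm2B_dist (e : R) u v : 0 < e ->
  `|enorm u ^+ 2 - enorm v ^+ 2| <= e * enorm v ^+ 2 + (1 + e^-1) * enorm (u - v) ^+ 2.
Proof.
move=> e0; have [h ->] : exists h, u = v + h by exists (u - v); rewrite addrC subrK.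
rewrite [v + h]addrC addrK !enorm2 dotvDl !dotvDr (dotvC h v).
have H (a : R) : a ^+ 2 = 1 -> 2 * a * dotv v h <= e * dotv v v + e^-1 * dotv h h.
  move=> a1; have ie0 : 0 <= e^-1 by rewrite invr_ge0 ltW.
  have := mulr_ge0 ie0 (dotvv_ge0 (e *: v - a *: h)).
  rewrite dotvDl !dotvDr !dotvNl !dotvNr !dotvZl !dotvZr (dotvC h v).
  move: (dotv v v) (dotv v h) (dotv h h) => x y z.
  rewrite (_ : e^-1 * (_ + _) = e * x - 2 * a * y + a ^+ 2 * (e^-1 * z)).
    by rewrite a1; lra.
  by field; rewrite gt_eqF.
have := H 1 (expr1n _ _); have := H (-1) (etrans (sqrrN 1) (expr1n _ _)).
have := dotvv_ge0 h.
move: (dotv v v) (dotv v h) (dotv h h) => x y z.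
by rewrite ler_norml; lra.
Qed.

End euclidean_facts.

Section filtration.
Context d (Omega : measurableType d) (R : realType) (P : probability Omega R).
Context (T : R) (m : nat) (B : R -> Omega -> 'cV[R]_m).
Hypothesis Pc : measure_is_complete P.
Hypothesis BM : brownian_motion P T B.

Local Notation Ft := (augmented_filtration P B).

(** Naming the generators gives access to the measurable type [g_sigma_algebraType (Ft_gen t)],
    whose measurable sets are those of the augmented filtration. *)
Definition Ft_gen (t : R) : set (set Omega) :=
  natural_filtration B t `|` [set N | P.-negligible N].

Lemma natural_filtrationS (s t : R) : s <= t ->
  natural_filtration B s `<=` natural_filtration B t.
Proof.
move=> st; apply: g_sigma_algebraS => E [u [i [A [/andP[u0 us] mA ->]]]].
apply: sub_sigma_algebra => /=; exists u, i, A; split => //.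
by rewrite u0 (le_trans us).
Qed.

Lemma Ft_genS (s t : R) : s <= t -> Ft_gen s `<=` Ft_gen t.
Proof. by move=> st E [/(natural_filtrationS st)|]; [left|right]. Qed.

Lemma FtS (s t : R) : s <= t -> Ft s `<=` Ft t.
Proof.
move=> st; apply: g_sigma_algebraS => E FE; apply: sub_sigma_algebra.
exact: Ft_genS FE.
Qed.

Lemma natural_filtration_measurable t : t <= T -> natural_filtration B t `<=` measurable.
Proof.
move=> tT; apply: smallest_sub; first exact: sigma_algebra_measurable.
move=> E [s [i [A [/andP[s0 st] mA ->]]]].
case: BM => mB _ _ _; rewrite -[X in measurable X]setTI; apply: mB => //.
by rewrite s0 (le_trans st).
Qed.

Lemma Ft_gen_measurable t : t <= T -> Ft_gen t `<=` measurable.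
Proof.
by move=> tT E [|]; [exact: natural_filtration_measurable|exact: Pc].
Qed.

Lemma Ft_measurable t : t <= T -> Ft t `<=` measurable.
Proof.
move=> tT; apply: smallest_sub; first exact: sigma_algebra_measurable.
exact: Ft_gen_measurable.
Qed.

(* Only the first [k] coordinates of the increment are recorded, so that the coordinates
   can be integrated out one at a time by [freezing]. *)
Definition past_and_increments (s t : R) (k : nat) : set (set Omega) :=
  [set E | exists E0 (A : 'I_m -> set R), [/\ natural_filtration B s E0,
     forall i, measurable (A i) &
     E = E0 `&` [set w | forall i : 'I_m, (i < k)%N ->
                   A i (B t w i ord0 - B s w i ord0)]]] `|`
  [set N | P.-negligible N].

Lemma measurable_increment s t i : 0 <= s -> s <= t -> t <= T ->
  measurable_fun setT (fun w => B t w i ord0 - B s w i ord0).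
Proof.
move=> s0 st tT; case: BM => mB _ _ _; apply: measurable_funB; apply: mB.
  by rewrite tT (le_trans s0).
by rewrite s0 (le_trans st).
Qed.

Lemma measurable_increments s t (D : pred 'I_m) (A : 'I_m -> set R) :
  0 <= s -> s <= t -> t <= T -> (forall i, measurable (A i)) ->
  measurable [set w | forall i : 'I_m, D i ->
                   A i (B t w i ord0 - B s w i ord0)].
Proof.
move=> s0 st tT mA.
rewrite (_ : [set _ | _] = \bigcap_(i in [set i | D i])
  ((fun w => B t w i ord0 - B s w i ord0) @^-1` A i)).
  apply: fin_bigcap_measurable => // i _.
  rewrite -[X in measurable X]setTI; apply: measurable_increment => //.
by apply/seteqP; split => w /= H i; [move=> Di|]; apply: H.
Qed.

Lemma past_and_increments_measurable s t k : 0 <= s -> s <= t -> t <= T ->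
  past_and_increments s t k `<=` measurable.
Proof.
move=> s0 st tT E [[E0 [A [mE0 mA ->]]]|]; last exact: Pc.
apply: measurableI; last exact: measurable_increments.
by apply: natural_filtration_measurable mE0; rewrite (le_trans st).
Qed.

Lemma past_and_incrementsI s t k : setI_closed (past_and_increments s t k).
Proof.
move=> E E' [[E0 [A [mE0 mA ->]]]|NE]; last first.
  by move=> _; right; apply: negligibleS NE; exact: subIsetl.
move=> [[E0' [A' [mE0' mA' ->]]]|NE']; last first.
  by right; apply: negligibleS NE'; exact: subIsetr.
left; exists (E0 `&` E0'), (fun i => A i `&` A' i); split.
- exact: g_sigma_algebraI.
- by move=> i; exact: measurableI.
- apply/seteqP; split => w /=.
    by move=> [[Ew H] [E'w H']]; split => // i ik; split; [exact: H|exact: H'].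
  by move=> [[Ew E'w] H]; split; split => // i /H[].
Qed.

Lemma past_and_incrementsT s t k : past_and_increments s t k setT.
Proof.
left; exists setT, (fun=> setT); split => //; first exact: (@measurableT _ (g_sigma_algebraType _)).
by rewrite setTI; apply/seteqP; split.
Qed.

Lemma Ft_past_and_increments s t k : Ft s `<=` <<s past_and_increments s t k >>.
Proof.
apply: g_sigma_algebraS => E [mE|NE]; apply: sub_sigma_algebra; last by right.
left; exists E, (fun=> setT); split => //.
rewrite (_ : [set _ | _] = setT) ?setIT//; apply/seteqP; split => //.
Qed.

(** On a generator the product formula of Brownian motion is used twice, with [A] and with [setT] in
    coordinate [k]; the two products differ in the [k]-th factor only. On a negligible set both
    sides vanish. The generators form a pi-system, so the identity extends to the sigma-algebra. *)
Lemma past_and_increments_indep (s t : R) (k : 'I_m) (E A : set _) : 0 <= s -> s < t -> t <= T ->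
  <<s past_and_increments s t k >> E -> measurable A ->
  P (E `&` (fun w => B t w k ord0 - B s w k ord0) @^-1` A) =
    (P E * normal_prob 0 (Num.sqrt (t - s)) A)%E.
Proof.
move=> s0 st tT GE mA.
set N := normal_prob 0 _.
have NE (D : set R) : measurable D -> N D = (fine (N D))%:E.
  move=> mD; rewrite fineK//.
  have : (N D <= 1)%E by apply: probability_le1.
  rewrite ge0_fin_numE ?measure_ge0// => /le_lt_trans; apply; exact: ltry.
rewrite NE//; apply: (indep_g_sigma_algebra _ _ _ _ _ _ GE).
- by rewrite fine_ge0 ?measure_ge0.
- exact: past_and_incrementsI.
- exact: past_and_incrementsT.
- exact: past_and_increments_measurable (ltW st) _.
- rewrite -[X in measurable X]setTI; apply: measurable_increment => //; exact: ltW.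
move=> {GE}E [[E0 [A1 [mE0 mA1 ->]]]|NE']; last first.
  have PE0 : P E = 0%E by apply/(negligibleP) => //; exact: Pc.
  rewrite PE0 mul0e; apply/eqP; rewrite -measure_le0 -PE0 le_measure ?inE//.
  - apply: measurableI; first exact: Pc.
    rewrite -[X in measurable X]setTI; apply: measurable_increment => //; exact: ltW.
  - exact: Pc.
rewrite -NE//.
pose A1' (i : 'I_m) := if (i < k)%N then A1 i else setT.
pose A2 i := if i == k then A else A1' i.
have mA1' i : measurable (A1' i) by rewrite /A1'; case: ifP.
have mA2 i : measurable (A2 i) by rewrite /A2; case: ifP.
case: BM => _ _ _ indep.
rewrite [X in P X](_ : _ = E0 `&` [set w | forall i, A2 i (B t w i ord0 - B s w i ord0)]); last first.
  apply/seteqP; split => w /=.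
    move=> [[Ew H] Aw]; split => // i; rewrite /A2 /A1'.
    by case: eqP => [->//|_]; case: ifP => // /H.
  move=> [Ew H]; split.
    split => // i ik; have := H i; rewrite /A2 /A1' ik.
    by case: eqP => // iE; rewrite iE ltnn in ik.
  by have := H k; rewrite /A2 eqxx.
rewrite [X in (_ = P X * _)%E](_ : _ = E0 `&` [set w | forall i, A1' i (B t w i ord0 - B s w i ord0)]); last first.
  apply/seteqP; split => w /=.
    by move=> [Ew H]; split => // i; rewrite /A1'; case: ifP => // /H.
  by move=> [Ew H]; split => // i ik; have := H i; rewrite /A1' ik.
have A2k : A2 k = A by rewrite /A2 eqxx.
have A1k : A1' k = setT by rewrite /A1' ltnn.
rewrite !indep// -/N (bigD1 k)//= [in RHS](bigD1 k)//= A2k A1k.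
rewrite [N setT]probability_setT mul1e -muleA; congr (_ * _)%E.
rewrite muleC; congr (_ * _)%E; apply: eq_bigr => i /negbTE ik.
by rewrite /A2 ik.
Qed.

(** The one-step martingale property of the exponential. The coordinates of the increment are
    integrated out from the last to the first. *)
Lemma exp_increment (s t : R) (xi : Omega -> 'cV[R]_m) (U : Omega -> R) :
  0 <= s -> s < t -> t <= T ->
  (forall j, measurable_wrt (Ft s) (fun w => xi w j ord0)) ->
  measurable_wrt (Ft s) U -> (forall w, 0 <= U w) ->
  (\int[P]_w (U w * expR (dotv (xi w) (B t w - B s w)
                         - enorm (xi w) ^+ 2 * (t - s) / 2))%:E =
   \int[P]_w (U w)%:E)%E.
Proof.
move=> s0 st tT mxi mU U0.
(* [Uk k] keeps the factors of the first [k] coordinates. It is measurable with respect to the past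
   and these [k] increments, so [freezing] can remove the next factor. *)
pose e (i : 'I_m) w := expR (xi w i ord0 * (B t w i ord0 - B s w i ord0) -
  xi w i ord0 ^+ 2 * Num.sqrt (t - s) ^+ 2 / 2).
pose Uk k w := U w * \prod_(i < m | (i < k)%N) e i w.
have mpast k (X : Omega -> R) : measurable_wrt (Ft s) X ->
    measurable_wrt <<s past_and_increments s t k >> X.
  by move=> mX A mA; apply: Ft_past_and_increments; exact: mX.
have mUk k : measurable_wrt <<s past_and_increments s t k >> (Uk k).
  apply/measurable_wrtP; apply: measurable_funM; first by apply/measurable_wrtP; exact: mpast.
  rewrite (_ : (fun w => _) = fun w => \prod_(i < m)
    (if (i < k)%N then e i w else 1)); last by apply/funext => w; exact: big_mkcond.
  apply: (@measurable_prod _ (g_sigma_algebraType _)) => i _.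
  case: (ltnP i k) => // ik; rewrite /e; apply: measurableT_comp => //.
  have mx : measurable_fun setT
    (fun w : g_sigma_algebraType (past_and_increments s t k) => xi w i ord0).
    by apply/measurable_wrtP; exact: mpast.
  apply: measurable_funB; last first.
    by do 2 apply: measurable_funM => //; exact: measurable_funX.
  apply: measurable_funM => //; apply/measurable_wrtP => A mA.
  apply: sub_sigma_algebra; left.
  exists setT, (fun j => if j == i then A else setT); split => //.
  - exact: g_sigma_algebraT.
  - by move=> j; case: ifP.
  - rewrite setTI; apply/seteqP; split => w /= H.
      by move=> j _; case: eqP => // ->.
    by have := H i ik; rewrite eqxx.
have Uk_ge0 k w : 0 <= Uk k w.
  by rewrite mulr_ge0// prodr_ge0// => i _; exact: expR_ge0.
have EUk k : (k <= m)%N -> (\int[P]_w (Uk k w)%:E = \int[P]_w (U w)%:E)%E.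
  elim: k => [_|k IH km].
    by apply: eq_integral => w _; rewrite /Uk big_pred0 ?mulr1.
  rewrite -IH ?(ltnW km)//.
  rewrite -(@freezing _ _ _ P (past_and_increments s t k)
     (fun w => B t w (Ordinal km) ord0 - B s w (Ordinal km) ord0)
     (Num.sqrt (t - s)) (fun w => xi w (Ordinal km) ord0) (Uk k)) //.
  - apply: eq_integral => w _; congr (_ %:E); rewrite /Uk -mulrA; congr (_ * _).
    rewrite (bigD1 (Ordinal km))//= mulrC; congr (_ * _).
    by apply: eq_bigl => i; rewrite ltnS -val_eqE/= ltn_neqAle andbC.
  - exact: past_and_increments_measurable (ltW st) _.
  - exact: measurable_increment (ltW st) _.
  - by rewrite gt_eqF// sqrtr_gt0 subr_gt0.
  - by move=> E A mE mA; apply: past_and_increments_indep.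
  - exact: mpast.
rewrite -(EUk m)//; apply: eq_integral => w _; congr (_ %:E).
rewrite /Uk; congr (_ * _); rewrite (eq_bigl xpredT); last by move=> i; rewrite ltn_ord.
rewrite -expR_sum; congr expR; rewrite big_split/= sumrN; congr (_ - _).
  by apply: eq_bigr => i _; rewrite !mxE.
rewrite sqr_sqrtr ?subr_ge0 1?ltW// -!mulr_suml enorm2; do 2 congr (_ * _).
Qed.

End filtration.

(** * Passage to the limit and optional stopping *)

Section convergence.
Context d (Omega : measurableType d) (R : realType) (P : probability Omega R).
Implicit Types X : nat -> Omega -> R.

(** [F e n] is the event that the [n]-th error exceeds the tolerance [e]. Along [phi] the tolerance
    [(1 / 2) ^+ k] is violated with probability at most [1 / 2 ^ (k + 1)], and Borel-Cantelli
    applies. *)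
Lemma ae_subsequence (F : R -> nat -> set Omega) :
  (forall e n, 0 < e -> measurable (F e n)) ->
  (forall e, 0 < e -> (fun n => P (F e n)) @ \oo --> 0%E) ->
  exists phi : nat -> nat, (forall k, (k <= phi k)%N) /\
    \forall w \ae P, exists K, forall k, (K <= k)%N -> ~ F ((1 / 2) ^+ k) (phi k) w.
Proof.
move=> mF F0.
have hp k : 0 < (1 / 2 : R) ^+ k by rewrite exprn_gt0// divr_gt0.
pose q k : R := 1 / (2 ^ (k + 1))%:R.
have q0 k : 0 < q k by rewrite divr_gt0// ltr0n expn_gt0.
have /choice[phi hphi] k : exists n, (k <= n)%N /\ (P (F ((1/2)%R ^+ k)%R n) <= (q k)%:E)%E.
  have := F0 _ (hp k); move/fine_cvgP => [fin /cvgrPdist_lt /(_ _ (q0 k))] h.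
  near \oo => n.
  exists n; split; first by near: n; exact: nbhs_infty_ge.
  have f : P (F ((1 / 2) ^+ k) n) \is a fin_num by near: n.
  have : `|0 - fine (P (F ((1 / 2) ^+ k) n))| < q k by near: n.
  rewrite sub0r normrN ger0_norm ?fine_ge0// => /ltW.
  by rewrite -lee_fin fineK.
exists phi; split; first by move=> k; have [] := hphi k.
pose G k := F ((1 / 2) ^+ k) (phi k).
have mG k : measurable (G k) by exact: mF.
have : P (lim_sup_set G) = 0%E.
  apply: lim_sup_set_cvg0 => //.
  apply: (@le_lt_trans _ _ (\sum_(0 <= k <oo) (q k)%:E)%E).
    by apply: lee_nneseries => // k _; have [] := hphi k.
  have /cvg_lim -> // := @cvg_geometric_eseries_half R 1 0.
  by rewrite ltry.
move=> lG; exists (lim_sup_set G); split => //.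
  by apply: bigcap_measurable => // n _; apply: bigcup_measurable.
move=> w /= nw; rewrite /lim_sup_set/= => n _.
apply: contrapT => H; apply: nw; exists n => k nk Fk; apply: H; exists k => //.
Unshelve. all: by end_near. Qed.

Lemma ge0_bounded_cvg X (Y : Omega -> R) (c : R) :
  (forall k, measurable_fun setT (X k)) -> measurable_fun setT Y ->
  (forall k w, 0 <= X k w <= c) -> (\forall w \ae P, X ^~ w @ \oo --> Y w) ->
  (fun k => \int[P]_w (X k w)%:E)%E @ \oo --> (\int[P]_w (Y w)%:E)%E.
Proof.
move=> mX mY X0c XY.
have mX' k : measurable_fun setT (fun w => (X k w)%:E) by exact/measurable_EFinP.
have mY' : measurable_fun setT (fun w => (Y w)%:E) by exact/measurable_EFinP.
have XY' : {ae P, forall w, setT w -> (fun k => (X k w)%:E) @ \oo --> (Y w)%:E}.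
  by apply: filterS XY => w h _; apply/cvg_EFin; [exact: nearW|exact: h].
have Xc : {ae P, forall w, forall k, setT w -> (`|(X k w)%:E| <= c%:E)%E}.
  by apply: nearW => w k _; have /andP[? ?] := X0c k w; rewrite /= lee_fin ger0_norm.
have ic := finite_measure_integrable_cst P c measurableT.
by have [] := dominated_convergence measurableT mX' mY' XY' ic Xc.
Qed.

(** Fatou's lemma, after the limit is identified almost everywhere with the lower limit. *)
Lemma ae_fatou_le X (Y : Omega -> R) (e : \bar R) :
  (forall k, measurable_fun setT (X k)) -> measurable_fun setT Y ->
  (forall k w, 0 <= X k w) -> (forall w, 0 <= Y w) ->
  (\forall w \ae P, X ^~ w @ \oo --> Y w) ->
  (forall k, \int[P]_w (X k w)%:E <= e)%E -> (\int[P]_w (Y w)%:E <= e)%E.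
Proof.
move=> mX mY X0 Y0 XY Xe.
have mX' k : measurable_fun setT (fun w => (X k w)%:E) by exact/measurable_EFinP.
have X0' k w : setT w -> (0 <= (X k w)%:E)%E by rewrite lee_fin.
apply: (@le_trans _ _ (\int[P]_w limn_einf (fun k => (X k w)%:E))%E).
  rewrite le_eqVlt; apply/orP; left; apply/eqP; apply: ge0_ae_eq_integral => //.
  - exact/measurable_EFinP.
  - rewrite /limn_einf; apply: measurableT_comp => //.
    apply: measurable_fun_limn_esup => k; exact: measurableT_comp.
  - by move=> w _; rewrite lee_fin.
  - move=> w _; rewrite limn_einf_lim; apply: lime_ge; first exact: is_cvg_einfs.
    by apply: nearW => n; apply: le_ereal_inf_tmp => _ [k _ <-]; exact: X0'.
  - apply: filterS XY => w h _; apply/esym; apply: (cvg_limn_einf_sup _).1.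
    by apply/cvg_EFin => //; exact: nearW.
apply: le_trans (fatou _ _ mX' X0') _ => //.
rewrite limn_einf_lim; apply: lime_le; first exact: is_cvg_einfs.
apply: nearW => n; apply: le_trans (Xe n).
apply: ereal_inf_lbound; exists n => //=.
Qed.

Lemma cvg_min_cst (u : nat -> R) (l c : R) : u @ \oo --> l ->
  (fun k => Num.min (u k) c) @ \oo --> Num.min l c.
Proof.
move=> /cvgrPdist_le h; apply/cvgrPdist_le => e /h; apply: filterS => k.
rewrite !ler_norml.
by case: (lerP l c) => ?; case: (lerP (u k) c) => ? /andP[? ?]; apply/andP; split; lra.
Qed.

(** Vitali's theorem. Each variable is split into its minimum with a level [c] and the excess. The
    truncated parts converge boundedly; the excesses of the [X k] are uniformly small by hypothesis,
    and that of [Y] is small by Fatou. *)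
Lemma ui_cvg X (Y : Omega -> R) :
  (forall k, measurable_fun setT (X k)) -> measurable_fun setT Y ->
  (forall k w, 0 <= X k w) -> (forall w, 0 <= Y w) ->
  (\forall w \ae P, X ^~ w @ \oo --> Y w) ->
  (forall e : R, 0 < e -> exists c : R, forall k,
     (\int[P]_(w in [set w | (c <= `|X k w|)%R]) `|X k w|%:E <= e%:E)%E) ->
  (fun k => \int[P]_w (X k w)%:E)%E @ \oo --> (\int[P]_w (Y w)%:E)%E.
Proof.
move=> mX mY X0 Y0 XY UI.
have mE (Z : Omega -> R) : measurable_fun setT Z -> measurable_fun setT (EFin \o Z).
  by move=> ?; exact/measurable_EFinP.
have mmin (Z : Omega -> R) (c : R) : measurable_fun setT Z ->
   measurable_fun setT (fun w => Num.min (Z w) c).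
  by move=> mZ; apply: measurable_minr.
have splitE (Z : Omega -> R) (c : R) : measurable_fun setT Z -> (forall w, 0 <= Z w) -> 0 <= c ->
  (\int[P]_w (Z w)%:E = \int[P]_w (Num.min (Z w) c)%:E +
     \int[P]_w (Z w - Num.min (Z w) c)%:E)%E.
  move=> mZ Z0 c0; rewrite -ge0_integralD//.
  - by apply: eq_integral => w _; rewrite -EFinD addrC subrK.
  - by move=> w _; rewrite lee_fin le_min Z0.
  - exact/mE/mmin.
  - by move=> w _; rewrite lee_fin subr_ge0 ge_min lexx.
  - by apply/mE; apply: measurable_funB => //; exact: mmin.
have UI' e : 0 < e -> exists c, 0 <= c /\ (forall k, \int[P]_w (X k w - Num.min (X k w) c)%:E <= e%:E)%E.
  move=> /UI[c hc]; exists (Num.max c 0); split; first by rewrite le_max lexx orbT.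
  move=> k; apply: le_trans (hc k).
  rewrite [leRHS]integral_mkcond; apply: ge0_le_integral => //.
  - by move=> w _; rewrite lee_fin subr_ge0 ge_min lexx.
  - by apply/mE; apply: measurable_funB => //; exact: mmin.
  - apply/(measurable_restrictT _ _).1 => //.
      rewrite -[X in measurable X]setTI; apply: measurable_fun_le => //.
      exact: measurableT_comp.
    by apply: measurable_funTS; do 2 apply: measurableT_comp.
  - move=> w _; rewrite patchE; case: ifPn => [|].
      rewrite inE/= => _; rewrite lee_fin ger0_norm// gerBl le_min X0 le_max lexx orbT//.
    rewrite notin_setE/= ger0_norm// => /negP; rewrite -ltNge => h.
    by rewrite min_l ?subrr// ltW// lt_max h.
have UIY e c : (forall k, \int[P]_w (X k w - Num.min (X k w) c)%:E <= e%:E)%E ->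
  (\int[P]_w (Y w - Num.min (Y w) c)%:E <= e%:E)%E.
  move=> hc.
  apply: (@ae_fatou_le (fun k w => X k w - Num.min (X k w) c)) => //.
  - by move=> k; apply: measurable_funB => //; exact: mmin.
  - by apply: measurable_funB => //; exact: mmin.
  - by move=> k w; rewrite subr_ge0 ge_min lexx.
  - by move=> w; rewrite subr_ge0 ge_min lexx.
  - apply: filterS XY => w h; apply: cvgB => //.
    exact: cvg_min_cst.
have finle (x : \bar R) (e : R) : (0 <= x)%E -> (x <= e%:E)%E -> x = (fine x)%:E.
  by move=> x0 xe; rewrite fineK// ge0_fin_numE// (le_lt_trans xe)// ltry.
have minfin (Z : Omega -> R) (c : R) : measurable_fun setT Z -> (forall w, 0 <= Z w) -> 0 <= c ->
  (0 <= \int[P]_w (Num.min (Z w) c)%:E <= c%:E)%E.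
  move=> mZ Z0 c0; apply/andP; split.
    by apply: integral_ge0 => w _; rewrite lee_fin le_min Z0.
  apply: (@le_trans _ _ (\int[P]_w c%:E)%E); last first.
    by rewrite integral_cst// [X in (_ * X)%E](_ : _ = 1%E) ?mule1//; exact: probability_setT.
  apply: ge0_le_integral => //.
  - by move=> w _; rewrite lee_fin le_min Z0.
  - exact/mE/mmin.
  - by move=> w _; rewrite lee_fin ge_min lexx orbT.
have ge0B (Z : Omega -> R) c : (0 <= \int[P]_w (Z w - Num.min (Z w) c)%:E)%E.
  by apply: integral_ge0 => w _; rewrite lee_fin subr_ge0 ge_min lexx.
have fE (Z : Omega -> R) c e : measurable_fun setT Z -> (forall w, 0 <= Z w) -> 0 <= c ->
    (\int[P]_w (Z w - Num.min (Z w) c)%:E <= e%:E)%E ->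
  exists2 r, 0 <= r <= e &
    (\int[P]_w (Z w)%:E = (fine (\int[P]_w (Num.min (Z w) c)%:E) + r)%:E)%E.
  move=> mZ Z0 c0 h; have /andP[m0 mc] := minfin Z c mZ Z0 c0.
  exists (fine (\int[P]_w (Z w - Num.min (Z w) c)%:E)%E).
    rewrite fine_ge0 ?ge0B//= -lee_fin -(finle _ e)//; exact: ge0B.
  by rewrite (splitE Z c)// EFinD -(finle _ c)// -(finle _ e)//; exact: ge0B.
have [c [c0 hc]] := UI' 1 ltr01.
have XfinE k : (\int[P]_w (X k w)%:E = (fine (\int[P]_w (X k w)%:E))%:E)%E.
  by have [r _ ->] := fE (X k) c 1 (mX k) (X0 k) c0 (hc k).
have [r _ YE] := fE Y c 1 mY Y0 c0 (UIY _ _ hc).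
have YfinE : (\int[P]_w (Y w)%:E = (fine (\int[P]_w (Y w)%:E))%:E)%E.
  by rewrite YE.
rewrite YfinE; apply/fine_cvgP; split.
  by apply: nearW => k; rewrite XfinE.
apply/cvgrPdist_le => e e0 /=.
have e2 : 0 < e / 2 by rewrite divr_gt0.
have {hc c c0 r YE}[c [c0 hc]] := UI' _ e2.
have [r /andP[r0 re] YE] := fE Y c _ mY Y0 c0 (UIY _ _ hc).
have : (fun k => \int[P]_w (Num.min (X k w) c)%:E)%E @ \oo -->
    (\int[P]_w (Num.min (Y w) c)%:E)%E.
  apply: (@ge0_bounded_cvg _ _ c).
  - by move=> k; exact: mmin.
  - exact: mmin.
  - by move=> k w; rewrite le_min X0 c0/= ge_min lexx orbT.
  - by apply: filterS XY => w h; exact: cvg_min_cst.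
rewrite [X in _ --> X -> _](finle _ c)//; try by have /andP[] := minfin Y c mY Y0 c0.
move=> /fine_cvgP[_ /cvgrPdist_le /(_ _ e2)]; apply: filterS => k /=.
have [rk /andP[rk0 rke] ->] := fE (X k) c _ (mX k) (X0 k) c0 (hc k).
rewrite YE /= ler_norml => /andP[h1 h2].
by rewrite ler_norml; move: h1 h2; set A := fine _; set A' := fine _; lra.
Qed.

(** On the tail event [|Z| <= Z^2 / c]. *)
Lemma l2_tail (Z : Omega -> R) (K c : R) : measurable_fun setT Z -> 0 < c ->
  (\int[P]_w (Z w ^+ 2)%:E <= K%:E)%E ->
  (\int[P]_(w in [set w | (c <= `|Z w|)%R]) `|Z w|%:E <= (K / c)%:E)%E.
Proof.
move=> mZ c0 ZK; rewrite integral_mkcond.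
apply: (@le_trans _ _ (\int[P]_w ((c^-1)%:E * (Z w ^+ 2)%:E))%E).
  apply: ge0_le_integral => //.
  - by move=> w _; rewrite patchE; case: ifP => // _; rewrite lee_fin.
  - apply/(measurable_restrictT _ _).1 => //.
      rewrite -[X in measurable X]setTI; apply: measurable_fun_le => //.
      exact: measurableT_comp.
    by apply: measurable_funTS; do 2 apply: measurableT_comp.
  - apply/measurable_EFinP; apply: measurable_funM => //; exact: measurable_funX.
  - move=> w _; rewrite patchE; case: ifPn => [|_].
      rewrite inE/= => cZ; rewrite -EFinM lee_fin mulrC ler_pdivlMr//.
      by rewrite -[leRHS]ger0_norm ?sqr_ge0// normrX expr2 ler_wpM2l.
    by rewrite -EFinM lee_fin mulr_ge0// ?sqr_ge0// invr_ge0 ltW.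
rewrite ge0_integralZl//.
- by rewrite mulrC EFinM; apply: lee_wpmul2l => //; rewrite lee_fin invr_ge0 ltW.
- apply/measurable_EFinP; exact: measurable_funX.
- by move=> w _; rewrite lee_fin sqr_ge0.
- by rewrite lee_fin invr_ge0 ltW.
Qed.

Lemma l2_cvg X (Y : Omega -> R) (K : R) :
  (forall k, measurable_fun setT (X k)) -> measurable_fun setT Y ->
  (forall k w, 0 <= X k w) -> (forall w, 0 <= Y w) ->
  (\forall w \ae P, X ^~ w @ \oo --> Y w) ->
  (forall k, \int[P]_w (X k w ^+ 2)%:E <= K%:E)%E ->
  (fun k => \int[P]_w (X k w)%:E)%E @ \oo --> (\int[P]_w (Y w)%:E)%E.
Proof.
move=> mX mY X0 Y0 XY XK; apply: ui_cvg => // e e0.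
have M0 : 0 < Num.max K 1 by rewrite lt_max ltr01 orbT.
(* At this level the tail bound of [l2_tail] is at most [e]; the maximum keeps the level
   positive. *)
exists (Num.max K 1 / e) => k.
apply: le_trans (l2_tail (mX k) _ (XK k)) _; first by rewrite divr_gt0.
rewrite lee_fin invf_div mulrCA ler_piMr ?(ltW e0)//.
by rewrite ler_pdivrMr// mul1r le_max lexx.
Qed.

End convergence.

Section complete_filtration.
Context d (Omega : measurableType d) (R : realType) (P : probability Omega R).
Context (G : set (set Omega)).
Hypothesis GN : forall N, P.-negligible N -> <<s G >> N.

Lemma measurable_wrt_ae_eq (f g : Omega -> R) :
  measurable_wrt <<s G >> f -> (\forall w \ae P, f w = g w) ->
  measurable_wrt <<s G >> g.
Proof.
move=> mf fg A mA; pose N := [set w | f w <> g w].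
have nN : P.-negligible N.
  by apply: negligibleS fg => w /= h; exact: h.
rewrite (_ : g @^-1` A = (f @^-1` A `&` ~` N) `|` (g @^-1` A `&` N)); last first.
  apply/seteqP; split => w /=.
    move=> Ag; have [Nw|Nw] := pselect (N w); [right|left] => //.
    by split => //; move: Nw; rewrite /N/= => /contrapT ->.
  by move=> [[Af /contrapT <-//]|[]].
apply: (@measurableU _ (g_sigma_algebraType G)).
- apply: (@measurableI _ (g_sigma_algebraType G)); first exact: mf.
  by apply: (@measurableC _ (g_sigma_algebraType G)); exact: GN.
- by apply: GN; apply: negligibleS nN; exact: subIsetr.
Qed.

(** Multiplying by the indicator of the set of convergence, which belongs to the sigma-algebra,
    produces a sequence that converges everywhere. *)
Lemma measurable_wrt_ae_cvg (X : nat -> Omega -> R) (Y : Omega -> R) :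
  (forall k, measurable_wrt <<s G >> (X k)) -> (\forall w \ae P, X ^~ w @ \oo --> Y w) ->
  measurable_wrt <<s G >> Y.
Proof.
move=> mX XY; pose N := [set w | ~ (X ^~ w @ \oo --> Y w)].
have nN : P.-negligible N by exact: XY.
have mN : <<s G >> N by exact: GN.
pose X' k w := X k w * \1_(~` N) w.
apply: (@measurable_wrt_ae_eq (fun w => Y w * \1_(~` N) w)); last first.
  by apply: filterS XY => w h; rewrite indicE mem_set ?mulr1//= => /(_ h).
apply/measurable_wrtP; apply: (@measurable_fun_cvg _ (g_sigma_algebraType G) R setT X').
  move=> k; apply: measurable_funM; first by apply/measurable_wrtP; exact: mX.
  by apply: measurable_indic; exact: (@measurableC _ (g_sigma_algebraType G)).
move=> w _; rewrite /X' indicE; case: (pselect (N w)) => Nw.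
  have -> : (w \in ~` N) = false by apply: memNset => h; exact: h.
  by rewrite mulr0; under eq_cvg do rewrite mulr0; exact: cvg_cst.
have -> : (w \in ~` N) = true by apply: mem_set.
by rewrite mulr1; under eq_cvg do rewrite mulr1; exact: contrapT.
Qed.

End complete_filtration.

Lemma measurable_fun_ae_cvg d (Omega : measurableType d) (R : realType)
    (P : probability Omega R) (X : nat -> Omega -> R) (Y : Omega -> R) :
  measure_is_complete P ->
  (forall k, measurable_fun setT (X k)) -> (\forall w \ae P, X ^~ w @ \oo --> Y w) ->
  measurable_fun setT Y.
Proof.
move=> Pc mX XY.
have e : <<s @measurable _ Omega >> = measurable by apply: sigma_algebra_id; exact: sigma_algebra_measurable.
move=> _ A mA; rewrite setTI -e; apply: (@measurable_wrt_ae_cvg _ _ _ P measurable) XY _ mA.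
  by move=> N NN; rewrite e; exact: Pc.
by move=> k D mD; rewrite e -[X in measurable X]setTI; exact: mX.
Qed.

Lemma measurable_fun_ae_eq d (Omega : measurableType d) (R : realType)
    (P : probability Omega R) (f g : Omega -> R) :
  measure_is_complete P -> measurable_fun setT f -> (\forall w \ae P, f w = g w) ->
  measurable_fun setT g.
Proof.
move=> Pc mf fg; apply: (@measurable_fun_ae_cvg _ _ _ P (fun=> f)) => //.
by apply: filterS fg => w ->; exact: cvg_cst.
Qed.

Lemma within_continuousP (R : realType) (a b : R) (f : R -> R) (s e : R) :
  {within `[a, b], continuous f} -> a <= s <= b -> 0 < e ->
  exists2 r, 0 < r & forall t, a <= t <= b -> `|t - s| < r -> `|f s - f t| <= e.
Proof.
move=> /subspace_continuousP cf sab e0.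
have /cvgrPdist_le /(_ _ e0) : f @ within `[a, b] (nbhs s) --> f s.
  by apply: cf; rewrite /= in_itv/=.
rewrite /prop_near1 /within/= => /nbhs_ballP[r r0 hr].
exists r => // t tab ts; apply: hr; last by rewrite /= in_itv/=.
by rewrite /ball/= distrC.
Qed.

(** * Discretization of stopping times *)

Section stopping.
Context d (Omega : measurableType d) (R : realType) (P : probability Omega R).
Context (T : R) (m : nat) (B : R -> Omega -> 'cV[R]_m).
Hypothesis Pc : measure_is_complete P.
Hypothesis BM : brownian_motion P T B.
Hypothesis T0 : 0 < T.

Local Notation Ft := (augmented_filtration P B).
Local Notation adapted := (adapted P T B).
Local Notation stopping_time := (stopping_time P T B).

Lemma Ft_negligible t N : P.-negligible N -> Ft t N.
Proof. by move=> nN; apply: sub_sigma_algebra; right. Qed.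

Lemma measurable_wrt_Ft t (X : Omega -> R) : t <= T -> measurable_wrt (Ft t) X -> measurable_fun setT X.
Proof. by move=> tT mX _ A mA; rewrite setTI; apply: (Ft_measurable Pc BM tT); exact: mX. Qed.

Lemma measurable_wrt_FtS s t (X : Omega -> R) : s <= t -> measurable_wrt (Ft s) X -> measurable_wrt (Ft t) X.
Proof. by move=> st mX A mA; apply: (FtS st); exact: mX. Qed.

Lemma adapted_measurable X t : adapted X -> 0 <= t <= T -> measurable_fun setT (X t).
Proof. by move=> aX tT; apply: (@measurable_wrt_Ft t); [case/andP: tT|exact: aX]. Qed.

Definition gridpt (N j : nat) : R := T * j%:R / N.+1%:R.

(** The event that the [j]-th grid point is the first one at or after [tau]. *)
Definition gridset (tau : Omega -> R) (N j : nat) : set Omega :=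
  [set w | tau w <= gridpt N j] `&` ~` [set w | exists i, (i < j)%N /\ tau w <= gridpt N i].

(** The value of [V] at the first grid point at or after [tau]; approximation from the right keeps
    the events [gridset] in the filtration at the grid time. The indices run from 0 to [N.+1], so
    that time [T] is included. *)
Definition sample (tau : Omega -> R) (N : nat) (V : R -> Omega -> R) (w : Omega) : R :=
  \sum_(j < N.+2) V (gridpt N j) w * \1_(gridset tau N j) w.

Lemma gridpt_itv N j : (j <= N.+1)%N -> 0 <= gridpt N j <= T.
Proof.
move=> jN; rewrite /gridpt divr_ge0 ?mulr_ge0 ?(ltW T0) ?ler0n//=.
by rewrite ler_pdivrMr ?ltr0n// ler_pM2l// ler_nat.
Qed.

Lemma Ft_gridset tau N j : stopping_time tau -> (j <= N.+1)%N -> Ft (gridpt N j) (gridset tau N j).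
Proof.
move=> [_ st] jN; apply: (@measurableI _ (g_sigma_algebraType (Ft_gen P B (gridpt N j)))).
  by apply: st; exact: gridpt_itv.
apply: (@measurableC _ (g_sigma_algebraType (Ft_gen P B (gridpt N j)))).
rewrite (_ : [set _ | _] = \bigcup_(i in [set i | (i < j)%N]) [set w | tau w <= gridpt N i]).
  apply: (@bigcup_measurable _ (g_sigma_algebraType (Ft_gen P B (gridpt N j)))) => i /= ij.
  apply: (@FtS _ _ _ P _ B (gridpt N i)).
    by rewrite /gridpt ler_pM2r ?invr_gt0 ?ltr0n// ler_pM2l// ler_nat ltnW.
  by apply: st; apply: gridpt_itv; rewrite (leq_trans _ jN)// ltnW.
by apply/seteqP; split => w /=; [move=> [i [ij h]]; exists i|move=> [i ij h]; exists i].
Qed.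

(** The same time [t] serves every process [V], so pathwise inequalities between processes pass to
    their samples. *)
Lemma sampleE tau N w : 0 <= tau w <= T ->
  exists t, [/\ 0 <= t <= T, tau w <= t, t - tau w <= T / N.+1%:R &
    forall V, sample tau N V w = V t w].
Proof.
move=> /andP[tau0 tauT].
have ex : exists j, tau w <= gridpt N j.
  by exists N.+1; rewrite /gridpt mulfK// pnatr_eq0.
have gN : tau w <= gridpt N N.+1 by rewrite /gridpt mulfK// pnatr_eq0.
pose j := ex_minn ex.
have [jle jmin] : tau w <= gridpt N j /\ forall i, tau w <= gridpt N i -> (j <= i)%N.
  by rewrite /j; case: ex_minnP.
have jN : (j <= N.+1)%N by exact: jmin.
exists (gridpt N j); split => //; first exact: gridpt_itv.
  have [->|j0] := posnP j.
    by rewrite /gridpt mulr0 mul0r sub0r (le_trans (y := 0)) ?oppr_le0// divr_ge0// ltW.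
  have : ~~ (tau w <= gridpt N j.-1).
    by apply/negP => /jmin; rewrite leqNgt prednK ?leqnn.
  rewrite -ltNge => h; rewrite lerBlDr -lerBlDl; apply: le_trans (ltW h).
  rewrite /gridpt -{1}(prednK j0) -natr1 mulrDr mulrDl mulr1 addrK//.
move=> V; rewrite /sample (bigD1 (Ordinal (jN : (j < N.+2)%N)))//=.
rewrite indicE mem_set ?mulr1; last first.
  by split => //= -[i [ij /jmin]]; rewrite leqNgt ij.
rewrite big1 ?addr0// => i ij.
rewrite indicE memNset ?mulr0// => -[/= ti].
move: (jmin _ ti); rewrite leq_eqVlt => /orP[/eqP ji|ji].
  by move: ij; rewrite -val_eqE/= ji eqxx.
by apply; exists j.
Qed.

Lemma measurable_sample tau N V : stopping_time tau -> adapted V ->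
  measurable_fun setT (sample tau N V).
Proof.
move=> st aV; apply: measurable_sum => j.
apply: measurable_funM.
  by apply: adapted_measurable => //; apply: gridpt_itv; rewrite -ltnS.
apply: measurable_indic; apply: (@Ft_measurable _ _ _ P T m B Pc BM (gridpt N j)).
  by have /andP[] : 0 <= gridpt N j <= T by apply: gridpt_itv; rewrite -ltnS.
by apply: Ft_gridset => //; rewrite -ltnS.
Qed.

Lemma cvg_sample tau V : (forall w, 0 <= tau w <= T) -> continuous_paths P T V ->
  \forall w \ae P, (fun N => sample tau N V w) @ \oo --> V (tau w) w.
Proof.
move=> tauT; apply: filterS => w cV.
apply/cvgrPdist_le => e e0; have [r r0 hr] := within_continuousP cV (tauT w) e0.
near=> N; have [t [tt taut tr ->]] := sampleE N (tauT w).
apply: hr => //.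
rewrite ger0_norm ?subr_ge0//.
apply: le_lt_trans tr _; rewrite ltr_pdivrMr ?ltr0n// mulrC -ltr_pdivrMr//.
near: N; apply: filterS (nbhs_infty_gtr (T / r)) => N /lt_trans; apply.
by rewrite ltr_nat.
Unshelve. all: by end_near. Qed.

(** The stopped value is the limit of the samples on every continuous path, that is almost
    everywhere, and completeness of [P] does the rest. *)
Lemma measurable_stopped tau V : stopping_time tau -> adapted V -> continuous_paths P T V ->
  measurable_fun setT (fun w => V (tau w) w).
Proof.
move=> st aV cV; apply: (measurable_fun_ae_cvg (P := P) (X := fun N => sample tau N V)) => //.
  by move=> N; exact: measurable_sample.
by apply: cvg_sample => //; case: st.
Qed.

(** The events [gridset] partition the sample space and each belongs to the filtration at its grid
    time, where the martingale property replaces [V] at that time by [V T]. *)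
Lemma integral_sample tau N V : stopping_time tau -> adapted V ->
  (forall t w, 0 <= t <= T -> 0 <= V t w) ->
  (forall t A, 0 <= t <= T -> Ft t A ->
    (\int[P]_w (\1_A w * V T w)%:E)%E = (\int[P]_w (\1_A w * V t w)%:E)%E) ->
  (\int[P]_w (sample tau N V w)%:E = \int[P]_w (V T w)%:E)%E.
Proof.
move=> st aV V0 VT.
have TT : 0 <= T <= T by rewrite lexx ltW.
have mG (j : 'I_N.+2) : measurable (gridset tau N j).
  apply: (@Ft_measurable _ _ _ P T m B Pc BM (gridpt N j)).
    by have /andP[] : 0 <= gridpt N j <= T by apply: gridpt_itv; rewrite -ltnS.
  by apply: Ft_gridset => //; rewrite -ltnS.
under eq_integral do rewrite -sumEFin.
rewrite ge0_integral_sum//; last 2 first.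
- move=> j; apply/measurable_EFinP; apply: measurable_funM; last exact: measurable_indic.
  by apply: adapted_measurable => //; apply: gridpt_itv; rewrite -ltnS.
- by move=> j w _; rewrite lee_fin mulr_ge0// V0//; apply: gridpt_itv; rewrite -ltnS.
transitivity (\sum_(j < N.+2) \int[P]_w (\1_(gridset tau N j) w * V T w)%:E)%E.
  apply: eq_bigr => j _; rewrite (VT (gridpt N j)).
  - by apply: eq_integral => w _; rewrite mulrC.
  - by apply: gridpt_itv; rewrite -ltnS.
  - by apply: Ft_gridset => //; rewrite -ltnS.
rewrite -ge0_integral_sum//; last 2 first.
- move=> j; apply/measurable_EFinP; apply: measurable_funM; first exact: measurable_indic.
  exact: adapted_measurable.
- by move=> j w _; rewrite lee_fin mulr_ge0// V0.
apply: eq_integral => w _; rewrite sumEFin -mulr_suml; congr (_ %:E).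
have [st1 _] := st.
have [t [_ _ _ h]] := sampleE N (st1 w).
(* Sampling the constant process 1 shows that the indicators of the events add up to 1. *)
have := h (fun _ _ => 1); rewrite /sample => {}h.
by rewrite -[RHS]mul1r -h; congr (_ * _); apply: eq_bigr => j _; rewrite mul1r.
Qed.

(** The samples of [M] all have the expectation of [M T]. Their squares are dominated by [c] times
    the samples of the second martingale [M2], whose expectation is 1, so they are bounded in L2 and
    the limit of the grid can be taken inside the expectation. *)
Lemma optional_stopping tau (M M2 : R -> Omega -> R) (c : R) :
  stopping_time tau -> adapted M -> adapted M2 -> continuous_paths P T M ->
  (forall t w, 0 <= t <= T -> 0 <= M t w) ->
  (forall t w, 0 <= t <= T -> 0 <= M2 t w) ->
  (forall t A, 0 <= t <= T -> Ft t A ->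
    (\int[P]_w (\1_A w * M T w)%:E)%E = (\int[P]_w (\1_A w * M t w)%:E)%E) ->
  (forall t A, 0 <= t <= T -> Ft t A ->
    (\int[P]_w (\1_A w * M2 T w)%:E)%E = (\int[P]_w (\1_A w * M2 t w)%:E)%E) ->
  (\int[P]_w (M2 T w)%:E = 1)%E -> 0 <= c ->
  (forall t w, 0 <= t <= T -> M t w ^+ 2 <= c * M2 t w) ->
  (\int[P]_w (M (tau w) w)%:E = \int[P]_w (M T w)%:E)%E.
Proof.
move=> st aM aM2 cM M0 M20 MT M2T M21 c0 MM2; have [st1 _] := st.
have Mint N : (\int[P]_w (sample tau N M w)%:E = \int[P]_w (M T w)%:E)%E.
  exact: integral_sample.
have := @l2_cvg _ _ _ P (fun N => sample tau N M) (fun w => M (tau w) w) c.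
move=> H; have {}H : (\int[P]_w (sample tau k M w)%:E)%E @[k --> \oo] --> (\int[P]_w (M (tau w) w)%:E)%E.
  apply: H.
  - by move=> N; exact: measurable_sample.
  - exact: measurable_stopped.
  - by move=> N w; have [t [tT _ _ ->]] := sampleE N (st1 w); exact: M0.
  - by move=> w; exact: M0.
  - exact: cvg_sample.
  - move=> N; apply: (@le_trans _ _ (\int[P]_w (c%:E * (sample tau N M2 w)%:E))%E).
      apply: ge0_le_integral => //.
      + by move=> w _; rewrite lee_fin sqr_ge0.
      + by apply/measurable_EFinP; apply: measurable_funX; exact: measurable_sample.
      + apply/measurable_EFinP; apply: measurable_funM => //; exact: measurable_sample.
      + move=> w _; have [t [tT _ _ h]] := sampleE N (st1 w).
        by rewrite !h -EFinM lee_fin; exact: MM2.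
    rewrite ge0_integralZl//.
    + by rewrite integral_sample// M21 mule1.
    + by apply/measurable_EFinP; exact: measurable_sample.
    + by move=> w _; have [t [tT _ _ ->]] := sampleE N (st1 w); rewrite lee_fin; exact: M20.
by apply/esym; move: H; under eq_fun do rewrite Mint; move=> /cvg_lim <- //; rewrite lim_cst.
Qed.

End stopping.

(** * Continuity on a compact interval *)

Section within_continuity.
Context (R : realType) (a b : R).
Implicit Types f g : R -> R.

Lemma continuous_withinP f :
  (forall s, a <= s <= b -> forall e, 0 < e ->
    exists2 r, 0 < r & forall t, a <= t <= b -> `|t - s| < r -> `|f s - f t| <= e) ->
  {within `[a, b], continuous f}.
Proof.
move=> h; apply/subspace_continuousP => s; rewrite /= in_itv/= => sab.
apply/cvgrPdist_le => e /(h _ sab)[r r0 hr].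
rewrite /prop_near1 /within/=; apply/nbhs_ballP; exists r => // t ts.
by rewrite in_itv/= => tab; apply: hr => //; rewrite distrC.
Qed.

Lemma within_continuousD f g : {within `[a, b], continuous f} ->
  {within `[a, b], continuous g} -> {within `[a, b], continuous (fun t => f t + g t)}.
Proof.
move=> /subspace_continuousP cf /subspace_continuousP cg.
by apply/subspace_continuousP => s sab; apply: cvgD; [exact: cf|exact: cg].
Qed.

Lemma within_continuousM f g : {within `[a, b], continuous f} ->
  {within `[a, b], continuous g} -> {within `[a, b], continuous (fun t => f t * g t)}.
Proof.
move=> /subspace_continuousP cf /subspace_continuousP cg.
by apply/subspace_continuousP => s sab; apply: cvgM; [exact: cf|exact: cg].
Qed.

Lemma within_continuousN f : {within `[a, b], continuous f} ->
  {within `[a, b], continuous (fun t => - f t)}.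
Proof.
move=> /subspace_continuousP cf.
by apply/subspace_continuousP => s sab; apply: cvgN; exact: cf.
Qed.

Lemma within_continuous_cst (c : R) : {within `[a, b], continuous (fun=> c)}.
Proof. by apply/subspace_continuousP => s _; exact: cvg_cst. Qed.

Lemma within_continuous_expR f : {within `[a, b], continuous f} ->
  {within `[a, b], continuous (fun t => expR (f t))}.
Proof.
move=> /subspace_continuousP cf; apply/subspace_continuousP => s sab.
exact: continuous_cvg (@continuous_expR _ _) (cf _ sab).
Qed.

Lemma within_continuous_sum (I : Type) (r : seq I) (Q : pred I) (F : I -> R -> R) :
  (forall i, Q i -> {within `[a, b], continuous (F i)}) ->
  {within `[a, b], continuous (fun t => \sum_(i <- r | Q i) F i t)}.
Proof.
move=> cF; elim: r => [|x r IH].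
  by under [X in {within _, continuous X}]eq_fun do rewrite big_nil; exact: within_continuous_cst.
under [X in {within _, continuous X}]eq_fun do rewrite big_cons.
by case: (boolP (Q x)) => [Qx|_]; [apply: within_continuousD => //; exact: cF|].
Qed.

Lemma within_continuous_min f (c : R) : {within `[a, b], continuous f} -> a <= c <= b ->
  {within `[a, b], continuous (fun t => f (Num.min c t))}.
Proof.
move=> cf cab; have minab t : a <= t <= b -> a <= Num.min c t <= b.
  by move: cab => /andP[? ?] /andP[? ?]; case: (lerP c t) => ?; apply/andP; split.
apply: continuous_withinP => s sab e e0.
have [r r0 hr] := within_continuousP cf (minab _ sab) e0.
exists r => // t tab ts; apply: hr; first exact: minab.
apply: le_lt_trans ts.
by case: (lerP c t) => ?; case: (lerP c s) => ?; rewrite ?subrr ?normr0// ler_norml;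
  case: (lerP t s) => ?; apply/andP; split; lra.
Qed.

Lemma within_continuous_eq f g : (forall t, a <= t <= b -> f t = g t) ->
  {within `[a, b], continuous f} -> {within `[a, b], continuous g}.
Proof.
move=> fg cf; apply: continuous_withinP => s sab e e0.
have [r r0 hr] := within_continuousP cf sab e0; exists r => // t tab ts.
by rewrite -!fg//; exact: hr.
Qed.

End within_continuity.

(** * Integrals of simple processes *)

Section simple_process_facts.
Context d (Omega : measurableType d) (R : realType) (P : probability Omega R).
Context (T : R) (m : nat) (B : R -> Omega -> 'cV[R]_m).
Hypothesis Pc : measure_is_complete P.
Hypothesis BM : brownian_motion P T B.
Hypothesis T0 : 0 < T.

Local Notation Ft := (augmented_filtration P B).
Local Notation adapted := (adapted P T B).
Local Notation simple_predictable := (simple_predictable P T B).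
Local Notation simple_process := (@simple_process d Omega R m).

(** The quadratic variation of [sp_integral]. *)
Definition sp_quad (S : simple_process) (t : R) (w : Omega) : R :=
  \sum_(i < sp_size S) enorm (sp_val S i w) ^+ 2 *
    (Num.min (sp_time S i.+1) t - Num.min (sp_time S i) t).

(** The stochastic exponential of the simple integral. *)
Definition sp_exp (S : simple_process) (t : R) (w : Omega) : R :=
  expR (sp_integral B S t w - sp_quad S t w / 2).

Local Notation FtT t := (g_sigma_algebraType (Ft_gen P B t)).

Lemma measurable_wrt_B s t i : 0 <= s <= t ->
  measurable_wrt (Ft t) (fun w => B s w i ord0).
Proof.
by move=> st A mA; apply: sub_sigma_algebra; left; apply: sub_sigma_algebra; exists s, i, A.
Qed.

Lemma measurable_dotv dd (X : measurableType dd) n (u v : X -> 'cV[R]_n) :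
  (forall j, measurable_fun setT (fun x => u x j ord0)) ->
  (forall j, measurable_fun setT (fun x => v x j ord0)) ->
  measurable_fun setT (fun x => dotv (u x) (v x)).
Proof.
by move=> mu mv; apply: measurable_sum => j; exact: measurable_funM.
Qed.

Section fixed_simple.
Variable S : simple_process.
Hypothesis hS : simple_predictable S.

Let tm i := sp_time S i.
Let v i := sp_val S i.
Let term i u w := dotv (v i w) (B (Num.min (tm i.+1) u) w - B (Num.min (tm i) u) w).
Let quad i u w := enorm (v i w) ^+ 2 * (Num.min (tm i.+1) u - Num.min (tm i) u).
Let z i u w := term i u w - quad i u w / 2.
(** The exponent of [sp_exp] restricted to the first [n] intervals, for the induction in
    [Z_martingale]. *)
Let Z n u w := \sum_(i < n) z i u w.

Let tm_itv i : (i <= sp_size S)%N -> 0 <= tm i <= T.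
Proof. by case: hS => h _ _ _; exact: h. Qed.

Let tmS i : (i < sp_size S)%N -> tm i <= tm i.+1.
Proof. by case: hS => _ h _ _; exact: h. Qed.

Let tm_le i j : (i <= j)%N -> (j <= sp_size S)%N -> tm i <= tm j.
Proof.
elim: j => [|j IH]; first by rewrite leqn0 => /eqP ->.
rewrite leq_eqVlt ltnS => /predU1P[->//|ij jS].
by apply: le_trans (IH ij (ltnW jS)) (tmS jS).
Qed.

(** An interval that has not begun contributes nothing. This is what makes all terms measurable at
    time [u], although [v i] is known only from time [tm i] on. *)
Let before i u w : (i < sp_size S)%N -> u <= tm i -> term i u w = 0 /\ quad i u w = 0.
Proof.
move=> iS ui; rewrite /term /quad !min_r// ?(le_trans ui (tmS iS))//.
by rewrite !subrr dotv0 mulr0.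
Qed.

Let z_before i u w : (i < sp_size S)%N -> u <= tm i -> z i u w = 0.
Proof. by move=> iS ui; rewrite /z; have [-> ->] := before w iS ui; rewrite mul0r subr0. Qed.

Let z_after i u w : (i < sp_size S)%N -> tm i.+1 <= u -> z i u w = z i (tm i.+1) w.
Proof.
move=> iS ui; have := tmS iS => h.
by rewrite /z /term /quad minxx !min_l// ?(le_trans h ui).
Qed.

Let z_during i s t w : tm i <= s -> s <= t -> t <= tm i.+1 ->
  z i t w = z i s w + (dotv (v i w) (B t w - B s w) - enorm (v i w) ^+ 2 * (t - s) / 2).
Proof.
move=> h1 h2 h3; rewrite /z /term /quad.
rewrite (min_r h3) (min_l (le_trans h1 h2)) (min_r (le_trans h2 h3)) (min_l h1).
by rewrite !dotvDr !dotvNr; field.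
Qed.

Let Z_after n u w : (n <= sp_size S)%N -> tm n <= u -> Z n u w = Z n (tm n) w.
Proof.
move=> nS nu; apply: eq_bigr => i _.
have iS : (i < sp_size S)%N by exact: leq_trans nS.
have h : tm i.+1 <= tm n by exact: tm_le.
by rewrite (z_after w iS (le_trans h nu)) [RHS]z_after.
Qed.

Let measurable_v i u j : (i < sp_size S)%N -> tm i <= u ->
  measurable_fun setT (fun w : FtT u => v i w j ord0).
Proof.
move=> iS iu; apply/measurable_wrtP; apply: (measurable_wrt_FtS iu).
by case: hS => _ _ h _; exact: h.
Qed.

Let measurable_quad i u : (i < sp_size S)%N -> 0 <= u ->
  measurable_fun setT (fun w : FtT u => quad i u w).
Proof.
move=> iS u0; have [iu|iu] := leP (tm i) u; last first.
  rewrite (_ : quad i u = cst 0); first exact: measurable_cst.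
  by apply/funext => w; have [] := before w iS (ltW iu).
rewrite /quad; under eq_fun do rewrite enorm2.
apply: measurable_funM => //; apply: measurable_dotv => j; exact: measurable_v.
Qed.

Let measurable_term i u : (i < sp_size S)%N -> 0 <= u ->
  measurable_fun setT (fun w : FtT u => term i u w).
Proof.
move=> iS u0; have [iu|iu] := leP (tm i) u; last first.
  rewrite (_ : term i u = cst 0); first exact: measurable_cst.
  by apply/funext => w; have [] := before w iS (ltW iu).
apply: measurable_dotv => j; first exact: measurable_v.
have hm k : (k <= sp_size S)%N -> measurable_fun setT (fun w : FtT u => B (Num.min (tm k) u) w j ord0).
  move=> kS; apply/measurable_wrtP; apply: measurable_wrt_B.
  by rewrite le_min u0 ge_min lexx orbT !andbT; have /andP[] := tm_itv kS.
under eq_fun do rewrite !mxE.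
by apply: measurable_funB; apply: hm => //; exact: ltnW.
Qed.

Let measurable_Z n u : (n <= sp_size S)%N -> 0 <= u ->
  measurable_fun setT (fun w : FtT u => Z n u w).
Proof.
move=> nS u0; rewrite /Z.
elim: n nS => [_|n IH nS].
  by under eq_fun do rewrite big_ord0; exact: measurable_cst.
under eq_fun do rewrite big_ord_recr/=.
apply: measurable_funD; first exact: IH (ltnW nS).
apply: measurable_funB; first exact: measurable_term.
by apply: measurable_funM => //; exact: measurable_quad.
Qed.

Lemma adapted_sp_integral : adapted (sp_integral B S).
Proof.
move=> t /andP[t0 tT]; apply/measurable_wrtP.
rewrite (_ : sp_integral B S t = fun w => \sum_(i < sp_size S) term i t w)//.
apply: (@measurable_sum _ (FtT t)) => i; exact: measurable_term.
Qed.

Lemma adapted_sp_quad : adapted (sp_quad S).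
Proof.
move=> t /andP[t0 tT]; apply/measurable_wrtP.
rewrite (_ : sp_quad S t = fun w => \sum_(i < sp_size S) quad i t w)//.
apply: (@measurable_sum _ (FtT t)) => i; exact: measurable_quad.
Qed.

Lemma adapted_sp_exp : adapted (sp_exp S).
Proof.
move=> t tT; apply/measurable_wrtP; apply: measurableT_comp => //.
apply: measurable_funB; first by apply/measurable_wrtP; exact: adapted_sp_integral.
by apply: measurable_funM => //; apply/measurable_wrtP; exact: adapted_sp_quad.
Qed.

Let sp_expE u w : sp_exp S u w = expR (Z (sp_size S) u w).
Proof. by rewrite /sp_exp /Z big_split/= sumrN -mulr_suml. Qed.

(** Induction on the number of intervals. After [tm n] only the last term moves, and [exp_increment]
    removes its increment with [U exp (Z n)] as weight. Before [tm n] the last term is zero and the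
    induction hypothesis applies. *)
Let Z_martingale n s t U : (n <= sp_size S)%N -> 0 <= s -> s <= t -> t <= T ->
  measurable_wrt (Ft s) U -> (forall w, 0 <= U w) ->
  (\int[P]_w (U w * expR (Z n t w))%:E = \int[P]_w (U w * expR (Z n s w))%:E)%E.
Proof.
elim: n s t U => [|n IH] s t U nS s0 st tT mU U0.
  by apply: eq_integral => w _; rewrite /Z !big_ord0.
have ZS u w : Z n.+1 u w = Z n u w + z n u w by rewrite /Z big_ord_recr.
have /andP[tn0 tnT] := tm_itv (ltnW nS).
have [tn|tn] := leP t (tm n).
  under eq_integral do rewrite ZS z_before// addr0.
  under [RHS]eq_integral do rewrite ZS z_before// ?addr0 ?(le_trans st)//.
  by apply: IH => //; exact: ltnW.
have tnn := tmS nS.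
(* The case in which the earlier time is already at or past [tm n]; beyond [tm n.+1] the exponent is
   constant, so the later time is capped there. *)
have later s' : tm n <= s' -> 0 <= s' -> s <= s' -> s' <= t ->
    (\int[P]_w (U w * expR (Z n.+1 t w))%:E = \int[P]_w (U w * expR (Z n.+1 s' w))%:E)%E.
  move=> tns' s'0 ss' s't; have [tn1s'|s'tn1] := leP (tm n.+1) s'.
    by apply: eq_integral => w _; rewrite !(@Z_after n.+1)// (le_trans tn1s').
  pose t' := Num.min t (tm n.+1).
  have s't' : s' <= t' by rewrite le_min s't ltW.
  have t't : t' <= t by rewrite ge_min lexx.
  have Zt w : Z n.+1 t w = Z n.+1 t' w.
    rewrite /t'; case: (leP t (tm n.+1)) => // /ltW h; exact: Z_after.
  have Zs' w : Z n.+1 t' w = Z n.+1 s' w + (dotv (v n w) (B t' w - B s' w) - enorm (v n w) ^+ 2 * (t' - s') / 2).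
    rewrite !ZS (@z_during n s' t')//; last by rewrite ge_min lexx orbT.
    by rewrite addrA !(@Z_after n)// ?(ltnW nS)// (le_trans tns').
  under eq_integral do rewrite Zt Zs' expRD mulrA.
  move: s't'; rewrite le_eqVlt => /predU1P[<-|s't'].
    by apply: eq_integral => w _; rewrite !subrr dotv0 mulr0 mul0r subr0 expR0 mulr1.
  apply: (exp_increment Pc BM) => //.
  - exact: le_trans tT.
  - move=> j; apply: (measurable_wrt_FtS tns').
    by case: hS => _ _ h _; exact: h.
  - apply/measurable_wrtP; apply: measurable_funM.
      by apply/measurable_wrtP; exact: measurable_wrt_FtS mU.
    by apply: measurableT_comp => //; exact: measurable_Z.
  - by move=> w; rewrite mulr_ge0// expR_ge0.
have [tns|stn] := leP (tm n) s; first exact: later.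
(* When [s] precedes [tm n], the expectation is first brought back from [t] to [tm n]. *)
rewrite (later (tm n) (lexx _) tn0 (ltW stn) (ltW tn)).
under eq_integral do rewrite ZS z_before// addr0.
under [RHS]eq_integral do rewrite ZS z_before ?addr0 1?ltW//.
by apply: IH => //; [exact: ltnW|exact: ltW].
Qed.

Lemma sp_exp_martingale t A : 0 <= t <= T -> Ft t A ->
  (\int[P]_w (\1_A w * sp_exp S T w)%:E)%E = (\int[P]_w (\1_A w * sp_exp S t w)%:E)%E.
Proof.
move=> /andP[t0 tT] FA; under eq_integral do rewrite sp_expE.
have mA : measurable_wrt (Ft t) (\1_A : Omega -> R).
  by apply/measurable_wrtP; exact: measurable_indic.
have A0 w : 0 <= \1_A w :> R by [].
rewrite (Z_martingale (leqnn _) t0 tT (lexx T) mA A0).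
by apply: eq_integral => w _; rewrite sp_expE.
Qed.

Lemma sp_integral0 w : sp_integral B S 0 w = 0.
Proof.
rewrite /sp_integral big1// => i _.
have [] := @before i 0 w (ltn_ord i); last by [].
by have /andP[] := tm_itv (ltnW (ltn_ord i)).
Qed.

Lemma sp_quad0 w : sp_quad S 0 w = 0.
Proof.
rewrite /sp_quad big1// => i _.
have [] := @before i 0 w (ltn_ord i); last by [].
by have /andP[] := tm_itv (ltnW (ltn_ord i)).
Qed.

Lemma integral_sp_exp : (\int[P]_w (sp_exp S T w)%:E = 1)%E.
Proof.
have := @sp_exp_martingale 0 setT; rewrite lexx (ltW T0) => /(_ isT (@g_sigma_algebraT _ _)).
under eq_integral do rewrite indicE in_setT mul1r.
move=> ->; under eq_integral do rewrite indicE in_setT mul1r /sp_exp sp_integral0 sp_quad0 mul0r subr0 expR0.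
by rewrite integral_cst// mul1e; exact: probability_setT.
Qed.

End fixed_simple.
End simple_process_facts.

Section grid_dense.
Context (R : realType).
Implicit Types (t s r c : R) (f : R -> R).

Lemma gridpt_dense t s r : 0 <= s <= t -> 0 < r ->
  exists N j, (j <= N.+1)%N /\ `|gridpt t N j - s| < r.
Proof.
move=> /andP[s0 st] r0.
have := le_trans s0 st; rewrite le_eqVlt => /predU1P[t0|t0].
  have -> : s = 0 by apply/eqP; rewrite eq_le s0 t0 st.
  by exists 0%N, 0%N; rewrite /gridpt mulr0 mul0r subrr normr0.
have [N hN] : exists N, t / r < N.+1%:R :> R.
  by exists (Num.trunc (t / r)); rewrite truncnS_gt.
pose x := s * N.+1%:R / t.
have x0 : 0 <= x by rewrite divr_ge0 ?mulr_ge0// ltW.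
have /andP[h1 h2] := truncn_itv x0.
exists N, (Num.trunc x); split.
  rewrite -ltnS -(ltr_nat R) (le_lt_trans h1)// (@le_lt_trans _ _ N.+1%:R) ?ltr_nat//.
  by rewrite /x ler_pdivrMr// mulrC ler_pM2l ?ltr0n.
have N0 : 0 < N.+1%:R :> R by rewrite ltr0n.
have tr : t / N.+1%:R < r by rewrite ltr_pdivrMr// mulrC -ltr_pdivrMr.
have e1 : gridpt t N (Num.trunc x) <= s.
  by rewrite /gridpt ler_pdivrMr// mulrC -ler_pdivlMr.
have e2 : s < gridpt t N (Num.trunc x) + t / N.+1%:R.
  by rewrite /gridpt -mulrDl -{2}(mulr1 t) -mulrDr ltr_pdivlMr// mulrC [ltRHS]mulrC -ltr_pdivrMr// mulrC natr1.
by move: e1 e2 tr; set g := gridpt _ _ _; set q := t / _ => ? ? ?; rewrite ltr_norml; apply/andP; split; lra.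
Qed.

(** Describes the exceedance of a level by countably many times, for measurability. The slack
    [n.+1%:R^-1] is there because a continuous path may reach [c] only off the grid; conversely the
    maximum over the compact interval must be at least [c]. *)
Lemma continuous_exceedance (T c t : R) f : {within `[0, T], continuous f} -> 0 <= t <= T ->
  (exists s, 0 <= s <= t /\ c <= f s) <->
  (forall n : nat, exists N j, (j <= N.+1)%N /\ c - n.+1%:R^-1 < f (gridpt t N j)).
Proof.
move=> cf /andP[t0 tT]; split.
  move=> [s [/andP[s0 st] cs]] n.
  have sT : 0 <= s <= T by rewrite s0 (le_trans st).
  have n0 : 0 < n.+1%:R^-1 / 2 :> R by rewrite divr_gt0// invr_gt0 ltr0n.
  have [r r0 hr] := within_continuousP cf sT n0.
  have s0t : 0 <= s <= t by rewrite s0.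
  have [N [j [jN h]]] := gridpt_dense s0t r0.
  exists N, j; split => //.
  have : `|f s - f (gridpt t N j)| <= n.+1%:R^-1 / 2.
    apply: hr => //; move: t0; rewrite le_eqVlt => /predU1P[t0|t0].
      by rewrite /gridpt -t0 !mul0r lexx/=; move: sT => /andP[+ /le_trans]; rewrite -t0 in tT.
    by have /andP[-> /le_trans -> //] := gridpt_itv t0 jN.
  by move: n0; set q := n.+1%:R^-1 => n0; rewrite ler_norml => /andP[? ?]; lra.
move=> h.
have cf' : {within `[0, t], continuous f}.
  by apply: continuous_subspaceW cf; apply: subset_itvl; rewrite bnd_simp.
have [x xt hx] := EVT_max t0 cf'.
exists x; split; first by move: xt; rewrite in_itv.
rewrite leNgt; apply/negP => fxc.
have [n hn] : exists n, n.+1%:R^-1 < c - f x.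
  exists (Num.trunc (c - f x)^-1); rewrite invf_plt ?posrE ?ltr0n ?subr_gt0//.
  by rewrite truncnS_gt.
have [N [j [jN hj]]] := h n.
have : f (gridpt t N j) <= f x.
  apply: hx; rewrite in_itv/=; have [t00|t00] := eqVneq t 0.
    by rewrite /gridpt t00 !mul0r lexx.
  by apply: gridpt_itv => //; rewrite lt_neqAle eq_sym t00.
by move: hn hj; set q := n.+1%:R^-1; lra.
Qed.

Lemma ereal_sup_exceedance (T c : R) f : 0 <= T -> {within `[0, T], continuous f} ->
  (c%:E <= ereal_sup [set (f t)%:E | t in `[0%R, T]])%E <->
  (exists t, 0 <= t <= T /\ c <= f t).
Proof.
move=> T0 cf; split => [h|[t [tT ct]]]; last first.
  by apply: le_ereal_sup_tmp; exists (f t)%:E => //; exists t => //=; rewrite in_itv.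
have [x xt hx] := EVT_max T0 cf.
exists x; split; first by move: xt; rewrite in_itv.
rewrite -lee_fin; apply: le_trans h _; apply: ge_ereal_sup => _ [t tT <-].
by rewrite lee_fin; apply: hx.
Qed.

End grid_dense.

Lemma le_measure_ae d (Omega : measurableType d) (R : realType)
    (P : {measure set Omega -> \bar R}) (A A' : set Omega) : measurable A -> measurable A' ->
  (\forall w \ae P, A w -> A' w) -> (P A <= P A')%E.
Proof.
move=> mA mA' [N [mN N0 AN]].
have <- : P (A' `|` N) = P A'.
  apply/eqP; rewrite eq_le; apply/andP; split.
    by apply: le_trans (measureU2 _ mA' mN) _; rewrite [X in (_ + X)%E]N0 adde0.
  by apply: le_measure; rewrite ?inE//; exact: measurableU.
apply: le_measure; rewrite ?inE//; first exact: measurableU.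
move=> w Aw; have [A'w|A'w] := pselect (A' w); [by left|right].
by apply: AN => /= /(_ Aw).
Qed.

(** * Hitting times and a maximal inequality *)

Section hitting.
Context d (Omega : measurableType d) (R : realType) (P : probability Omega R).
Context (T : R) (m : nat) (B : R -> Omega -> 'cV[R]_m).
Hypothesis Pc : measure_is_complete P.
Hypothesis BM : brownian_motion P T B.
Hypothesis T0 : 0 < T.

Local Notation Ft := (augmented_filtration P B).
Local Notation FtT t := (g_sigma_algebraType (Ft_gen P B t)).
Local Notation adapted := (adapted P T B).
Local Notation stopping_time := (stopping_time P T B).
Local Notation simple_predictable := (simple_predictable P T B).
Local Notation simple_process := (@simple_process d Omega R m).

Lemma Ft_ae_eq t (A A' : set Omega) : Ft t A -> (\forall w \ae P, A w <-> A' w) -> Ft t A'.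
Proof.
move=> FA AA'.
have : measurable_wrt (Ft t) (\1_A' : Omega -> R).
  apply: (@measurable_wrt_ae_eq _ _ _ P (Ft_gen P B t) _ (\1_A)).
  - by move=> N; exact: Ft_negligible.
  - by apply/measurable_wrtP; exact: measurable_indic.
  - by apply: filterS AA' => w h; rewrite !indicE; congr (_%:R); congr nat_of_bool; apply/idP/idP; rewrite !inE => /h.
move=> /(_ [set 1] (@measurable_set1 _ _)).
rewrite (_ : _ @^-1` _ = A')//; apply/seteqP; split => w /=; rewrite indicE.
  by case: (boolP (w \in A')) => [|_ /eqP]; rewrite ?inE// eq_sym oner_eq0.
by move=> h; rewrite mem_set.
Qed.

(** On continuous paths the event is a countable combination of grid events; the other paths form a
    negligible set, which the augmented filtration contains at every time. *)
Lemma Ft_exceedance V (c t : R) : adapted V -> continuous_paths P T V -> 0 <= t <= T ->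
  Ft t [set w | exists s, 0 <= s <= t /\ c <= V s w].
Proof.
move=> aV cV tT; have /andP[t0 _] := tT.
apply: (@Ft_ae_eq _ (\bigcap_n \bigcup_N \bigcup_(j in [set j | (j <= N.+1)%N])
    [set w | c - n.+1%:R^-1 < V (gridpt t N j) w])).
  apply: (@bigcap_measurableType _ (FtT t)) => n _.
  apply: (@bigcup_measurable _ (FtT t)) => N _.
  apply: (@bigcup_measurable _ (FtT t)) => j /= jN.
  have /andP[g0 gt] : 0 <= gridpt t N j <= t.
    move: t0; rewrite le_eqVlt => /predU1P[t0|t0]; last exact: gridpt_itv.
    by rewrite /gridpt -t0 !mul0r lexx.
  have gT : 0 <= gridpt t N j <= T by rewrite g0; have /andP[_] := tT; apply: le_trans.
  apply: (FtS gt); rewrite (_ : [set _ | _] = V (gridpt t N j) @^-1` `]c - n.+1%:R^-1, +oo[).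
    by apply: aV gT _ _.
  by apply/seteqP; split => w /=; rewrite in_itv/= andbT.
apply: filterS cV => w cV; apply: iff_sym; apply: iff_trans (continuous_exceedance c cV tT) _.
split => h n.
  by move=> _; have [N [j [jN hj]]] := h n; exists N => //; exists j.
by have [N _ [j jN hj]] := h n I; exists N, j.
Qed.

Lemma measurable_exceedance V (c : R) : adapted V -> continuous_paths P T V ->
  measurable [set w | exists t, 0 <= t <= T /\ c <= V t w].
Proof.
move=> aV cV; apply: (Ft_measurable Pc BM (lexx T)); apply: Ft_exceedance => //.
by rewrite lexx ltW.
Qed.

(** The infimum of the times at which [V] is at least [c]. By continuity it is attained, so up to a
    null set being hit by time [t] is the event of [Ft_exceedance]. *)
Lemma hitting_time V (c : R) : adapted V -> continuous_paths P T V ->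
  exists2 tau, stopping_time tau &
    \forall w \ae P, (forall t, 0 <= t < tau w -> V t w < c) /\
      (c <= V (tau w) w \/ tau w = T).
Proof.
move=> aV cV.
(* Adjoining [T] makes the set nonempty on every path and bounds the infimum by [T]. *)
pose E w := [set t | 0 <= t <= T /\ c <= V t w] `|` [set T].
pose tau w := inf (E w).
have E0 w : E w !=set0 by exists T; right.
have Elb w : has_lbound (E w).
  by exists 0 => t [[/andP[]]|->]//; exact: ltW.
have tauE w t : E w t -> tau w <= t by move=> Et; apply: ge_inf.
have tau0 w : 0 <= tau w.
  by apply: lb_le_inf => // t [[/andP[]]|->]//; exact: ltW.
have tauT w : tau w <= T by apply: tauE; right.
(* If [V] were below [c] at the infimum, and the infimum below [T], then [V] would remain below [c]
   on a short interval after it, which contradicts the definition of the infimum. *)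
have hit w : {within `[0, T], continuous V^~ w} -> (c <= V (tau w) w \/ tau w = T).
  move=> cw; have [|cV'] := leP c (V (tau w) w); [by left|right].
  apply/eqP; rewrite eq_le tauT/= leNgt; apply/negP => tT.
  pose e := (c - V (tau w) w) / 2.
  have e0 : 0 < e by rewrite divr_gt0// subr_gt0.
  have tw : 0 <= tau w <= T by rewrite tau0 tauT.
  have [r r0 hr] := within_continuousP cw tw e0.
  have r'0 : 0 < Num.min r (T - tau w) by rewrite lt_min r0 subr_gt0.
  have [t Et] := inf_adherent r'0 (conj (E0 w) (Elb w)).
  rewrite -/(tau w) -ltrBlDl lt_min => /andP[tr tT'].
  have tauWt := tauE _ _ Et.
  case: Et => [[tTT cVt]|tTE]; last by move: tT'; rewrite tTE ltxx.
  have : `|V (tau w) w - V t w| <= e.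
    by apply: hr => //; rewrite ger0_norm ?subr_ge0.
  by rewrite /e ler_norml; lra.
exists tau.
  split=> [w|t tT]; first by rewrite tau0 tauT.
  have /andP[t0] := tT; rewrite le_eqVlt => /predU1P[->|tltT].
    rewrite (_ : [set _ | _] = setT); first exact: g_sigma_algebraT.
    by apply/seteqP; split => // w _ /=.
  (* For [t < T] the adjoined point [T] does not matter, and a path that satisfies [tau w <= t] has
     truly reached [c]. *)
  apply: (Ft_ae_eq (Ft_exceedance c aV cV tT)).
  apply: filterS cV => w cw; split=> [[s [/andP[s0 st] cs]]|/= taut].
    apply: (le_trans _ st); apply: tauE; left; split => //.
    by rewrite s0 (le_trans st (ltW tltT)).
  exists (tau w); split; first by rewrite tau0.
  by have [//|tE] := hit _ cw; move: taut; rewrite tE leNgt tltT.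
apply: filterS cV => w cw; split; last exact: hit.
move=> t /andP[t0 tt]; rewrite ltNge; apply/negP => ct.
have : tau w <= t by apply: tauE; left; split => //; rewrite t0 (le_trans (ltW tt)).
by rewrite leNgt tt.
Qed.

Lemma continuous_sp_integral (S : simple_process) : simple_predictable S ->
  continuous_paths P T (sp_integral B S).
Proof.
move=> hS; have cB : \forall w \ae P, forall j, {within `[0, T], continuous (fun t => B t w j ord0)}.
  by apply: filter_forall => j; case: BM => _ _ h _; exact: h.
apply: filterS cB => w cB; apply: within_continuous_sum => i _.
apply: within_continuous_sum => j _.
apply: within_continuousM; first exact: within_continuous_cst.
have [tmT _ _ _] := hS.
have cm k : (k <= sp_size S)%N ->
    {within `[0, T], continuous (fun t => B (Num.min (sp_time S k) t) w j ord0)}.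
  by move=> kS; apply: (within_continuous_min (f := fun t => B t w j ord0)) (cB j) (tmT _ kS).
apply: (@within_continuous_eq _ _ _ (fun t => B (Num.min (sp_time S i.+1) t) w j ord0
    + - B (Num.min (sp_time S i) t) w j ord0)).
  by move=> t _; rewrite !mxE.
by apply: within_continuousD; [|apply: within_continuousN]; apply: cm => //; exact: ltnW.
Qed.

Lemma continuous_sp_quad (S : simple_process) w : simple_predictable S ->
  {within `[0, T], continuous (fun t => sp_quad S t w)}.
Proof.
move=> hS; apply: within_continuous_sum => i _.
apply: within_continuousM; first exact: within_continuous_cst.
have [tmT _ _ _] := hS.
have cid : {within `[0, T], continuous (fun t : R => t)}.
  by apply/subspace_continuousP => s _; exact: cvg_within.
apply: within_continuousD; last apply: within_continuousN.
  by apply: (within_continuous_min cid); exact: tmT.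
by apply: (within_continuous_min cid); apply: tmT; exact: ltnW.
Qed.

Lemma continuous_sp_exp (S : simple_process) : simple_predictable S ->
  continuous_paths P T (sp_exp B S).
Proof.
move=> hS; apply: filterS (continuous_sp_integral hS) => w cJ.
apply: within_continuous_expR; apply: within_continuousD => //.
apply: within_continuousN; apply: within_continuousM; last exact: within_continuous_cst.
exact: continuous_sp_quad.
Qed.

Definition sp_scale (a : R) (S : simple_process) : simple_process :=
  SimpleProcess (sp_size S) (sp_time S) (fun i w => a *: sp_val S i w).

Lemma enormZ n a (u : 'cV[R]_n) : enorm (a *: u) ^+ 2 = a ^+ 2 * enorm u ^+ 2.
Proof. by rewrite !enorm2 dotvZl dotvZr mulrA. Qed.

Lemma sp_scale_predictable a S : simple_predictable S -> simple_predictable (sp_scale a S).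
Proof.
move=> [h1 h2 h3 h4]; split => //= i; first last.
  move=> /h4[K hK]; exists (`|a| * K) => w.
  have -> : enorm (a *: sp_val S i w) = `|a| * enorm (sp_val S i w).
    apply: (@pexpIrn _ 2) => //; rewrite ?nnegrE ?mulr_ge0 ?enorm_ge0//.
    by rewrite enormZ exprMn -normrX ger0_norm ?sqr_ge0.
  by rewrite ler_wpM2l.
move=> j iS; apply/measurable_wrtP.
rewrite (_ : (fun w => _) = fun w => a * sp_val S i w j ord0); last first.
  by apply/funext => w; rewrite mxE.
by apply: measurable_funM => //; apply/measurable_wrtP; exact: h3.
Qed.

Lemma sp_scale_integral a S t w : sp_integral B (sp_scale a S) t w = a * sp_integral B S t w.
Proof. by rewrite /sp_integral mulr_sumr; apply: eq_bigr => i _; rewrite dotvZl. Qed.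

Lemma sp_scale_quad a S t w : sp_quad (sp_scale a S) t w = a ^+ 2 * sp_quad S t w.
Proof. by rewrite /sp_quad mulr_sumr; apply: eq_bigr => i _; rewrite enormZ mulrA. Qed.

Lemma sp_scale_eval a S t w : sp_eval (sp_scale a S) t w = a *: sp_eval S t w.
Proof.
rewrite /sp_eval scaler_sumr; apply: eq_bigr => i _.
by rewrite !scalerA mulrC.
Qed.

Lemma sp_quad_bounded S : simple_predictable S ->
  exists K, forall t w, 0 <= t <= T -> sp_quad S t w <= K.
Proof.
move=> [h1 h2 h3 h4].
have /choice[K hK] (i : 'I_(sp_size S)) : exists K, forall w, enorm (sp_val S i w) <= K by exact: h4.
exists (\sum_(i < sp_size S) K i ^+ 2 * T) => t w /andP[t0 tT].
apply: ler_sum => i _.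
have /andP[a0 aT] := h1 i (ltnW (ltn_ord i)).
have /andP[b0 bT] := h1 i.+1 (ltn_ord i).
have ab := h2 i (ltn_ord i).
apply: ler_pM; rewrite ?sqr_ge0//.
- by rewrite subr_ge0 le_min !ge_min ab lexx orbT.
- by rewrite ler_pXn2r ?nnegrE ?enorm_ge0// (le_trans (enorm_ge0 _) (hK i w)).
- rewrite lerBlDr (@le_trans _ _ T)//; first by rewrite ge_min bT.
  by rewrite lerDl le_min a0.
Qed.

(** Wherever the quadratic variation is bounded, the square of the exponential is dominated by the
    exponential martingale of the doubled integrand. All L2 bounds come from this identity. *)
Lemma sp_exp_sqr S t w : sp_exp B S t w ^+ 2 = expR (sp_quad S t w) * sp_exp B (sp_scale 2 S) t w.
Proof.
rewrite /sp_exp sp_scale_integral sp_scale_quad -expRD -expRM_natl; congr expR.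
by rewrite -mulr_natl; field.
Qed.

Lemma integral_sp_exp_stopped S tau : simple_predictable S -> stopping_time tau ->
  (\int[P]_w (sp_exp B S (tau w) w)%:E = 1)%E.
Proof.
move=> hS st; have [K hK] := sp_quad_bounded hS.
have hS2 := sp_scale_predictable 2 hS.
rewrite -[RHS](integral_sp_exp Pc BM T0 hS).
apply: (@optional_stopping _ _ _ _ _ _ _ Pc BM T0 tau (sp_exp B S)
  (sp_exp B (sp_scale 2 S)) (expR K) st).
- exact: adapted_sp_exp.
- exact: adapted_sp_exp.
- exact: continuous_sp_exp.
- by move=> t w _; exact: expR_ge0.
- by move=> t w _; exact: expR_ge0.
- by move=> t A tT FA; exact: (sp_exp_martingale Pc BM hS).
- by move=> t A tT FA; exact: (sp_exp_martingale Pc BM hS2).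
- exact: (integral_sp_exp Pc BM T0 hS2).
- exact: expR_ge0.
- by move=> t w tT; rewrite sp_exp_sqr ler_wpM2r ?expR_ge0// ler_expR; exact: hK.
Qed.

(** Doob's maximal inequality: Markov's inequality for the exponential stopped when it first reaches
    [c], where its expectation is 1. *)
Lemma sp_exp_exceedance S c : simple_predictable S -> 0 < c ->
  (P [set w | exists t, (0 <= t <= T)%R /\ (c <= sp_exp B S t w)%R] <= c^-1%:E)%E.
Proof.
move=> hS c0.
have aM := adapted_sp_exp hS; have cM := continuous_sp_exp hS.
have [tau st htau] := hitting_time c aM cM.
have mM : measurable_fun setT (fun w => sp_exp B S (tau w) w) by exact: (measurable_stopped Pc BM T0 st aM cM).
have mE := measurable_exceedance c aM cM.
have mE' : measurable [set w | c <= sp_exp B S (tau w) w].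
  by rewrite -[X in measurable X]setTI; exact: measurable_fun_le.
apply: (@le_trans _ _ (P [set w | c <= sp_exp B S (tau w) w])).
  apply: le_measure_ae => //; apply: filterS htau => w [h1 h2] [t [/andP[t0' tT] ct]].
  case: h2 => // tauE; move: (h1 t); rewrite t0' tauE => h3.
  rewrite /= tauE; move: tT; rewrite le_eqVlt => /predU1P[<-//|tT].
  by move: (h3 tT); rewrite ltNge ct.
have : (\int[P]_w (c%:E * (\1_[set w | (c <= sp_exp B S (tau w) w)%R] w)%:E) <= 1)%E.
  rewrite -(integral_sp_exp_stopped hS st); apply: ge0_le_integral => //.
  - by move=> w _; rewrite mule_ge0// lee_fin// ltW.
  - apply/measurable_EFinP; apply: measurable_funM => //; exact: measurable_indic.
  - exact/measurable_EFinP.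
  - move=> w _; rewrite -EFinM lee_fin indicE; case: (boolP (w \in _)) => [|_].
      by rewrite inE/= mulr1.
    by rewrite mulr0 expR_ge0.
rewrite ge0_integralZl//; [|by apply/measurable_EFinP; exact: measurable_indic|by rewrite lee_fin ltW].
rewrite integral_indic// setIT => h.
by rewrite -[leRHS]mule1 lee_pdivlMl.
Qed.

Lemma sp_quad_le S s t w : simple_predictable S -> s <= t -> sp_quad S s w <= sp_quad S t w.
Proof.
move=> [_ h _ _] st; apply: ler_sum => i _.
rewrite ler_wpM2l ?sqr_ge0//; have := h i (ltn_ord i).
move: (sp_time S i) (sp_time S i.+1) => x y xy.
by case: (lerP x s) => ?; case: (lerP x t) => ?; case: (lerP y s) => ?; case: (lerP y t) => ?; lra.
Qed.

(** Exponential Chebyshev. Where the quadratic variation is at most [b], an integral that reaches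
    [a] or [- a] forces the exponential of [l] or [- l] times the integrand to reach [c]. *)
Lemma sp_integral_tail S a b : simple_predictable S -> 0 < a -> 0 < b ->
  (P ([set w | exists t, (0 <= t <= T)%R /\ (a <= `|sp_integral B S t w|)%R] `&`
      [set w | (sp_quad S T w <= b)%R]) <= (2 * expR (- (a ^+ 2 / (2 * b))))%:E)%E.
Proof.
(* [l] maximizes [l a - l^2 b / 2], and the maximum is the exponent in [c]. *)
move=> hS a0 b0; pose l := a / b; pose c := expR (a ^+ 2 / (2 * b)).
have c0 : 0 < c by exact: expR_gt0.
have E l' := sp_exp_exceedance (sp_scale_predictable l' hS) c0.
have mE l' : measurable [set w | exists t, (0 <= t <= T)%R /\ (c <= sp_exp B (sp_scale l' S) t w)%R].
  have hl := sp_scale_predictable l' hS.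
  by apply: measurable_exceedance; [exact: adapted_sp_exp|exact: continuous_sp_exp].
have mJ : measurable [set w | exists t, 0 <= t <= T /\ a <= `|sp_integral B S t w|].
  apply: (@measurable_exceedance (fun t w => `|sp_integral B S t w|)).
    move=> t tT; apply/measurable_wrtP; apply: measurableT_comp => //.
    by apply/measurable_wrtP; exact: (adapted_sp_integral hS tT).
  apply: filterS (continuous_sp_integral hS) => w cJ.
  by apply: continuous_withinP => s sT e e0; have [r r0 hr] := within_continuousP cJ sT e0;
    exists r => // t tT ts; apply: le_trans (hr t tT ts); exact: ler_dist_dist.
have mQ : measurable [set w | sp_quad S T w <= b].
  rewrite -[X in measurable X]setTI; apply: measurable_fun_le => //.
  by apply: (adapted_measurable Pc BM (adapted_sp_quad hS)); rewrite lexx ltW.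
apply: (@le_trans _ _ (P ([set w | exists t, (0 <= t <= T)%R /\ (c <= sp_exp B (sp_scale l S) t w)%R] `|`
  [set w | exists t, (0 <= t <= T)%R /\ (c <= sp_exp B (sp_scale (- l) S) t w)%R]))%E).
  apply: le_measure; rewrite ?inE.
  - exact: measurableI.
  - exact: measurableU.
  move=> w [[t [tT aJ]] /= Qb].
  have Qt : sp_quad S t w <= b by apply: le_trans Qb; apply: sp_quad_le => //; case/andP: tT.
  have key x : a <= x -> a ^+ 2 / (2 * b) <= l * x - l ^+ 2 * sp_quad S t w / 2.
    move=> ax; rewrite (_ : a ^+ 2 / (2 * b) = l * a - l ^+ 2 * b / 2); last first.
      by rewrite /l; field; rewrite gt_eqF.
    have l0 : 0 <= l by rewrite divr_ge0 ?ltW.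
    have h1 := ler_wpM2l l0 ax.
    have h2 : l ^+ 2 * sp_quad S t w <= l ^+ 2 * b by rewrite ler_wpM2l ?sqr_ge0.
    lra.
  move: aJ; case: (ger0P (sp_integral B S t w)) => _ aJ; [left|right];
    exists t; split => //; rewrite ler_expR sp_scale_integral sp_scale_quad.
    exact: key.
  by rewrite sqrrN mulNr -mulrN; exact: key.
apply: le_trans (measureU2 _ _ _) _; try exact: mE.
rewrite mulr_natl mulr2n EFinD expRN; apply: leeD; exact: E.
Qed.

End hitting.

(** * Common refinements of simple processes *)

(** The cells of [r] inside [[x, y]] are consecutive because both end points occur in [r]. The map
    [g] is arbitrary so that it can be an indicator in the time variable or a Brownian path. *)
Lemma telescope_sorted (R : realType) (V : lmodType R) (g : R -> V) (r : seq R) (x y : R) :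
  sorted <%R r -> x \in r -> y \in r -> x <= y ->
  \sum_(j < (size r).-1) ((x <= r`_j) && (r`_j.+1 <= y))%:R *: (g r`_j.+1 - g r`_j) = g y - g x.
Proof.
move=> sr xr yr xy.
have mono := lt_sorted_leq_nth 0 sr.
set a := index x r; set b := index y r.
have ar : (a < size r)%N by rewrite index_mem.
have br : (b < size r)%N by rewrite index_mem.
have xE : x = r`_a by rewrite nth_index.
have yE : y = r`_b by rewrite nth_index.
have ab : (a <= b)%N by rewrite -(mono a b)// -xE -yE.
transitivity (\sum_(j < (size r).-1 | (a <= j < b)%N) (g r`_j.+1 - g r`_j)).
  rewrite [RHS]big_mkcond; apply: eq_bigr => j _.
  have jr : (j.+1 < size r)%N by case: (size r) j ar => // n j _ /=; rewrite ltnS.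
  rewrite xE yE (mono a j)// ?inE// ?(ltnW jr)// (mono j.+1 b)//.
  by case: ifP => _; rewrite ?scale1r ?scale0r.
rewrite -(big_mkord (fun j => (a <= j < b)%N) (fun j => g r`_j.+1 - g r`_j)).
rewrite (_ : \sum_(0 <= j < _ | _) _ = \sum_(a <= j < b) (g r`_j.+1 - g r`_j)).
  by rewrite (telescope_sumr (fun j => g r`_j))// -xE -yE.
have bs : (b <= (size r).-1)%N by rewrite -ltnS prednK// (leq_ltn_trans _ br).
rewrite [RHS]big_nat_cond (big_nat_widenl a 0)// (big_nat_widen _ _ _ _ _ bs).
rewrite /=; apply: eq_bigl => j /=.
by rewrite andbT -andbA andbb.
Qed.

Section refinement.
Context d (Omega : measurableType d) (R : realType) (P : probability Omega R).
Context (T : R) (m : nat) (B : R -> Omega -> 'cV[R]_m).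
Hypothesis T0 : 0 < T.

Local Notation Ft := (augmented_filtration P B).
Local Notation FtT t := (g_sigma_algebraType (Ft_gen P B t)).
Local Notation simple_predictable := (simple_predictable P T B).
Local Notation simple_process := (@simple_process d Omega R m).

Definition sp_times (S : simple_process) : seq R := map (sp_time S) (iota 0 (sp_size S).+1).

(** The value that [S] takes on the [j]-th cell of a partition [r] finer than its own. *)
Definition sp_refine (S : simple_process) (r : seq R) (j : nat) (w : Omega) : 'cV[R]_m :=
  \sum_(i < sp_size S) ((sp_time S i <= r`_j) && (r`_j.+1 <= sp_time S i.+1))%:R *: sp_val S i w.

Lemma mem_sp_times S i : (i <= sp_size S)%N -> sp_time S i \in sp_times S.
Proof. by move=> iS; apply/mapP; exists i; rewrite // mem_iota. Qed.

Lemma nth_sorted_le (r : seq R) j : sorted <%R r -> (j < (size r).-1)%N -> r`_j <= r`_j.+1.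
Proof.
move=> sr jr; have jr' : (j.+1 < size r)%N by case: (size r) jr.
by rewrite (lt_sorted_leq_nth 0 sr) ?inE// ltnW.
Qed.

Lemma in_oc_natr (t x y : R) : x <= y ->
  (t \in `]x, y])%:R = (t <= y)%R%:R - (t <= x)%R%:R :> R.
Proof.
move=> xy; rewrite in_itv/=; case: (leP t x) => tx; last by rewrite subr0.
by rewrite (le_trans tx xy) subrr.
Qed.

(** The indicator of a half-open interval is an increment of [x -> 1_(t <= x)], so the telescoping
    sum applies to it just as it does to Brownian increments. *)
Lemma sp_refine_eval S r t w : simple_predictable S -> sorted <%R r ->
  {subset sp_times S <= r} ->
  \sum_(j < (size r).-1) (t \in `]r`_j, r`_j.+1])%:R *: sp_refine S r j w = sp_eval S t w.
Proof.
move=> [_ h _ _] sr Sr.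
under eq_bigr do rewrite /sp_refine scaler_sumr.
rewrite exchange_big/=; apply: eq_bigr => i _.
have ti := h i (ltn_ord i).
rewrite in_oc_natr//.
rewrite -(telescope_sorted (V := R^o) (fun x => (t <= x)%R%:R) sr
   (Sr _ (mem_sp_times (ltnW (ltn_ord i)))) (Sr _ (mem_sp_times (ltn_ord i))) ti).
rewrite scaler_suml; apply: eq_bigr => j _.
by rewrite in_oc_natr ?nth_sorted_le// !scalerA mulrC.
Qed.

Lemma sp_refine_integral S r t w : simple_predictable S -> sorted <%R r ->
  {subset sp_times S <= r} ->
  \sum_(j < (size r).-1) dotv (sp_refine S r j w)
     (B (Num.min r`_j.+1 t) w - B (Num.min r`_j t) w) = sp_integral B S t w.
Proof.
move=> [_ h _ _] sr Sr.
under eq_bigr do rewrite /sp_refine dotv_suml.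
rewrite exchange_big/=; apply: eq_bigr => i _.
have ti := h i (ltn_ord i).
rewrite -(telescope_sorted (fun x => B (Num.min x t) w) sr
   (Sr _ (mem_sp_times (ltnW (ltn_ord i)))) (Sr _ (mem_sp_times (ltn_ord i))) ti).
by rewrite dotv_sumr; apply: eq_bigr => j _; rewrite dotvZl dotvZr.
Qed.

(** The intervals of [S] that begin after the cell have coefficient zero, and the values on the
    others are already known when the cell begins. *)
Lemma sp_refine_measurable S r j i : simple_predictable S ->
  measurable_wrt (Ft r`_j) (fun w => sp_refine S r j w i ord0).
Proof.
move=> [_ _ h _]; apply/measurable_wrtP.
rewrite (_ : (fun w => _) = fun w => \sum_(k < sp_size S)
   ((sp_time S k <= r`_j) && (r`_j.+1 <= sp_time S k.+1))%:R * sp_val S k w i ord0); last first.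
  by apply/funext => w; rewrite /sp_refine summxE; apply: eq_bigr => k _; rewrite mxE.
apply: (@measurable_sum _ (FtT r`_j)) => k.
have [kj|kj] := leP (sp_time S k) r`_j; last first.
  rewrite (_ : (fun x => _) = cst 0); first exact: measurable_cst.
  by apply/funext => x; rewrite andFb mulr0n mul0r.
apply: measurable_funM => //; apply/measurable_wrtP.
by apply: (measurable_wrt_FtS kj); exact: h.
Qed.

Definition bounded_vec (u : Omega -> 'cV[R]_m) := exists K : R, forall w, enorm (u w) <= K.

Lemma bounded_vecP u : bounded_vec u <-> exists K, forall w, enorm (u w) ^+ 2 <= K.
Proof.
split => [[K hK]|[K hK]].
  exists (K ^+ 2) => w; rewrite ler_pXn2r ?nnegrE ?enorm_ge0//.
  exact: le_trans (enorm_ge0 _) (hK w).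
exists (1 + K) => w; have := hK w; have := enorm_ge0 (u w).
by move: (enorm (u w)) => x x0 xK; have := sqr_ge0 (x - 1); rewrite sqrrB1; lra.
Qed.

Lemma bounded_vecD u v : bounded_vec u -> bounded_vec v -> bounded_vec (fun w => u w + v w).
Proof.
move=> /bounded_vecP[K hK] /bounded_vecP[L hL]; apply/bounded_vecP.
exists (2 * K + 2 * L) => w; apply: le_trans (enorm2D_le _ _) _.
by rewrite lerD// ler_wpM2l.
Qed.

Lemma bounded_vecZ u a : bounded_vec u -> bounded_vec (fun w => a *: u w).
Proof.
move=> /bounded_vecP[K hK]; apply/bounded_vecP; exists (a ^+ 2 * K) => w.
by rewrite enormZ ler_wpM2l// sqr_ge0.
Qed.

Lemma bounded_vec0 : bounded_vec (fun=> 0).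
Proof. by exists 0 => w; rewrite enorm0. Qed.

Lemma bounded_vec_sum I (r : seq I) (u : I -> Omega -> 'cV[R]_m) :
  (forall i, bounded_vec (u i)) -> bounded_vec (fun w => \sum_(i <- r) u i w).
Proof.
move=> bu; elim: r => [|i r IH].
  by under [X in bounded_vec X]eq_fun do rewrite big_nil; exact: bounded_vec0.
by under [X in bounded_vec X]eq_fun do rewrite big_cons; exact: bounded_vecD.
Qed.

Lemma sp_refine_bounded S r j : simple_predictable S -> bounded_vec (sp_refine S r j).
Proof.
move=> [_ _ _ h]; apply: bounded_vec_sum => i; apply: bounded_vecZ.
exact: h.
Qed.

(** Both processes are rewritten on the sorted union of their partitions, where values can be added
    cell by cell. *)
Lemma sp_add S1 S2 : simple_predictable S1 -> simple_predictable S2 ->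
  exists S, [/\ simple_predictable S,
    forall t w, sp_eval S t w = sp_eval S1 t w + sp_eval S2 t w &
    forall t w, sp_integral B S t w = sp_integral B S1 t w + sp_integral B S2 t w].
Proof.
move=> h1 h2; pose r := sort <=%R (undup (sp_times S1 ++ sp_times S2)).
have sr : sorted <%R r by rewrite sort_lt_sorted undup_uniq.
have memr x : x \in r -> 0 <= x <= T.
  rewrite mem_sort mem_undup mem_cat => /orP[]/mapP[i]; rewrite mem_iota/= add0n ltnS => iS ->.
    by case: h1 => h _ _ _; exact: h.
  by case: h2 => h _ _ _; exact: h.
have Sr1 : {subset sp_times S1 <= r}.
  by move=> x xS; rewrite mem_sort mem_undup mem_cat xS.
have Sr2 : {subset sp_times S2 <= r}.
  by move=> x xS; rewrite mem_sort mem_undup mem_cat xS orbT.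
have r0 : (0 < size r)%N.
  have := Sr1 _ (mem_sp_times (leq0n _)); by case: (r).
exists (SimpleProcess (size r).-1 (nth 0 r) (fun j w => sp_refine S1 r j w + sp_refine S2 r j w)).
split.
- split => /=.
  + move=> i ir; apply: memr; apply: mem_nth.
    by move: r0 ir; case: (size r).
  + by move=> i ir; exact: nth_sorted_le.
  + move=> i j ir; apply/measurable_wrtP.
    rewrite (_ : (fun w => _) = fun w => sp_refine S1 r i w j ord0 + sp_refine S2 r i w j ord0).
      by apply: measurable_funD; apply/measurable_wrtP; exact: sp_refine_measurable.
    by apply/funext => w; rewrite mxE.
  + by move=> i ir; apply: bounded_vecD; exact: sp_refine_bounded.
- move=> t w; rewrite -(sp_refine_eval t w h1 sr Sr1) -(sp_refine_eval t w h2 sr Sr2).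
  by rewrite -big_split/=; apply: eq_bigr => j _; rewrite scalerDr.
- move=> t w; rewrite -(sp_refine_integral t w h1 sr Sr1) -(sp_refine_integral t w h2 sr Sr2).
  by rewrite -big_split/=; apply: eq_bigr => j _; rewrite dotvDl.
Qed.

Lemma sp_rectangle (s t : R) (E : set Omega) (v : 'cV[R]_m) : 0 <= s -> s < t -> t <= T -> Ft s E ->
  exists2 S, simple_predictable S &
    forall u w, sp_eval S u w = (u \in `]s, t])%:R *: (\1_E w *: v).
Proof.
move=> s0 st tT FE.
exists (SimpleProcess 1 (fun i => if i is 0%N then s else t) (fun _ w => \1_E w *: v)); last first.
  by move=> u w; rewrite /sp_eval big_ord1.
split => /=.
- by move=> [|i] _; rewrite ?s0 ?tT ?andbT ?(le_trans s0 (ltW st))// (le_trans (ltW st)).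
- by move=> [|//] _; exact: ltW.
- move=> [|//] j _; apply/measurable_wrtP.
  rewrite (_ : (fun w => _) = fun w => \1_E w * v j ord0); last by apply/funext => w; rewrite mxE.
  by apply: measurable_funM => //; exact: measurable_indic.
- move=> i _; apply/bounded_vecP; exists (enorm v ^+ 2) => w; rewrite enormZ.
  by rewrite ler_piMl ?sqr_ge0// indicE; case: (_ \in _); rewrite ?expr1n ?expr0n.
Qed.

Lemma sp_zero : exists2 S, simple_predictable S & forall t w, sp_eval S t w = 0.
Proof.
exists (SimpleProcess 0 (fun=> 0) (fun _ _ => 0)); last by move=> t w; rewrite /sp_eval big_ord0.
by split => //= i _; rewrite lexx ltW.
Qed.

End refinement.

(** * Predictable processes and their simple approximation *)

Section predictable_facts.
Context d (Omega : measurableType d) (R : realType) (P : probability Omega R).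
Context (T : R) (m : nat) (B : R -> Omega -> 'cV[R]_m).
Hypothesis Pc : measure_is_complete P.
Hypothesis BM : brownian_motion P T B.
Hypothesis T0 : 0 < T.

Local Notation FtT t := (g_sigma_algebraType (Ft_gen P B t)).
Local Notation adapted := (adapted P T B).
Local Notation predictable := (predictable P T B).
Local Notation leb := (@lebesgue_measure R).
Local Notation RT := (measurableTypeR R).

Definition horizon : set (R * Omega) := `[0, T] `*` setT.

(** The predictable sigma-algebra lives on [horizon]. Taking all sets with a predictable trace makes
    it a sigma-algebra on the full product type, so that predictability becomes ordinary
    measurability, see [predictableP]. *)
Definition pred_system : set (set (R * Omega)) :=
  [set D | <<s horizon, predictable_rectangles P T B >> (horizon `&` D)].

Local Notation PT := (g_sigma_algebraType pred_system).

Lemma sigma_algebra_pred_system : sigma_algebra setT pred_system.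
Proof.
have [h0 hC hU] := smallest_sigma_algebra horizon (predictable_rectangles P T B).
split.
- by rewrite /pred_system/= setI0.
- move=> A; rewrite /pred_system/= => /hC; congr (<<s _, _ >> _).
  by apply/seteqP; split => z /=; [move=> [hz nA]; split => //; split => // Az; apply: nA|
    move=> [hz [_ nA]]; split => // -[_ /nA]].
- by move=> A hA; rewrite /pred_system/= setI_bigcupr; apply: hU.
Qed.

Lemma predictableP X : predictable X <->
  measurable_fun setT (fun z : PT => X z.1 z.2).
Proof.
have E : <<s pred_system >> = pred_system by exact/sigma_algebra_id/sigma_algebra_pred_system.
split => [pX _ A mA|mX A mA].
  by rewrite setTI; apply: sub_sigma_algebra; exact: pX.
have : <<s pred_system >> ((fun z => X z.1 z.2) @^-1` A).
  by rewrite -[X in <<s _ >> X]setTI; apply: (mX measurableT).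
by rewrite E.
Qed.

Lemma predictable_set (D : set (R * Omega)) : pred_system D -> predictable (fun t w => \1_D (t, w)).
Proof.
move=> pD; apply/predictableP.
rewrite (_ : (fun z => _) = \1_D); last by apply/funext => -[].
by apply: (@measurable_indic _ PT); apply: sub_sigma_algebra.
Qed.

Lemma horizon_ind (H : set (set (R * Omega))) :
  sigma_algebra horizon H -> predictable_rectangles P T B `<=` H ->
  forall D, pred_system D -> H (horizon `&` D).
Proof. by move=> sH pH D pD; apply: (smallest_sub sH pH). Qed.

Lemma measurable_slab (t : R) d' (S : measurableType d') :
  measurable (`[0, t] `*` setT : set (RT * S)).
Proof. by apply: measurableX => //; exact: measurable_itv. Qed.
Arguments measurable_slab : clear implicits.

Lemma mem_slab d' (S : measurableType d') (t s : R) (w : S) :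
  ((s, w) \in `[0, t] `*` setT) = (s \in `[0, t]%classic).
Proof. by apply/idP/idP; rewrite !inE; [case|move=> h; split]. Qed.

Lemma slab_horizon t : t <= T -> `[0, t] `*` setT `<=` horizon.
Proof.
by move=> tT [s w] /=; rewrite /horizon /= !in_itv/= => -[/andP[-> /le_trans->]].
Qed.

(** Checked on rectangles: one that begins by time [t] has its base in the filtration at [t], and
    one that begins later misses the slab. Progressive measurability makes predictable processes and
    their time integrals adapted. *)
Lemma pred_system_progressive t D : 0 <= t <= T -> pred_system D ->
  measurable ((`[0, t] `*` setT) `&` D : set (RT * FtT t)).
Proof.
move=> /andP[t0 tT] pD.
pose H := [set E : set (R * Omega) | measurable ((`[0, t] `*` setT) `&` E : set (RT * FtT t))].
have tsub := slab_horizon tT.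
have := @horizon_ind H _ _ D pD; rewrite /H/= setIA (setIidl tsub); apply.
  split.
  - by rewrite /H/= setI0; exact: measurable0.
  - move=> A mA; rewrite /H/=.
    rewrite (_ : _ `&` _ = (`[0, t] `*` setT) `\` ((`[0, t] `*` setT) `&` A)).
      by apply: measurableD => //; exact: (measurable_slab t _ _).
    apply/seteqP; split => z /=.
      by move=> [tz [hz nA]]; split => // -[_ /nA].
    by move=> [tz nA]; split => //; split; [exact: tsub|move=> Az; apply: nA].
  - by move=> A mA; rewrite /H/= setI_bigcupr; apply: bigcup_measurable => k _; exact: mA.
move=> E [[E0 FE0 ->]|[s [u [E0 [s0 su uT FE0 ->]]]]]; rewrite /H/=.
  rewrite (_ : _ `&` _ = [set 0] `*` E0).
    by apply: measurableX; [exact: measurable_set1|exact: (FtS t0)].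
  apply/seteqP; split => -[r w] /=; first by move=> [_ []].
  by move=> [-> Ew]; rewrite in_itv/= lexx t0.
have [st|ts] := leP s t.
  rewrite (_ : _ `&` _ = (`[0, t] `&` `]s, u]) `*` E0).
    apply: measurableX; first by apply: measurableI; exact: measurable_itv.
    exact: (FtS st).
  by apply/seteqP; split => -[r w] /=; [move=> [[rt _] [ru Ew]]|move=> [[rt ru] Ew]].
rewrite (_ : _ `&` _ = set0); first exact: measurable0.
apply/seteqP; split => -[r w] //= [[]]; rewrite in_itv/= => /andP[_ rt] _ [].
by rewrite in_itv/= => /andP[sr _] _; have := lt_trans (le_lt_trans rt ts) sr; rewrite ltxx.
Qed.

Lemma predictable_progressive X t : 0 <= t <= T -> predictable X ->
  measurable_fun (`[0, t] `*` setT : set (RT * FtT t)) (fun z => X z.1 z.2).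
Proof.
move=> tT pX _ A mA.
have pA : pred_system (horizon `&` [set tw | A (X tw.1 tw.2)]).
  by rewrite /pred_system/= setIA setIid; exact: pX.
have /andP[_ /slab_horizon tT'] := tT.
by have := pred_system_progressive tT pA; rewrite setIA (setIidl tT').
Qed.

Lemma predictable_measurable X : predictable X ->
  measurable_fun (horizon : set (RT * Omega)) (fun z => X z.1 z.2).
Proof.
move=> pX; have TT : 0 <= T <= T by rewrite lexx ltW.
move=> mh A mA; have := predictable_progressive TT pX (measurable_slab T _ _) mA.
move=> h.
have mid : measurable_fun setT (fun z : RT * Omega => (z.1, z.2 : FtT T)).
  apply: measurable_fun_pair; first exact: measurable_fst.
  move=> _ E mE; rewrite setTI (_ : _ @^-1` _ = setT `*` E).
    by apply: measurableX => //; exact: (Ft_measurable Pc BM (lexx T)).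
  by apply/seteqP; split => -[r w] //= [].
have := mid measurableT _ h; rewrite setTI.
by congr measurable; apply/seteqP; split => -[].
Qed.

Lemma predictable_adapted X : predictable X -> adapted X.
Proof.
move=> pX t tT; have mX := (measurable_restrictT _ (measurable_slab t _ _)).1 (predictable_progressive tT pX).
apply/measurable_wrtP; apply: eq_measurable_fun (measurable_fun_pair2 (t : RT) mX) => w _.
by rewrite patchE mem_set//=; split => //=; rewrite in_itv/= lexx andbT; case/andP: tT.
Qed.

Lemma predictable_path X w t : predictable X -> 0 <= t <= T ->
  measurable_fun (`[0, t] : set RT) (fun s => X s w).
Proof.
move=> pX /andP[_ tT]; apply: (@measurable_funS _ _ _ _ `[0, T]%classic).
- exact: measurable_itv.
- by move=> s /=; rewrite !in_itv/= => /andP[-> /le_trans->].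
have mX := (measurable_restrictT _ (measurable_slab T _ _)).1 (predictable_measurable pX).
have [_] := measurable_restrictT (D := `[0, T]%classic : set RT) (fun s => X s w) (measurable_itv _).
apply; apply: eq_measurable_fun (measurable_fun_pair1 w mX) => s _.
by rewrite !patchE mem_slab.
Qed.

(** Tonelli on the slab for the positive and the negative part separately. The second factor carries
    the filtration at time [t], which makes the integral adapted. *)
Lemma measurable_integral_path (X : R -> Omega -> \bar R) t : 0 <= t <= T ->
  measurable_fun (`[0, t] `*` setT : set (RT * FtT t)) (fun z => X z.1 z.2) ->
  measurable_fun setT (fun w : FtT t => \int[leb]_(s in `[0%R, t]) X s w)%E.
Proof.
move=> tT.
suff ge0case (Z : R -> Omega -> \bar R) : (forall s w, 0 <= Z s w)%E ->
    measurable_fun (`[0, t] `*` setT : set (RT * FtT t)) (fun z => Z z.1 z.2) ->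
    measurable_fun setT (fun w : FtT t => \int[leb]_(s in `[0%R, t]) Z s w)%E.
  move=> mX; under eq_fun do rewrite integralE; apply: emeasurable_funB.
    apply: (ge0case (fun s w => (X^~ w)^\+ s)%E) => //.
    rewrite (_ : (fun z => _) = (fun z : RT * FtT t => X z.1 z.2)^\+%E); last first.
      by apply/funext => z; rewrite !funeposE.
    exact: measurable_funepos.
  apply: (ge0case (fun s w => (X^~ w)^\- s)%E) => //.
  rewrite (_ : (fun z => _) = (fun z : RT * FtT t => X z.1 z.2)^\-%E); last first.
    by apply/funext => z; rewrite !funenegE.
  exact: measurable_funeneg.
move=> Z0 mZ; have mZ' := (measurable_restrictT _ (measurable_slab t _ _)).1 mZ.
have Z'0 z : (0 <= ((fun z : RT * FtT t => Z z.1 z.2) \_ (`[0%R, t] `*` setT)) z)%E.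
  by rewrite patchE; case: ifP.
have := @measurable_fun_fubini_tonelli_G _ _ _ _ R leb _ mZ' Z'0.
apply: eq_measurable_fun => w _; rewrite /fubini_G [RHS]integral_mkcond.
apply: eq_integral => s _; by rewrite !patchE mem_slab.
Qed.

Lemma adapted_integral (X : R -> Omega -> R) : predictable X ->
  adapted (fun t w => \int[leb]_(s in `[0, t]) X s w).
Proof.
move=> pX t tT; apply/measurable_wrtP.
apply: measurableT_comp => //; apply: (measurable_integral_path tT).
by apply/measurable_EFinP; exact: predictable_progressive.
Qed.

Lemma tonelli_path (X : R -> Omega -> R) : predictable X -> (forall t w, 0 <= X t w) ->
  (\int[leb \x P]_(z in horizon) (X z.1 z.2)%:E =
   \int[P]_w \int[leb]_(t in `[0%R, T]) (X t w)%:E)%E.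
Proof.
move=> pX X0.
have /measurable_EFinP mX := predictable_measurable pX.
have mX' := (measurable_restrictT _ (measurable_slab T _ _)).1 mX.
have X'0 z : (0 <= ((fun z : RT * Omega => (X z.1 z.2)%:E) \_ (`[0%R, T] `*` setT)) z)%E.
  by rewrite patchE; case: ifP => // _; rewrite lee_fin.
rewrite integral_mkcond; transitivity (\int[P]_w fubini_G leb
    ((fun z : RT * Omega => (X z.1 z.2)%:E) \_ (`[0%R, T] `*` setT)) w)%E.
  exact: (fubini_tonelli2 _ mX' X'0).
apply: eq_integral => w _; rewrite /fubini_G [RHS]integral_mkcond.
apply: eq_integral => s _; by rewrite !patchE mem_slab.
Qed.

End predictable_facts.

Lemma ge0_integral_le_lin d (X : measurableType d) (R : realType)
    (mu : {measure set X -> \bar R}) (D : set X) (f g h : X -> \bar R) (a b : R) :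
  0 <= a -> 0 <= b ->
  measurable D -> measurable_fun D f -> measurable_fun D g -> measurable_fun D h ->
  (forall x, D x -> 0 <= f x)%E -> (forall x, D x -> 0 <= g x)%E -> (forall x, D x -> 0 <= h x)%E ->
  (forall x, D x -> h x <= a%:E * f x + b%:E * g x)%E ->
  (\int[mu]_(x in D) h x <= a%:E * \int[mu]_(x in D) f x + b%:E * \int[mu]_(x in D) g x)%E.
Proof.
move=> a0 b0 mD mf mg mh f0 g0 h0 le.
rewrite -!ge0_integralZl// -ge0_integralD//.
- apply: ge0_le_integral => //.
  by apply: emeasurable_funD; exact: measurable_funeM.
- by move=> x Dx; rewrite mule_ge0// f0.
- exact: measurable_funeM.
- by move=> x Dx; rewrite mule_ge0// g0.
- exact: measurable_funeM.
Qed.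

Section predictable_operations.
Context d (Omega : measurableType d) (R : realType) (P : probability Omega R).
Context (T : R) (m : nat) (B : R -> Omega -> 'cV[R]_m).
Hypothesis Pc : measure_is_complete P.
Hypothesis BM : brownian_motion P T B.
Hypothesis T0 : 0 < T.

Local Notation Ft := (augmented_filtration P B).
Local Notation predictable := (predictable P T B).
Local Notation vpred := (mx_predictable P T B).
Local Notation pred_system := (pred_system P T B).
Local Notation PT := (g_sigma_algebraType pred_system).
Local Notation simple_predictable := (simple_predictable P T B).
Local Notation leb := (@lebesgue_measure R).
Local Notation RT := (measurableTypeR R).
Local Notation horizon := (@horizon d Omega R T).
Local Notation process := (R -> Omega -> 'cV[R]_m).

Lemma predictable_cst (c : R) : predictable (fun _ _ => c).
Proof. by apply/predictableP; exact: measurable_cst. Qed.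

Lemma predictableD X Y : predictable X -> predictable Y -> predictable (fun t w => X t w + Y t w).
Proof. by move=> /predictableP mX /predictableP mY; apply/predictableP; exact: measurable_funD. Qed.

Lemma predictableM X Y : predictable X -> predictable Y -> predictable (fun t w => X t w * Y t w).
Proof. by move=> /predictableP mX /predictableP mY; apply/predictableP; exact: measurable_funM. Qed.

Lemma predictable_sum I (r : seq I) (X : I -> R -> Omega -> R) :
  (forall i, predictable (X i)) -> predictable (fun t w => \sum_(i <- r) X i t w).
Proof.
move=> mX; apply/predictableP.
apply: (@measurable_sum _ PT R setT I r (fun i z => X i z.1 z.2)) => i.
exact/predictableP.
Qed.

Lemma predictable_comp (f : R -> R) X : measurable_fun setT f -> predictable X ->
  predictable (fun t w => f (X t w)).
Proof.
by move=> mf /predictableP mX; apply/predictableP; exact: (measurableT_comp mf mX).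
Qed.

Lemma eq_predictable X Y : (forall t w, 0 <= t <= T -> X t w = Y t w) -> predictable X -> predictable Y.
Proof.
move=> XY pX A mA; have := pX A mA; congr (<<s _, _ >> _).
apply/seteqP; split => -[t w] /= [[tT _]]; rewrite -/(_ t w) => H; split => //.
  by rewrite -XY// -in_itv.
by rewrite XY// -in_itv.
Qed.

Lemma predictable_dotv n (X Y : R -> Omega -> 'cV[R]_n) : mx_predictable P T B X ->
  mx_predictable P T B Y -> predictable (fun t w => dotv (X t w) (Y t w)).
Proof. by move=> pX pY; apply: predictable_sum => i; exact: predictableM. Qed.

Lemma predictable_enorm2 n (X : R -> Omega -> 'cV[R]_n) : mx_predictable P T B X ->
  predictable (fun t w => enorm (X t w) ^+ 2).
Proof.
move=> pX; apply: (@eq_predictable (fun t w => dotv (X t w) (X t w))).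
  by move=> t w _; rewrite enorm2.
exact: predictable_dotv.
Qed.

Lemma mx_predictableD p q (X Y : R -> Omega -> 'M[R]_(p, q)) : mx_predictable P T B X ->
  mx_predictable P T B Y -> mx_predictable P T B (fun t w => X t w + Y t w).
Proof.
move=> pX pY i j; apply: (@eq_predictable (fun t w => X t w i j + Y t w i j)).
  by move=> t w _; rewrite mxE.
exact: predictableD.
Qed.

Lemma mx_predictable_scale p q (h : R -> Omega -> R) (X : R -> Omega -> 'M[R]_(p, q)) :
  predictable h -> mx_predictable P T B X -> mx_predictable P T B (fun t w => h t w *: X t w).
Proof.
move=> ph pX i j; apply: (@eq_predictable (fun t w => h t w * X t w i j)).
  by move=> t w _; rewrite mxE.
exact: predictableM.
Qed.

Lemma mx_predictable_cst p q (M : 'M[R]_(p, q)) : mx_predictable P T B (fun _ _ => M).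
Proof. by move=> i j; exact: predictable_cst. Qed.

Lemma mx_predictableZ p q a (X : R -> Omega -> 'M[R]_(p, q)) :
  mx_predictable P T B X -> mx_predictable P T B (fun t w => a *: X t w).
Proof. by move=> pX; apply: mx_predictable_scale => //; exact: predictable_cst. Qed.

Lemma mx_predictableB p q (X Y : R -> Omega -> 'M[R]_(p, q)) : mx_predictable P T B X ->
  mx_predictable P T B Y -> mx_predictable P T B (fun t w => X t w - Y t w).
Proof.
move=> pX pY; rewrite (_ : (fun t w => _) = fun t w => X t w + (-1) *: Y t w).
  by apply: mx_predictableD => //; exact: mx_predictableZ.
by apply/funext => t; apply/funext => w; rewrite scaleN1r.
Qed.

Lemma pred_system_rectangle s u E : 0 <= s -> u <= T -> Ft s E -> pred_system (`]s, u] `*` E).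
Proof.
move=> s0 uT FE; have [h0 _ _] := sigma_algebra_pred_system P T B.
have [su|us] := ltP s u; last first.
  rewrite (_ : _ `*` _ = set0)//; apply/seteqP; split => -[r w] //= [].
  by rewrite in_itv/= => /andP[/lt_le_trans h /h]; rewrite ltNge us.
rewrite /pred_system/=; apply: sub_sigma_algebra; right; exists s, u, E; split => //.
apply/seteqP; split => -[r w] /=; first by case.
move=> [ru Ew]; do !split => //; move: ru; rewrite !in_itv/= => /andP[/ltW sr ru].
by rewrite in_itv/= (le_trans s0 sr) (le_trans ru).
Qed.

Lemma predictable_step s u (xi : Omega -> R) : 0 <= s -> u <= T -> measurable_wrt (Ft s) xi ->
  predictable (fun t w => (t \in `]s, u])%:R * xi w).
Proof.
move=> s0 uT mxi; apply/predictableP => _ A mA; rewrite setTI.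
pose D := (`]s, u] `*` (xi @^-1` A)).
pose D' := (`]s, u] `*` setT : set (R * Omega)).
have mD : measurable (D : set PT) by apply: sub_sigma_algebra; apply: pred_system_rectangle => //; exact: mxi.
have mD' : measurable (D' : set PT).
  by apply: sub_sigma_algebra; apply: pred_system_rectangle => //; exact: g_sigma_algebraT.
(* Off the strip the process is 0, so the preimage contains the complement of the strip exactly when
   [A] contains 0. *)
rewrite (_ : _ @^-1` _ = D `|` (if pselect (A 0) then ~` D' else set0)).
  by apply: measurableU => //; case: pselect => A0; [exact: measurableC|exact: measurable0].
apply/seteqP; split => -[t w] /=.
  case: (boolP (t \in `]s, u])) => tsu; first by rewrite mul1r => Axi; left; split.
  rewrite mul0r => A0; right; case: pselect => // _ [] /=.
  by rewrite (negbTE tsu).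
move=> [[tsu Axi]|].
  by rewrite (_ : t \in _ = true)// mul1r.
case: pselect => // A0 /= nD.
case: (boolP (t \in `]s, u])) => tsu; last by rewrite mul0r.
by exfalso; apply: nD; split.
Qed.

Lemma sp_eval_predictable S : simple_predictable S -> vpred (sp_eval S).
Proof.
move=> [h1 h2 h3 h4] i j.
apply: (@eq_predictable (fun t w => \sum_(k < sp_size S)
    (t \in `]sp_time S k, sp_time S k.+1])%:R * sp_val S k w i ord0)).
  by move=> t w _; rewrite (ord1 j) /sp_eval summxE; apply: eq_bigr => k _; rewrite mxE.
apply: predictable_sum => k; apply: predictable_step.
- by have /andP[] := h1 k (ltnW (ltn_ord k)).
- by have /andP[] := h1 k.+1 (ltn_ord k).
- exact: h3.
Qed.

(** The squared L2 distance for the product of time and probability; being squared, it satisfies the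
    triangle inequality with factors 2, whence the tolerances [e / 4] below. *)
Definition dist2 (X Y : process) : \bar R :=
  (\int[leb \x P]_(z in horizon) (enorm (X z.1 z.2 - Y z.1 z.2) ^+ 2)%:E)%E.

Definition approximable (X : process) : Prop := vpred X /\
  forall e : R, 0 < e -> exists2 S, simple_predictable S & (dist2 (sp_eval S) X <= e%:E)%E.

Lemma measurable_horizon : measurable (horizon : set (RT * Omega)).
Proof. exact: measurable_slab. Qed.

Lemma measurable_enorm2 (X : process) : vpred X ->
  measurable_fun (horizon : set (RT * Omega)) (fun z => (enorm (X z.1 z.2) ^+ 2)%:E).
Proof.
move=> pX; apply/measurable_EFinP.
exact: (predictable_measurable Pc BM T0 (predictable_enorm2 pX)).
Qed.

Lemma dist2_add (X1 X2 Y1 Y2 : process) : vpred X1 -> vpred X2 -> vpred Y1 -> vpred Y2 ->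
  (dist2 (fun t w => X1 t w + X2 t w)%R (fun t w => Y1 t w + Y2 t w)%R
    <= 2%:E * dist2 X1 Y1 + 2%:E * dist2 X2 Y2)%E.
Proof.
move=> pX1 pX2 pY1 pY2; rewrite /dist2.
have m1 := measurable_enorm2 (mx_predictableB pX1 pY1).
have m2 := measurable_enorm2 (mx_predictableB pX2 pY2).
have m3 := measurable_enorm2 (mx_predictableB (mx_predictableD pX1 pX2) (mx_predictableD pY1 pY2)).
apply: (@ge0_integral_le_lin _ _ _ (leb \x P)%E _ _ _ _ 2 2 (ler0n _ 2) (ler0n _ 2) measurable_horizon m1 m2 m3);
  try by move=> z _; rewrite lee_fin sqr_ge0.
move=> z _; rewrite -!EFinM -EFinD lee_fin opprD addrACA; exact: enorm2D_le.
Qed.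

Lemma dist2_trans (X Y Z : process) : vpred X -> vpred Y -> vpred Z ->
  (dist2 X Z <= 2%:E * dist2 X Y + 2%:E * dist2 Y Z)%E.
Proof.
move=> pX pY pZ.
have m1 := measurable_enorm2 (mx_predictableB pX pY).
have m2 := measurable_enorm2 (mx_predictableB pY pZ).
have m3 := measurable_enorm2 (mx_predictableB pX pZ).
apply: (@ge0_integral_le_lin _ _ _ (leb \x P)%E _ _ _ _ 2 2 (ler0n _ 2) (ler0n _ 2) measurable_horizon m1 m2 m3);
  try by move=> z _; rewrite lee_fin sqr_ge0.
move=> z _; rewrite -!EFinM -EFinD lee_fin; apply: le_trans (enorm2D_le _ _).
by rewrite addrA subrK.
Qed.

Lemma dist2_scale a (X Y : process) : vpred X -> vpred Y ->
  dist2 (fun t w => a *: X t w) (fun t w => a *: Y t w) = ((a ^+ 2)%:E * dist2 X Y)%E.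
Proof.
move=> pX pY; rewrite /dist2 -ge0_integralZl//.
- by apply: eq_integral => z _; rewrite -scalerBr enormZ EFinM.
- exact: measurable_horizon.
- exact: (measurable_enorm2 (mx_predictableB pX pY)).
- by move=> z _; rewrite lee_fin sqr_ge0.
- by rewrite lee_fin sqr_ge0.
Qed.

Lemma approximable_eq (X Y : process) : (forall t w, 0 <= t <= T -> X t w = Y t w) ->
  approximable X -> approximable Y.
Proof.
move=> XY [pX aX]; split.
  by move=> i j; apply: eq_predictable (pX i j) => t w tT; rewrite XY.
move=> e e0; have [S hS hd] := aX e e0; exists S; first exact: hS.
apply: le_trans hd; rewrite le_eqVlt; apply/orP; left; apply/eqP.
apply: eq_integral => -[t w]; rewrite inE => -[/=]; rewrite in_itv/= => tT _.
by rewrite XY.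
Qed.

Lemma approximable_lim (X : process) : vpred X ->
  (forall e : R, 0 < e -> exists2 Y, approximable Y & (dist2 Y X <= e%:E)%E) -> approximable X.
Proof.
move=> pX h; split => // e e0.
have e4 : 0 < e / 4 by rewrite divr_gt0.
have [Y [pY aY] YX] := h _ e4; have [S hS SY] := aY _ e4.
exists S; first exact: hS.
apply: le_trans (dist2_trans (sp_eval_predictable hS) pY pX) _.
rewrite (_ : e%:E = 2%:E * (e / 4)%:E + 2%:E * (e / 4)%:E)%E; last first.
  by rewrite -!EFinM -EFinD; congr EFin; field.
exact: leeD (lee_wpmul2l _ SY) (lee_wpmul2l _ YX).
Qed.

Lemma approximableD (X Y : process) : approximable X -> approximable Y ->
  approximable (fun t w => X t w + Y t w).
Proof.
move=> [pX aX] [pY aY]; split; first exact: mx_predictableD.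
move=> e e0; have e4 : 0 < e / 4 by rewrite divr_gt0.
have [S1 h1 d1] := aX _ e4; have [S2 h2 d2] := aY _ e4.
have [S [hS Sev _]] := sp_add h1 h2; exists S; first exact: hS.
rewrite (_ : sp_eval S = fun t w => sp_eval S1 t w + sp_eval S2 t w); last first.
  by apply/funext => t; apply/funext => w.
apply: le_trans (dist2_add (sp_eval_predictable h1) (sp_eval_predictable h2) pX pY) _.
rewrite (_ : e%:E = 2%:E * (e / 4)%:E + 2%:E * (e / 4)%:E)%E; last first.
  by rewrite -!EFinM -EFinD; congr EFin; field.
exact: leeD (lee_wpmul2l _ d1) (lee_wpmul2l _ d2).
Qed.

Lemma approximableZ a (X : process) : approximable X -> approximable (fun t w => a *: X t w).
Proof.
move=> [pX aX]; split; first exact: mx_predictableZ.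
(* Adding 1 to the square covers [a = 0]. *)
move=> e e0; have ea : 0 < e / (a ^+ 2 + 1) by rewrite divr_gt0// ltr_wpDl ?sqr_ge0.
have [S hS hd] := aX _ ea; exists (sp_scale a S); first exact: sp_scale_predictable.
rewrite (_ : sp_eval (sp_scale a S) = fun t w => a *: sp_eval S t w); last first.
  by apply/funext => t; apply/funext => w; exact: sp_scale_eval.
rewrite dist2_scale//; last exact: sp_eval_predictable.
apply: (@le_trans _ _ ((a ^+ 2)%:E * (e / (a ^+ 2 + 1))%:E)%E).
  by apply: lee_wpmul2l => //; rewrite lee_fin sqr_ge0.
rewrite -EFinM lee_fin mulrCA ler_piMr ?(ltW e0)// ler_pdivrMr ?mul1r ?lerDl//.
by rewrite ltr_wpDl ?sqr_ge0.
Qed.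

Lemma approximable0 : approximable (fun _ _ => 0).
Proof.
split; first exact: mx_predictable_cst.
move=> e e0; have [S hS hev] := sp_zero P B T0; exists S; first exact: hS.
rewrite /dist2 integral0_eq ?lee_fin ?ltW// => z _.
by rewrite hev subr0 enorm0 expr0n.
Qed.

Lemma approximable_sum I (r : seq I) (X : I -> process) : (forall i, approximable (X i)) ->
  approximable (fun t w => \sum_(i <- r) X i t w).
Proof.
move=> aX; elim: r => [|i r IH].
  by apply: approximable_eq approximable0 => t w _; rewrite big_nil.
by apply: approximable_eq (approximableD (aX i) IH) => t w _; rewrite big_cons.
Qed.

Lemma dist2_le_cst (X Y : process) (c : R) : vpred X -> vpred Y ->
  (forall t w, 0 <= t <= T -> enorm (X t w - Y t w) ^+ 2 <= c) -> (dist2 X Y <= (c * T)%:E)%E.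
Proof.
move=> pX pY XYc.
apply: (@le_trans _ _ (\int[leb \x P]_(z in horizon) c%:E)%E).
  apply: ge0_le_integral => //; first exact: measurable_horizon.
  - by move=> z _; rewrite lee_fin sqr_ge0.
  - exact: (measurable_enorm2 (mx_predictableB pX pY)).
  - by move=> -[t w] [/=]; rewrite in_itv/= => tT _; rewrite lee_fin; exact: XYc.
rewrite integral_cst//; last exact: measurable_horizon.
rewrite [X in (_ * X)%E](_ : _ = leb `[0%R, T]%classic * P setT)%E; last first.
  apply: product_measure1E; first exact: measurable_itv.
  exact: measurableT.
rewrite [P _]probability_setT mule1 lebesgue_measure_itv/= lte_fin T0.
by rewrite oppr0 adde0.
Qed.

End predictable_operations.

(** * Density of simple processes among bounded predictable ones *)

Section simple_density.
Context d (Omega : measurableType d) (R : realType) (P : probability Omega R).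
Context (T : R) (m : nat) (B : R -> Omega -> 'cV[R]_m).
Hypothesis Pc : measure_is_complete P.
Hypothesis BM : brownian_motion P T B.
Hypothesis T0 : 0 < T.

Local Notation predictable := (predictable P T B).
Local Notation vpred := (mx_predictable P T B).
Local Notation pred_system := (pred_system P T B).
Local Notation PT := (g_sigma_algebraType pred_system).
Local Notation leb := (@lebesgue_measure R).
Local Notation RT := (measurableTypeR R).
Local Notation horizon := (@horizon d Omega R T).
Local Notation process := (R -> Omega -> 'cV[R]_m).
Local Notation approximable := (approximable P T B).
Local Notation dist2 := (@dist2 d Omega R P T m).

Lemma pred_system_measurable D : pred_system D -> measurable (horizon `&` D : set (RT * Omega)).
Proof.
move=> pD; have mh : measurable (horizon : set (RT * Omega)) by exact: measurable_horizon.
have := predictable_measurable Pc BM T0 (predictable_set pD) mh (@measurable_set1 _ (1:R)).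
congr measurable; apply/seteqP; split => -[t w] /= [hz]; rewrite indicE.
  by move=> h; split => //; apply: contrapT => nD; move: h; rewrite memNset// => /eqP; rewrite eq_sym oner_eq0.
by move=> Dz; split => //; rewrite mem_set.
Qed.

Lemma pred_systemE : <<s pred_system >> = pred_system.
Proof. exact/sigma_algebra_id/sigma_algebra_pred_system. Qed.

Lemma mu_horizon : (leb \x P)%E (horizon : set (RT * Omega)) = T%:E.
Proof.
transitivity (leb `[0%R, T]%classic * P setT)%E.
  apply: product_measure1E; first exact: measurable_itv.
  exact: measurableT.
by rewrite [P _]probability_setT mule1 lebesgue_measure_itv/= lte_fin T0 oppr0 adde0.
Qed.

Lemma pred_systemW D : <<s horizon, predictable_rectangles P T B >> D -> D `<=` horizon -> pred_system D.
Proof. by move=> sD Dh; rewrite /pred_system/= setIidr. Qed.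

Lemma pred_system_horizon : pred_system horizon.
Proof.
have [h0 hC _] := smallest_sigma_algebra horizon (predictable_rectangles P T B).
by rewrite /pred_system/= setIid; have := hC _ h0; rewrite setD0.
Qed.

Lemma predictable_indic_scale D (v : 'cV[R]_m) : pred_system D -> vpred (fun t w => \1_D (t, w) *: v).
Proof.
by move=> pD; apply: mx_predictable_scale; [exact: predictable_set|exact: mx_predictable_cst].
Qed.

Lemma dist2_indic_le (X Y : process) (N : set (RT * Omega)) (c : R) : vpred X -> vpred Y ->
  0 <= c -> measurable N -> (forall t w, 0 <= t <= T -> enorm (X t w - Y t w) ^+ 2 <= c * \1_N (t, w)) ->
  (dist2 X Y <= c%:E * (leb \x P)%E N)%E.
Proof.
move=> pX pY c0 mN XYN.
have mh : measurable (horizon : set (RT * Omega)) by exact: measurable_horizon.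
apply: (@le_trans _ _ (\int[leb \x P]_(z in horizon) (c%:E * (\1_N z)%:E))%E).
  apply: ge0_le_integral => //.
  - by move=> z _; rewrite lee_fin sqr_ge0.
  - exact: (measurable_enorm2 Pc BM T0 (mx_predictableB pX pY)).
  - apply: measurable_funeM; apply/measurable_EFinP.
    by apply: measurable_funTS; exact: measurable_indic.
  - move=> -[t w] [/=]; rewrite in_itv/= => tT _; rewrite -EFinM lee_fin; exact: XYN.
rewrite ge0_integralZl//; last first.
  apply/measurable_EFinP; apply: measurable_funTS; exact: measurable_indic.
apply: lee_wpmul2l; first by rewrite lee_fin.
rewrite integral_indic//; apply: le_measure; rewrite ?inE//; exact: measurableI.
Qed.

Lemma measurable_mu_slice (t : R) : (leb \x P)%E ([set t] `*` setT : set (RT * Omega)) = 0%E.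
Proof.
transitivity (leb [set t] * P setT)%E.
  by apply: product_measure1E; [exact: measurable_set1|exact: measurableT].
by rewrite lebesgue_measure_set1 mul0e.
Qed.

(** The class for a pi-lambda argument from rectangles to all predictable sets; every vector [v] is
    allowed as a value. *)
Definition approx_sets : set (set (R * Omega)) :=
  [set D | [/\ D `<=` horizon, pred_system D & forall v, approximable (fun t w => \1_D (t, w) *: v)]].

(** A half-open rectangle is itself a simple process. A rectangle at time 0 is at distance 0 from
    the zero process, since one instant has measure zero. *)
Lemma approx_sets_rectangle : predictable_rectangles P T B `<=` approx_sets.
Proof.
move=> D [[E FE ->]|[s [u [E [s0 su uT FE ->]]]]].
  have sub : [set (0:R)] `*` E `<=` horizon.
    by move=> [t w] [/= -> _]; split => //=; rewrite in_itv/= lexx ltW.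
  have pD : pred_system ([set 0] `*` E).
    by apply: pred_systemW => //; apply: sub_sigma_algebra; left; exists E.
  split => // v; split; first exact: predictable_indic_scale.
  move=> e e0; have [S hS hev] := @sp_zero _ _ _ P T m B T0; exists S; first exact: hS.
  apply: (@le_trans _ _ 0%E); last by rewrite lee_fin ltW.
  rewrite -[leRHS](mule0 (enorm v ^+ 2)%:E) -(measurable_mu_slice 0).
  apply: dist2_indic_le.
  - exact: sp_eval_predictable.
  - exact: predictable_indic_scale.
  - exact: sqr_ge0.
  - by apply: measurableX; [exact: measurable_set1|exact: measurableT].
  - move=> t w _; rewrite hev sub0r enormN enormZ mulrC ler_wpM2l ?sqr_ge0//.
    rewrite !indicE; case: (boolP (_ \in [set 0] `*` E)); rewrite ?inE => h; last by rewrite expr0n.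
    by rewrite expr1n (mem_set (_ : ([set 0] `*` setT) (t, w)))//; split => //; case: h.
have pD : pred_system (`]s, u] `*` E) by exact: pred_system_rectangle.
split => //.
  move=> [t w] [/=]; rewrite in_itv/= => /andP[/ltW st tu] _; split => //=.
  by rewrite in_itv/= (le_trans s0 st) (le_trans tu).
move=> v; have [S hS hev] := sp_rectangle v s0 su uT FE.
split; first exact: predictable_indic_scale.
move=> e e0; exists S; first exact: hS.
apply: (@le_trans _ _ 0%E); last by rewrite lee_fin ltW.
rewrite /dist2 integral0_eq// => -[t w] _ /=.
rewrite hev (_ : _ *: _ = \1_(`]s, u] `*` E) (t, w) *: v) ?subrr ?enorm0 ?expr0n//.
rewrite scalerA !indicE; congr (_ *: v).
rewrite -natrM mulnb; congr (nat_of_bool _)%:R.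
by apply/andP/idP => [[h1 h2]|]; rewrite inE; [split => //; exact: set_mem|case=> ? ?; split => //; exact: mem_set].
Qed.

(** The whole horizon differs from the simple process on []0, T]] only at time 0. Proper differences
    are linear combinations. An increasing union is approximated by its members, because the measure
    is finite and the remainders decrease to the empty set. *)
Lemma approx_sets_lambda : lambda_system horizon approx_sets.
Proof.
split.
- by move=> A [].
- split => //; first exact: pred_system_horizon.
  move=> v; split; first exact: predictable_indic_scale pred_system_horizon.
  move=> e e0.
  have [S hS hev] := sp_rectangle v (lexx 0) T0 (lexx T) (@g_sigma_algebraT _ (Ft_gen P B 0)).
  exists S; first exact: hS.
  apply: (@le_trans _ _ 0%E); last by rewrite lee_fin ltW.
  rewrite -[leRHS](mule0 (enorm v ^+ 2)%:E) -(measurable_mu_slice 0).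
  apply: dist2_indic_le.
  - exact: sp_eval_predictable.
  - exact: predictable_indic_scale pred_system_horizon.
  - exact: sqr_ge0.
  - by apply: measurableX; [exact: measurable_set1|exact: measurableT].
  - move=> t w tT; rewrite hev !indicE in_setT scale1r.
    have hz : ((t, w) \in horizon) = true by apply: mem_set; split => //=; rewrite in_itv.
    rewrite hz {hz}.
    rewrite scale1r -scaleN1r -scalerDl enormZ mulrC ler_wpM2l ?sqr_ge0//.
    have /andP[t0 tT'] := tT; rewrite in_itv/= tT' andbT lt_neqAle t0 andbT.
    have [<-|t0'] := eqVneq 0 t.
      by rewrite add0r sqrrN expr1n (mem_set (_ : ([set 0] `*` setT) (0, w))).
    by rewrite subrr expr0n.
- move=> A D DA [Ah pA aA] [Dh pD aD]; split.
  + by move=> z [/Ah].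
  + by rewrite -pred_systemE; apply: (@measurableD _ PT); apply: sub_sigma_algebra.
  + move=> v; have aAD := approximableD Pc BM T0 (aA v) (approximableZ Pc BM T0 (-1) (aD v)).
    apply: (approximable_eq _ aAD) => t w _.
    rewrite scalerA -scalerDl; congr (_ *: _); rewrite !indicE in_setD mulN1r.
    case: (boolP ((t, w) \in D)) => [|_]; last by rewrite subr0 andbT.
    by rewrite inE => /DA h; rewrite (mem_set h) subrr.
- move=> F ndF aF; pose U := \bigcup_n F n.
  have Uh : U `<=` horizon by move=> z [n _ Fz]; have [h _ _] := aF n; exact: h.
  have pU : pred_system U.
    rewrite -pred_systemE; apply: (@bigcup_measurable _ PT) => n _.
    by apply: sub_sigma_algebra; have [] := aF n.
  split => // v; apply: approximable_lim => //; first exact: predictable_indic_scale.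
  move=> e e0; pose N n := U `\` F n.
  have pN n : pred_system (N n).
    rewrite -pred_systemE; apply: (@measurableD _ PT); apply: sub_sigma_algebra => //.
    by have [] := aF n.
  have Nh n : N n `<=` horizon by move=> z [/Uh].
  have mN n : measurable (N n : set (RT * Omega)).
    by rewrite -(setIidr (@Nh n)); exact: pred_system_measurable.
  have N0 : \bigcap_n N n = set0.
    apply/seteqP; split => // z h; have [[n _ Fz] _] := h 0%N I.
    by have [_] := h n I.
  have : (leb \x P)%E \o (N : nat -> set (RT * Omega)) @ \oo --> (leb \x P)%E (\bigcap_n N n).
    apply: nonincreasing_cvg_mu => //.
    - apply: (@le_lt_trans _ _ T%:E); last exact: ltry.
      rewrite -mu_horizon; apply: le_measure; rewrite ?inE//; exact: measurable_horizon.
    - by rewrite N0.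
    - move=> i j ij; apply/subsetPset => z [Uz nF]; split => // Fi; apply: nF.
      by have /subsetPset := ndF _ _ ij; apply.
  rewrite N0 measure0 => /fine_cvgP[fN cN].
  have ev : 0 < e / (enorm v ^+ 2 + 1) by rewrite divr_gt0// ltr_wpDl ?sqr_ge0.
  have /cvgrPdist_le/(_ _ ev) cN' := cN.
  have [n _ hn] : \forall n \near \oo, ((leb \x P)%E (N n : set (RT * Omega)) <= (e / (enorm v ^+ 2 + 1))%:E)%E.
    near=> n; have fn : (leb \x P)%E (N n : set (RT * Omega)) \is a fin_num by near: n.
    rewrite -(fineK fn) lee_fin; have : `|0 - fine ((leb \x P)%E (N n : set (RT * Omega)))| <= e / (enorm v ^+ 2 + 1) by near: n.
    by rewrite sub0r normrN; apply: le_trans; exact: ler_norm.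
  exists (fun t w => \1_(F n) (t, w) *: v); first by have [_ _] := aF n.
  apply: (@le_trans _ _ ((enorm v ^+ 2)%:E * (leb \x P)%E (N n : set (RT * Omega)))%E).
    apply: dist2_indic_le => //.
    - by apply: predictable_indic_scale; have [] := aF n.
    - exact: predictable_indic_scale.
    - exact: sqr_ge0.
    - move=> t w _; rewrite -scalerBl enormZ mulrC ler_wpM2l ?sqr_ge0// /N !indicE in_setD.
      case: (boolP (_ \in F n)) => [|_].
        rewrite inE => Fz; rewrite (mem_set (_ : U (t, w))) ?subrr ?expr0n//.
        by exists n.
      by rewrite sub0r sqrrN andbT; case: (_ \in U); rewrite ?expr1n ?expr0n.
  apply: (@le_trans _ _ ((enorm v ^+ 2)%:E * (e / (enorm v ^+ 2 + 1))%:E)%E).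
    apply: lee_wpmul2l; first by rewrite lee_fin sqr_ge0.
    exact: (hn n (leqnn n)).
  rewrite -EFinM lee_fin mulrCA ler_piMr ?(ltW e0)// ler_pdivrMr ?mul1r ?lerDl//.
  by rewrite ltr_wpDl ?sqr_ge0.
Unshelve. all: by end_near. Qed.

Lemma approximable_indic D v : pred_system D -> D `<=` horizon ->
  approximable (fun t w => \1_D (t, w) *: v).
Proof.
move=> pD Dh; have [_ _] : approx_sets D; last exact.
have : <<s horizon, predictable_rectangles P T B >> D by have := pD; rewrite /pred_system/= (setIidr Dh).
move: (D); apply: (@lambda_system_subset _ (predictable_rectangles P T B) _ horizon).
- move=> D1 D2 [[E1 F1 ->]|[s [u [E1 [s0 su uT F1 ->]]]]] [[E2 F2 ->]|[r [q [E2 [r0 rq qT F2 ->]]]]].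
  + left; exists (E1 `&` E2); first exact: g_sigma_algebraI.
    by apply/seteqP; split => -[t w] /=; [move=> [[-> ?] [_ ?]]|move=> [-> [? ?]]].
  (* A disjoint pair still has to meet in a rectangle: the empty set is the one at time 0 over the
     empty event. *)
  + left; exists set0; first exact: sigma_algebra0.
    apply/seteqP; split => -[t w] /=; last by case.
    by move=> [[-> _] [] ]; rewrite in_itv/= ltNge r0.
  + left; exists set0; first exact: sigma_algebra0.
    apply/seteqP; split => -[t w] /=; last by case.
    by move=> [] [h _] [h' _]; move: h; rewrite h' in_itv/= ltNge s0.
  + have [sr|sr] := ltP (Num.max s r) (Num.min u q); last first.
      left; exists set0; first exact: sigma_algebra0.
      apply/seteqP; split => -[t w] /=; last by case.
      move=> [] [+ _] [+ _]; rewrite !in_itv/= => /andP[st tu] /andP[rt tq].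
      have : Num.max s r < Num.min u q by rewrite lt_min !gt_max !(lt_le_trans _ tu) ?(lt_le_trans _ tq).
      by rewrite ltNge sr.
    right; exists (Num.max s r), (Num.min u q), (E1 `&` E2); split => //.
    * by rewrite le_max s0.
    * by rewrite ge_min uT.
    * apply: g_sigma_algebraI; [apply: FtS F1|apply: FtS F2]; by rewrite le_max lexx ?orbT.
    * apply/seteqP; split => -[t w] /=; rewrite !in_itv/= gt_max le_min.
        by move=> [[/andP[-> ->] ?] [/andP[-> ->] ?]].
      by move=> [/andP[/andP[-> ->] /andP[-> ->]] [? ?]].
- exact: approx_sets_lambda.
- exact: approx_sets_rectangle.
- apply: smallest_sub.
    split; [by move=> z|by move=> A _ z []|by move=> A hA z [n _ /hA]].
  by move=> A /approx_sets_rectangle[].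
Qed.

Lemma predictable_level (h : R -> Omega -> R) (c : R) : predictable h ->
  pred_system (horizon `&` [set z | c <= h z.1 z.2]).
Proof.
move=> ph; have := ph `[c, +oo[%classic (measurable_itv _).
rewrite /pred_system/= setIA setIid; congr (<<s _, _ >> _).
by apply/seteqP; split => -[t w] [? /=]; rewrite ?in_itv/= ?andbT.
Qed.

(** The sum counts the positive integers up to [x], so it is the integer part of [x]. *)
Lemma count_floor (N : nat) (x : R) : 0 <= x <= N%:R ->
  x - 1 <= \sum_(j < N) ((j.+1%:R <= x)%R%:R : R) <= x.
Proof.
elim: N x => [|N IH] x /andP[x0 xN].
  rewrite big_ord0 x0 andbT subr_le0; apply: le_trans xN _; exact: ler01.
rewrite big_ord_recr/=; have [xN'|Nx] := leP x N%:R.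
  have := IH x; rewrite x0 xN' => /(_ isT).
  have -> : (N.+1%:R <= x) = false.
    by apply/negbTE; rewrite -ltNge; apply: le_lt_trans xN' _; rewrite ltr_nat.
  by rewrite addr0.
rewrite (eq_bigr (fun=> 1)); last first.
  by move=> j _; rewrite (le_trans _ (ltW Nx))// ler_nat.
rewrite sumr_const card_ord.
have [h|h] := leP N.+1%:R x.
  by rewrite /= mulr1n; rewrite -natr1 in h xN; apply/andP; split; lra.
by rewrite /= addr0; rewrite -natr1 in h xN; apply/andP; split; lra.
Qed.

(** The coefficient [h] is replaced by [q] times the integer part of [h / q], which is a finite sum
    of indicators of the level sets [D j]. *)
Lemma approximable_ge0 (h : R -> Omega -> R) (K : R) v : predictable h ->
  (forall t w, 0 <= t <= T -> 0 <= h t w <= K) -> approximable (fun t w => h t w *: v).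
Proof.
move=> ph hK; apply: (approximable_lim Pc BM T0).
  by apply: mx_predictable_scale => //; exact: mx_predictable_cst.
move=> e e0; set V := enorm v ^+ 2; have V0 : 0 <= V := sqr_ge0 _.
have VT : 0 <= V * T by rewrite mulr_ge0// ltW.
(* The staircase errs by at most [q], so the squared distance is at most [q^2 V T]; this is at most
   [e], using [q <= 1] for one of the two factors. *)
pose q := Num.min 1 (e / (V * T + 1)).
have q0 : 0 < q by rewrite lt_min ltr01 divr_gt0// ltr_wpDl.
have q1 : q <= 1 by rewrite ge_min lexx.
have qe : q ^+ 2 * V * T <= e.
  have : q <= e / (V * T + 1) by rewrite ge_min lexx orbT.
  rewrite ler_pdivlMr ?ltr_wpDl// => h'.
  apply: le_trans h'; rewrite -mulrA expr2 -mulrA ler_wpM2l ?(ltW q0)//; nra.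
have [N hN] : exists N : nat, K / q <= N%:R.
  by exists (Num.truncn (K / q)).+1; apply/ltW; exact: truncnS_gt.
pose D j := horizon `&` [set z | j.+1%:R * q <= h z.1 z.2].
have aD j : approximable (fun t w => q *: (\1_(D j) (t, w) *: v)).
  apply: (approximableZ Pc BM T0); apply: approximable_indic; first exact: predictable_level.
  by move=> z [].
exists (fun t w => \sum_(j < N) q *: (\1_(D j) (t, w) *: v)).
  exact: (approximable_sum Pc BM T0 _ (fun j : 'I_N => aD j)).
have [pY _] := approximable_sum Pc BM T0 (index_enum 'I_N) (fun j : 'I_N => aD j).
apply: (@le_trans _ _ (q ^+ 2 * V * T)%:E); last by rewrite lee_fin.
apply: (dist2_le_cst Pc BM T0) => //.
  by apply: mx_predictable_scale => //; exact: mx_predictable_cst.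
move=> t w tT; have [h0 hK'] := andP (hK t w tT).
have /(@count_floor N) : 0 <= h t w / q <= N%:R.
  by rewrite divr_ge0 ?(ltW q0)//= (le_trans _ hN)// ler_pM2r// invr_gt0.
rewrite (_ : \sum_(j < N) q *: _ = (q * \sum_(j < N) ((j.+1%:R <= h t w / q)%R%:R : R)) *: v); last first.
  rewrite mulr_sumr scaler_suml; apply: eq_bigr => j _; rewrite scalerA; congr (_ * _ *: _).
  rewrite indicE ler_pdivlMr//; congr (nat_of_bool _)%:R; apply/idP/idP; rewrite inE /D/=.
    by case.
  by move=> hj; split => //; split => //=; rewrite in_itv.
set c := \sum_(j < N) _ => /andP[c1 c2].
rewrite -scalerBl enormZ ler_wpM2r//.
have e1 : h t w - q <= q * c.
  have := c1; rewrite lerBlDr ler_pdivrMr// => c1'; lra.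
have e2 : q * c <= h t w by have := c2; rewrite ler_pdivlMr// mulrC.
by rewrite -ler_sqrt ?sqr_ge0// !sqrtr_sqr ler_norml (gtr0_norm q0); apply/andP; split; lra.
Qed.

Lemma approximable_bounded (X : process) (K : R) : vpred X ->
  (forall t w, 0 <= t <= T -> enorm (X t w) ^+ 2 <= K) -> approximable X.
Proof.
move=> pX XK; have XK' t w i : 0 <= t <= T -> `|X t w i ord0| <= K + 1.
  move=> tT; have K0 := le_trans (sqr_ge0 _) (XK t w tT).
  rewrite -ler_sqr ?nnegrE ?addr_ge0// real_normK ?num_real//.
  apply: (@le_trans _ _ K); last by nra.
  apply: le_trans (XK t w tT); rewrite enorm2 /dotv (bigD1 i)//= -expr2 lerDl.
  by apply: sumr_ge0 => j _; rewrite -expr2 sqr_ge0.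
(* Each coordinate is raised by [K + 1], a bound of its absolute value, to make it nonnegative, and
   the constant is subtracted again. *)
apply: approximable_eq (approximable_sum Pc BM T0 (index_enum 'I_m)
  (X := fun i t w => (X t w i ord0 + (K + 1)) *: delta_mx i ord0 + (- (K + 1)) *: delta_mx i ord0) _).
  move=> t w _; rewrite [RHS]matrix_sum_delta; apply: eq_bigr => i _.
  by rewrite big_ord1 -scalerDl addrK.
move=> i; apply: (approximableD Pc BM T0).
  apply: (@approximable_ge0 _ (K + 1 + (K + 1))).
    by apply: predictableD; [exact: pX|exact: predictable_cst].
  by move=> t w tT; have := XK' t w i tT; rewrite ler_norml => /andP[]; lra.
apply: (approximableZ Pc BM T0).
apply: approximable_eq (approximable_indic (delta_mx i ord0) pred_system_horizon _) => // t w tT.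
rewrite indicE mem_set ?scale1r//; split => //=; by rewrite in_itv.
Qed.

End simple_density.

(** * Stochastic integrals and their exponentials *)

Section cvg_in_probability.
Context d (Omega : measurableType d) (R : realType) (P : probability Omega R).
Implicit Types xi f g : nat -> Omega -> \bar R.

(** Convergence in probability involves only these events. For a supremum over all times of a
    continuous process they are measurable by [measurable_sup_level], through the countable
    description of exceedance. *)
Definition measurable_levels xi := forall n (e : R), 0 < e -> measurable [set w | e%:E <= xi n w]%E.

Lemma measurable_levelsW xi : (forall n, measurable_fun setT (xi n)) -> measurable_levels xi.
Proof.
move=> mxi n e _; rewrite -[X in measurable X]setTI.
by apply: emeasurable_fun_c_infty.
Qed.

(** Bounded convergence of the indicators of the level sets. *)
Lemma cvg_in_probability0_ae xi : measurable_levels xi ->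
  (\forall w \ae P, forall e : R, 0 < e -> \forall n \near \oo, (xi n w < e%:E)%E) ->
  cvg_in_probability0 P xi.
Proof.
move=> mxi xi0 e e0; pose X n : Omega -> R := \1_[set w | e%:E <= xi n w]%E.
have mX n : measurable_fun setT (X n) by apply: measurable_indic; exact: mxi.
have := @ge0_bounded_cvg _ _ _ P X (fun=> 0) 1 mX (measurable_cst _).
rewrite integral0 (_ : (fun k => _) = fun n => P [set w | e%:E <= xi n w]%E); last first.
  by apply/funext => n; rewrite /X integral_indic ?setIT//; exact: mxi.
apply; first by move=> k w; rewrite /X indicE; case: (_ \in _); rewrite ?lexx ?ler01.
apply: filterS xi0 => w /(_ e e0) h; apply: cvg_near_cst; apply: filterS h => n h.
by rewrite /X indicE memNset//= => /(lt_le_trans h); rewrite ltxx.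
Qed.

Lemma cvg_in_probability0_L1 xi (c : R^nat) : (forall n, measurable_fun setT (xi n)) ->
  (forall n w, 0 <= xi n w)%E -> (forall n, \int[P]_w xi n w <= (c n)%:E)%E -> c @ \oo --> 0 ->
  cvg_in_probability0 P xi.
Proof.
move=> mxi xi0 xic c0 e e0.
have hle n : (P [set w | e%:E <= xi n w]%E <= (c n / e)%:E)%E.
  have := le_integral_abse P measurableT (mxi n) e0; rewrite setTI.
  rewrite (_ : [set x | _] = [set w | e%:E <= xi n w]%E); last first.
    by apply/seteqP; split => w /=; rewrite gee0_abs.
  under eq_integral do rewrite gee0_abs//.
  move=> /le_trans/(_ (xic n)).
  by rewrite EFinM lee_pdivlMr// muleC.
apply: (@squeeze_cvge _ _ _ _ (fun=> 0%E) _ (fun n => (c n / e)%:E)).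
- by apply: nearW => n; rewrite measure_ge0 hle.
- exact: cvg_cst.
- by apply/fine_cvgP; split; [apply: nearW|rewrite -(mul0r e^-1); apply: cvgMl].
Qed.

(** If both [f n] and [g n] stay below [e / (2 * c)], then [xi n] stays below [e]; a union bound
    gives the rest. *)
Lemma cvg_in_probability0_le xi f g (c : R) : 0 < c ->
  measurable_levels xi -> measurable_levels f -> measurable_levels g ->
  (\forall w \ae P, forall n, xi n w <= c%:E * f n w + c%:E * g n w)%E ->
  cvg_in_probability0 P f -> cvg_in_probability0 P g -> cvg_in_probability0 P xi.
Proof.
move=> c0 mxi mf mg le f0 g0 e e0; pose q := e / (2 * c).
have q0 : 0 < q by rewrite divr_gt0// mulr_gt0.
apply: (@squeeze_cvge _ _ _ _ (fun=> 0%E) _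
  (fun n => P [set w | q%:E <= f n w]%E + P [set w | q%:E <= g n w]%E)%E).
- apply: nearW => n; rewrite measure_ge0/=.
  apply: le_trans (measureU2 _ (mf n _ q0) (mg n _ q0)).
  apply: le_measure_ae; [exact: mxi|by apply: measurableU; [exact: mf|exact: mg]|].
  apply: filterS le => w /(_ n) h /= ew.
  have [?|hf] := leP q%:E (f n w); first by left.
  have [?|hg] := leP q%:E (g n w); first by right.
  have : (c%:E * f n w + c%:E * g n w < e%:E)%E.
    rewrite (_ : e%:E = c%:E * q%:E + c%:E * q%:E)%E; last first.
      by rewrite -!EFinM -EFinD; congr EFin; rewrite /q; field; rewrite gt_eqF.
    by apply: lteD; rewrite lte_pmul2l.
  by rewrite ltNge (le_trans ew h).
- exact: cvg_cst.
- by rewrite -[X in _ --> X]adde0; apply: cvgeD => //; [exact: f0|exact: g0].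
Qed.

Lemma cvg_in_probability0_comp xi (phi : nat -> nat) : (forall k, (k <= phi k)%N) ->
  cvg_in_probability0 P xi -> cvg_in_probability0 P (fun k => xi (phi k)).
Proof.
move=> kphi xi0 e e0; have := xi0 e e0.
apply: cvg_comp => A [N _ hN]; exists N => // k /= Nk.
by apply: hN => /=; apply: leq_trans (kphi k).
Qed.

Lemma borel_cantelli_half (G : nat -> set Omega) (c : R) : 0 <= c -> (forall k, measurable (G k)) ->
  (forall k, P (G k) <= (c * (1 / 2) ^+ k)%:E)%E ->
  \forall w \ae P, exists K, forall k, (K <= k)%N -> ~ G k w.
Proof.
move=> c0 mG hG.
have : P (lim_sup_set G) = 0%E.
  apply: lim_sup_set_cvg0 => //.
  apply: (@le_lt_trans _ _ (\sum_(0 <= k <oo) (c * (1 / 2) ^+ k)%:E)%E).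
    apply: lee_nneseries => [k _ _|k _]; [exact: measure_ge0|exact: hG].
  have h : `|1 / 2 : R| < 1 by rewrite ger0_norm; lra.
  have /cvg_lim hl := @cvg_geometric_series _ c _ h.
  have -> : (\sum_(0 <= k <oo) (c * (1 / 2) ^+ k)%:E = (c * (1 - 1 / 2)^-1)%:E)%E.
    rewrite -[in RHS]hl// -EFin_lim; last exact: is_cvg_geometric_series.
    by congr (limn _); apply/funext => n; rewrite /= /series/= sumEFin.
  by rewrite ltry.
move=> lG; exists (lim_sup_set G); split => //.
  by apply: bigcap_measurable => // n _; apply: bigcup_measurable.
move=> w /= nw; rewrite /lim_sup_set/= => n _.
apply: contrapT => H; apply: nw; exists n => k nk Fk; apply: H; exists k => //.
Qed.

End cvg_in_probability.

Section truncation.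
Context d (Omega : measurableType d) (R : realType) (P : probability Omega R).
Context (T : R) (m : nat) (B : R -> Omega -> 'cV[R]_m).
Hypothesis Pc : measure_is_complete P.
Hypothesis BM : brownian_motion P T B.
Hypothesis T0 : 0 < T.

Local Notation FtT t := (g_sigma_algebraType (Ft_gen P B t)).
Local Notation predictable := (predictable P T B).
Local Notation vpred := (mx_predictable P T B).
Local Notation simple_predictable := (simple_predictable P T B).
Local Notation simple_process := (@simple_process d Omega R m).
Local Notation leb := (@lebesgue_measure R).
Local Notation RT := (measurableTypeR R).
Local Notation process := (R -> Omega -> 'cV[R]_m).
Local Notation dist2 := (@dist2 d Omega R P T m).
Local Notation pdist2 X Y w := (\int[leb]_(t in `[0%R, T]) (enorm (X t w - Y t w) ^+ 2)%:E)%E.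

Lemma measurable_integral_predictable (X : R -> Omega -> R) : predictable X ->
  measurable_fun setT (fun w => \int[leb]_(t in `[0%R, T]) (X t w)%:E)%E.
Proof.
move=> pX; have TT : 0 <= T <= T by rewrite lexx ltW.
have mX : measurable_fun (`[0, T] `*` setT : set (RT * FtT T)) (fun z => (X z.1 z.2)%:E).
  apply/measurable_EFinP; exact: (@predictable_progressive _ _ _ _ _ _ _ _ _ TT pX).
move=> _ A mA; rewrite setTI; apply: (Ft_measurable Pc BM (lexx T)).
have mI := @measurable_integral_path _ _ _ _ _ _ _ (fun t w => (X t w)%:E) T TT mX.
by have := mI measurableT A mA; rewrite setTI.
Qed.

Lemma measurable_pdist2 (X Y : process) : vpred X -> vpred Y -> measurable_fun setT (fun w => pdist2 X Y w).
Proof.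
move=> pX pY; apply: (measurable_integral_predictable (X := fun t w => enorm (X t w - Y t w) ^+ 2)).
exact: predictable_enorm2 (mx_predictableB pX pY).
Qed.

Lemma dist2_pdist2 (X Y : process) : vpred X -> vpred Y -> dist2 X Y = (\int[P]_w pdist2 X Y w)%E.
Proof.
move=> pX pY.
apply: (tonelli_path Pc BM T0 (X := fun t w => enorm (X t w - Y t w) ^+ 2)).
  exact: predictable_enorm2 (mx_predictableB pX pY).
by move=> t w; exact: sqr_ge0.
Qed.

Lemma measurable_pdist2_path (X Y : process) w : vpred X -> vpred Y ->
  measurable_fun (`[0, T] : set RT) (fun t => (enorm (X t w - Y t w) ^+ 2)%:E).
Proof.
move=> pX pY; apply/measurable_EFinP; have TT : 0 <= T <= T by rewrite lexx ltW.
exact: (predictable_path Pc BM T0 w (predictable_enorm2 (mx_predictableB pX pY)) TT).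
Qed.

Lemma pdist2_trans (X Y W : process) w : vpred X -> vpred Y -> vpred W ->
  (pdist2 X W w <= 2%:E * pdist2 X Y w + 2%:E * pdist2 Y W w)%E.
Proof.
move=> pX pY pW.
have m1 := measurable_pdist2_path w pX pY.
have m2 := measurable_pdist2_path w pY pW.
have m3 := measurable_pdist2_path w pX pW.
apply: (@ge0_integral_le_lin _ _ _ leb _ _ _ _ 2 2 (ler0n _ 2) (ler0n _ 2) (measurable_itv _) m1 m2 m3);
  try by move=> z _; rewrite lee_fin sqr_ge0.
move=> t _; rewrite -!EFinM -EFinD lee_fin; apply: le_trans (enorm2D_le _ _).
by rewrite addrA subrK.
Qed.

Lemma pdist2C (X Y : process) w : pdist2 X Y w = pdist2 Y X w.
Proof. by apply: eq_integral => t _; rewrite -enormN opprB. Qed.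

(** The cut to 0 keeps the difference to [H] below [H] in norm, which provides the dominating
    function in [truncated_cvg]. *)
Definition truncated (H : process) (k : nat) : process :=
  fun t w => (enorm (H t w) ^+ 2 <= k%:R)%R%:R *: H t w.

Lemma truncated_predictable H k : vpred H -> vpred (truncated H k).
Proof.
move=> pH; apply: mx_predictable_scale => //.
apply: (@predictable_comp _ _ _ _ _ _ _ (fun x : R => (x <= k%:R)%R%:R)); last exact: predictable_enorm2.
rewrite (_ : (fun x : R => _) = \1_(`]-oo, k%:R])).
  by apply: measurable_indic; exact: measurable_itv.
by apply/funext => x; rewrite indicE; congr (nat_of_bool _)%:R; apply/idP/idP; rewrite inE/= in_itv.
Qed.

Lemma truncated_cvg H w : vpred H ->
  (\int[leb]_(t in `[0%R, T]) (enorm (H t w) ^+ 2)%:E < +oo)%E ->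
  (fun k => pdist2 (truncated H k) H w) @ \oo --> 0%E.
Proof.
move=> pH H2.
have mT k := measurable_pdist2_path w (truncated_predictable k pH) pH.
have mH : measurable_fun (`[0, T] : set RT) (fun t => (enorm (H t w) ^+ 2)%:E).
  apply/measurable_EFinP; have TT : 0 <= T <= T by rewrite lexx ltW.
  exact: (predictable_path Pc BM T0 w (predictable_enorm2 pH) TT).
have := @dominated_convergence _ _ _ leb `[0%R, T]%classic (measurable_itv _)
  (fun k t => (enorm (truncated H k t w - H t w) ^+ 2)%:E) (fun=> 0%E)
  (fun t => (enorm (H t w) ^+ 2)%:E) mT (measurable_cst _).
case.
- apply: aeW => t _; apply: cvg_near_cst; near=> k.
  rewrite /truncated (_ : (_ <= _) = true) ?scale1r ?subrr ?enorm0 ?expr0n//.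
  near: k; exists (Num.truncn (enorm (H t w) ^+ 2)).+1 => // k /= hk.
  by apply: le_trans (ltW (truncnS_gt _)) _; rewrite ler_nat.
- apply/integrableP; split => //.
  under eq_integral do rewrite gee0_abs ?lee_fin ?sqr_ge0//.
  exact: H2.
- apply: aeW => t k _; rewrite gee0_abs ?lee_fin ?sqr_ge0//.
  rewrite /truncated; case: (_ <= k%:R) => /=.
    by rewrite scale1r subrr enorm0 expr0n sqr_ge0.
  by rewrite scale0r sub0r enormN.
- by move=> _ _; rewrite integral0.
Unshelve. all: by end_near. Qed.

(** The truncations are bounded, hence approximable in L2 with error [(1 / 2) ^+ k], which tends to
    0 in probability by Markov. They converge to [H] on every path of finite energy. *)
Lemma simple_dense H : vpred H -> square_integrable_paths P T H ->
  exists2 S : nat -> simple_process, forall n, simple_predictable (S n) &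
    cvg_in_probability0 P (fun n w => pdist2 (sp_eval (S n)) H w).
Proof.
move=> pH sH.
have /choice[S hS] k : exists S, simple_predictable S /\
    (dist2 (sp_eval S) (truncated H k) <= ((1 / 2) ^+ k)%:E)%E.
  have [_ /(_ ((1 / 2) ^+ k))] : approximable P T B (truncated H k).
    apply: (@approximable_bounded _ _ _ _ _ _ _ Pc BM T0 _ k%:R); first exact: truncated_predictable.
    move=> t w _; rewrite /truncated; case: (leP (enorm (H t w) ^+ 2) k%:R) => /=.
      by rewrite scale1r.
    by rewrite scale0r enorm0 expr0n.
  by case; [rewrite exprn_gt0|move=> S hS1 hS2; exists S].
exists S; first by move=> n; have [] := hS n.
have pS n : vpred (sp_eval (S n)) by apply: sp_eval_predictable; have [] := hS n.
have pT n : vpred (truncated H n) by exact: truncated_predictable.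
apply: (@cvg_in_probability0_le _ _ _ _ _ (fun n w => pdist2 (sp_eval (S n)) (truncated H n) w)
   (fun n w => pdist2 (truncated H n) H w) 2).
- by [].
- by apply: measurable_levelsW => n; exact: measurable_pdist2.
- by apply: measurable_levelsW => n; exact: measurable_pdist2.
- by apply: measurable_levelsW => n; exact: measurable_pdist2.
- by apply: aeW => w n; exact: pdist2_trans.
- apply: (@cvg_in_probability0_L1 _ _ _ _ _ (fun n => (1 / 2) ^+ n)).
  + by move=> n; exact: measurable_pdist2.
  + by move=> n w; apply: integral_ge0 => t _; rewrite lee_fin sqr_ge0.
  + by move=> n; rewrite -dist2_pdist2//; have [] := hS n.
  + by apply: cvg_expr; rewrite ger0_norm; lra.
- apply: cvg_in_probability0_ae.
    by apply: measurable_levelsW => n; exact: measurable_pdist2.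
  apply: filterS sH => w /(truncated_cvg pH) /fine_cvgP[fn /cvgrPdist_lt cv] e /cv h.
  near=> n; have f : pdist2 (truncated H n) H w \is a fin_num by near: n.
  rewrite -(fineK f) lte_fin; have : `|0 - fine (pdist2 (truncated H n) H w)| < e by near: n.
  by rewrite sub0r normrN; apply: le_lt_trans; exact: ler_norm.
Unshelve. all: by end_near. Qed.

End truncation.

(** * Existence of the stochastic integral *)

Section existence.
Context d (Omega : measurableType d) (R : realType) (P : probability Omega R).
Context (T : R) (m : nat) (B : R -> Omega -> 'cV[R]_m).
Hypothesis Pc : measure_is_complete P.
Hypothesis BM : brownian_motion P T B.
Hypothesis T0 : 0 < T.

Local Notation vpred := (mx_predictable P T B).
Local Notation simple_predictable := (simple_predictable P T B).
Local Notation leb := (@lebesgue_measure R).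
Local Notation pdist2 X Y w := (\int[leb]_(t in `[0%R, T]) (enorm (X t w - Y t w) ^+ 2)%:E)%E.

Lemma sp_time_le S i j : simple_predictable S -> (i <= j <= sp_size S)%N -> sp_time S i <= sp_time S j.
Proof.
move=> [_ h _ _]; elim: j => [|j IH] /andP[ij jS]; first by move: ij; rewrite leqn0 => /eqP ->.
move: ij; rewrite leq_eqVlt => /predU1P[->//|ij].
by apply: le_trans (h j jS); apply: IH; rewrite -ltnS ij ltnW.
Qed.

(** The intervals are disjoint, so the cross terms of the square vanish. *)
Lemma sp_eval_sqr S t w : simple_predictable S -> enorm (sp_eval S t w) ^+ 2 =
  \sum_(i < sp_size S) (t \in `]sp_time S i, sp_time S i.+1])%:R * enorm (sp_val S i w) ^+ 2.
Proof.
move=> hS; rewrite enorm2 {1}/sp_eval dotv_suml; apply: eq_bigr => i _.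
rewrite dotvZl; case: (boolP (t \in _)) => [ti|_]; last by rewrite !mul0r.
rewrite !mul1r enorm2 /sp_eval (bigD1 i)//= ti scale1r big1 ?addr0// => j ji.
rewrite (_ : t \in _ = false) ?scale0r//.
move: ti; rewrite !in_itv/= => /andP[it ti]; apply/negbTE/negP => /andP[jt tj].
move: ji; rewrite -val_eqE/= neq_ltn => /orP[ji|ij].
  have := @sp_time_le S j.+1 i hS; rewrite ji (ltnW (ltn_ord i)) => /(_ isT) /(le_trans tj).
  by rewrite leNgt it.
have := @sp_time_le S i.+1 j hS; rewrite ij (ltnW (ltn_ord j)) => /(_ isT) /(le_trans ti).
by rewrite leNgt jt.
Qed.

Lemma integral_sp_eval S t w : simple_predictable S -> 0 <= t ->
  (\int[leb]_(s in `[0%R, t]) (enorm (sp_eval S s w) ^+ 2)%:E = (sp_quad S t w)%:E)%E.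
Proof.
move=> hS t0; have [h1 h2 _ _] := hS.
under eq_integral do rewrite sp_eval_sqr// -sumEFin.
have mI i : measurable (`]sp_time S i, sp_time S i.+1] : set R) by exact: measurable_itv.
have mf i : measurable_fun (`[0, t] : set R)
    (fun s => ((s \in `]sp_time S i, sp_time S i.+1])%:R * enorm (sp_val S i w) ^+ 2)%:E).
  apply/measurable_EFinP; apply: measurable_funM => //.
  rewrite (_ : (fun s => _) = \1_(`]sp_time S i, sp_time S i.+1])).
    by apply: measurable_funTS; apply: measurable_indic.
  by apply/funext => s; rewrite indicE; congr (nat_of_bool _)%:R; apply/idP/idP; rewrite inE.
rewrite (@ge0_integral_sum _ _ _ leb _ (measurable_itv _) _ (fun (i : 'I_(sp_size S)) s =>
  ((s \in `]sp_time S i, sp_time S i.+1])%:R * enorm (sp_val S i w) ^+ 2)%:E)); first last.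
- by move=> i s _; rewrite lee_fin mulr_ge0 ?sqr_ge0.
- by move=> i; exact: mf.
rewrite /sp_quad -sumEFin; apply: eq_bigr => i _.
have hi := h2 i (ltn_ord i); have /andP[i0 _] := h1 i (ltnW (ltn_ord i)).
under eq_integral do rewrite mulrC EFinM.
rewrite ge0_integralZl//; first last.
- by rewrite lee_fin sqr_ge0.
- apply/measurable_EFinP; rewrite (_ : (fun s => _) = \1_(`]sp_time S i, sp_time S i.+1])).
    by apply: measurable_funTS; apply: measurable_indic.
  by apply/funext => s; rewrite indicE; congr (nat_of_bool _)%:R; apply/idP/idP; rewrite inE.
rewrite [RHS]EFinM; congr (_ * _)%E.
transitivity (\int[leb]_(s in `[0%R, t]) (\1_(`]sp_time S i, sp_time S i.+1]) s)%:E)%E.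
  by apply: eq_integral => s _; rewrite indicE; congr (nat_of_bool _)%:R%:E; apply/idP/idP; rewrite inE.
rewrite integral_indic//.
rewrite (_ : _ `&` _ = `]Num.min (sp_time S i) t, Num.min (sp_time S i.+1) t]%classic); last first.
  apply/seteqP; split => s /=; rewrite !in_itv/= gt_min le_min.
    by move=> [/andP[-> ->] /andP[_ ->]].
  move=> /andP[+ /andP[h st]]; rewrite (ltNge t) st orbF => hs; split; first by rewrite hs.
  by rewrite andbT (le_trans i0 (ltW hs)).
transitivity (leb `]Num.min (sp_time S i) t, Num.min (sp_time S i.+1) t]); first by [].
rewrite lebesgue_measure_itv/= lte_fin.
case: ltP => [//|h].
by congr EFin; apply/eqP; rewrite eq_sym subr_eq0 eq_le h; move: h; move: (sp_time S i) (sp_time S i.+1) hi => x y xy _;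
   case: (lerP x t) => ?; case: (lerP y t) => ?; lra.
Qed.

Lemma cvg_geometric_increments (u : R^nat) (K : nat) :
  (forall k, (K <= k)%N -> `|u k.+1 - u k| <= (1 / 2) ^+ k) ->
  cvgn u /\ forall k, (K <= k)%N -> `|u k - limn u| <= 2 * (1 / 2) ^+ k.
Proof.
move=> hu.
have h0 k : 0 < (1 / 2 : R) ^+ k by rewrite exprn_gt0// divr_gt0.
have hd n k : (K <= k)%N -> `|u (n + k)%N - u k| <= 2 * (1 / 2) ^+ k - 2 * (1 / 2) ^+ (n + k).
  move=> Kk; elim: n => [|n IH]; first by rewrite add0n !subrr normr0.
  have := hu (n + k)%N (leq_trans Kk (leq_addl _ _)).
  rewrite addSn exprS; move: IH; set a := (1 / 2) ^+ (n + k); set b := (1 / 2) ^+ k => IH hn.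
  rewrite -(subrK (u (n + k)%N) (u _.+1)) -addrA; apply: le_trans (ler_normD _ _) _; lra.
have hd' n k : (K <= k <= n)%N -> `|u n - u k| <= 2 * (1 / 2) ^+ k.
  move=> /andP[Kk kn]; have := hd (n - k)%N k Kk; rewrite subnK// => /le_trans; apply.
  by rewrite lerBlDr lerDl mulr_ge0// ltW.
have small (e : R) : 0 < e -> exists2 k, (K <= k)%N & 2 * (1 / 2) ^+ k < e.
  move=> e0; have : (fun k => 2 * (1 / 2 : R) ^+ k) @ \oo --> 0.
    by rewrite -(mulr0 2); apply: cvgMr; apply: cvg_expr; rewrite ger0_norm; lra.
  move=> /cvgrPdist_lt/(_ _ e0)[N _ hN]; exists (maxn K N); first exact: leq_maxl.
  by have := hN _ (leq_maxr K N); rewrite sub0r normrN gtr0_norm// mulr_gt0.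
have cu : cvgn u.
  apply: cauchy_cvg; apply: cauchy_exP => e e0; have [k Kk he] := small _ e0.
  exists (u k); exists k => // n /= kn; rewrite /ball/= distrC.
  by apply: le_lt_trans he; apply: hd'; rewrite Kk.
split => // k Kk; apply/ler_addgt0Pr => e e0.
have /cvgrPdist_le/(_ _ e0)[N _ hN] := cu.
have h1 := hN (maxn k N) (leq_maxr _ _).
have := hd' (maxn k N) k; rewrite Kk leq_maxl => /(_ isT) h2.
rewrite distrC -(subrK (u (maxn k N)) (limn u)) -addrA; apply: le_trans (ler_normD _ _) _; lra.
Qed.

Lemma within_continuous_norm (f : R -> R) : {within `[0, T], continuous f} ->
  {within `[0, T], continuous (fun t => `|f t|)}.
Proof.
move=> /subspace_continuousP cf; apply/subspace_continuousP => s sab.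
exact: continuous_cvg (@norm_continuous _ _ _) (cf _ sab).
Qed.

Lemma measurable_sup_level V (e : R) : adapted P T B V -> continuous_paths P T V ->
  measurable [set w | (e%:E <= ereal_sup [set (V t w)%:E | t in `[0%R, T]])%E].
Proof.
move=> aV cV; apply: (Ft_measurable Pc BM (lexx T)).
have TT : 0 <= T <= T by rewrite lexx ltW.
have FE := Ft_exceedance e aV cV TT.
suff h : \forall w \ae P, (exists s, 0 <= s <= T /\ e <= V s w) <->
    (e%:E <= ereal_sup [set (V t w)%:E | t in `[0%R, T]])%E by exact: Ft_ae_eq FE h.
apply: filterS cV => w cw; split.
  by move=> [s [sT es]]; apply/(ereal_sup_exceedance e (ltW T0) cw); exists s.
by move=> /(ereal_sup_exceedance e (ltW T0) cw)[s [sT es]]; exists s.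
Qed.

Lemma expR_inv_le (x : R) : 0 < x -> expR (- x) <= x^-1.
Proof.
move=> x0; rewrite expRN lef_pV2 ?posrE ?expR_gt0//.
by apply: le_trans (expR_ge1Dx x); rewrite lerDr.
Qed.

Lemma simple_sub S1 S2 : simple_predictable S1 -> simple_predictable S2 ->
  exists S, [/\ simple_predictable S,
    forall t w, sp_eval S t w = sp_eval S1 t w - sp_eval S2 t w &
    forall t w, sp_integral B S t w = sp_integral B S1 t w - sp_integral B S2 t w].
Proof.
move=> h1 h2; have [S [hS ev int]] := sp_add h1 (sp_scale_predictable (-1) h2).
exists S; split; first exact: hS.
- by move=> t w; rewrite ev sp_scale_eval scaleN1r.
- by move=> t w; rewrite int sp_scale_integral mulN1r.
Qed.

(** Along a fast subsequence of simple approximations, consecutive integrals differ by less than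
    [(1 / 2) ^+ k] uniformly in time for all large [k], almost surely: the difference [D k] has
    small quadratic variation and [sp_integral_tail] with Borel-Cantelli applies. The uniform limit
    is continuous and adapted. *)
Lemma stochastic_integral_exists H : vpred H -> square_integrable_paths P T H ->
  exists I, is_stochastic_integral P T B H I.
Proof.
move=> pH sH; have [S hS SH] := simple_dense Pc BM T0 pH sH.
pose A n w := pdist2 (sp_eval (S n)) H w.
have pS n : vpred (sp_eval (S n)) by exact: sp_eval_predictable (hS n).
have mA n : measurable_fun setT (A n) by exact: (@measurable_pdist2 _ _ _ _ _ _ _ Pc BM T0 _ _ (pS n) pH).
(* The cube makes the squared distance small compared with the square of the level [(1 / 2) ^+ k],
   so that the exponent of the tail bound grows. *)
have [phi [kphi hphi]] := @ae_subsequence _ _ _ P (fun e n => [set w | (e ^+ 3)%:E <= A n w]%E)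
  (fun e n e0 => measurable_levelsW mA n (exprn_gt0 3 e0)) (fun e e0 => SH _ (exprn_gt0 3 e0)).
pose S' k := S (phi k); pose J k := sp_integral B (S' k).
have hS' k : simple_predictable (S' k) by exact: hS.
have /choice[D hD] k := simple_sub (hS' k.+1) (hS' k).
have hp k : 0 < (1 / 2 : R) ^+ k by rewrite exprn_gt0// divr_gt0.
pose G k := [set w | exists t, (0 <= t <= T)%R /\ ((1 / 2) ^+ k <= `|sp_integral B (D k) t w|)%R] `&`
      [set w | (sp_quad (D k) T w <= 4 * ((1 / 2) ^+ k) ^+ 3)%R].
have aJ k : adapted P T B (J k) by exact: adapted_sp_integral.
have cJ k : continuous_paths P T (J k) by exact: continuous_sp_integral.
have mG k : measurable (G k).
  have [hDk _ _] := hD k; apply: measurableI.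
    apply: (measurable_exceedance Pc BM T0 (V := fun t w => `|sp_integral B (D k) t w|)).
      move=> t tT; apply/measurable_wrtP; apply: measurableT_comp => //; apply/measurable_wrtP.
      exact: (adapted_sp_integral hDk).
    by apply: filterS (continuous_sp_integral BM hDk) => w; exact: within_continuous_norm.
  rewrite -[X in measurable X]setTI; apply: measurable_fun_le => //.
  apply: (adapted_measurable Pc BM (adapted_sp_quad hDk)); by rewrite lexx ltW.
have PG k : (P (G k) <= (16 * (1 / 2) ^+ k)%:E)%E.
  have [hDk _ _] := hD k.
  (* With [q = (1 / 2) ^+ k], level [q] and variation [4 q^3], the exponent is [1 / (8 q)], and
     [exp (- x) <= 1 / x] leaves the summable bound [16 q]. *)
  apply: le_trans (sp_integral_tail Pc BM T0 hDk (hp k) _) _; first by rewrite mulr_gt0// exprn_gt0.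
  rewrite lee_fin; set q := (1 / 2) ^+ k; have q0 : 0 < q := hp k.
  apply: (@le_trans _ _ (2 * (q ^+ 2 / (2 * (4 * q ^+ 3)))^-1)).
    by rewrite ler_wpM2l//; apply: expR_inv_le; rewrite divr_gt0 ?mulr_gt0 ?exprn_gt0.
  rewrite le_eqVlt; apply/orP; left; apply/eqP; field; by rewrite gt_eqF.
have cvJ : \forall w \ae P, exists K, forall k, (K <= k)%N -> forall t, 0 <= t <= T ->
    `|J k.+1 t w - J k t w| <= (1 / 2) ^+ k.
  have BC := borel_cantelli_half (ler0n _ 16) mG PG.
  move: hphi BC; apply: filterS2 => w [K1 hK1] [K2 hK2]; exists (maxn K1 K2) => k.
  rewrite geq_max => /andP[k1 k2] t tT; have [hDk ev int] := hD k.
  rewrite -int leNgt; apply/negP => hlt; apply: (hK2 k k2); split => /=.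
    by exists t; split => //; exact: ltW.
  rewrite -lee_fin -integral_sp_eval//; last exact: ltW.
  under eq_integral do rewrite ev.
  (* The factor 4 in [G] is 2 + 2: both approximations are compared with [H], each within [q^3]. *)
  apply: le_trans (pdist2_trans Pc BM T0 w (pS _) pH (pS _)) _.
  rewrite [X in (_ + _ * X)%E]pdist2C.
  have h1 : (A (phi k.+1) w <= (((1 / 2) ^+ k) ^+ 3)%:E)%E.
    have /negP := hK1 k.+1 (leq_trans k1 (leqnSn k)); rewrite -ltNge => /ltW /le_trans; apply.
    rewrite lee_fin ler_pXn2r// ?nnegrE ?(ltW (hp _))// exprS ler_piMl ?(ltW (hp _))//; lra.
  have h2 : (A (phi k) w <= (((1 / 2) ^+ k) ^+ 3)%:E)%E.
    by have /negP := hK1 k k1; rewrite -ltNge => /ltW.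
  apply: le_trans (leeD (lee_wpmul2l _ h1) (lee_wpmul2l _ h2)) _ => //.
  by rewrite -!EFinM -EFinD lee_fin; lra.
pose I t w := limn (fun k => J k t w).
have cvI : \forall w \ae P, exists K, forall k, (K <= k)%N -> forall t, 0 <= t <= T ->
    `|J k t w - I t w| <= 2 * (1 / 2) ^+ k.
  apply: filterS cvJ => w [K hK]; exists K => k Kk t tT.
  have [_] := @cvg_geometric_increments (fun k => J k t w) K (fun k Kk => hK k Kk t tT).
  exact.
have small (e : R) : 0 < e -> exists N, forall k, (N <= k)%N -> 2 * (1 / 2) ^+ k < e.
  move=> e0; have : (fun k => 2 * (1 / 2 : R) ^+ k) @ \oo --> 0.
    by rewrite -(mulr0 2); apply: cvgMr; apply: cvg_expr; rewrite ger0_norm; lra.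
  move=> /cvgrPdist_lt/(_ _ e0)[N _ hN]; exists N => k /hN.
  by rewrite sub0r normrN gtr0_norm// mulr_gt0.
have cI : continuous_paths P T I.
  have cJ' : \forall w \ae P, forall k, {within `[0, T], continuous (fun t => J k t w)}.
    by apply/ae_foralln => k; exact: cJ.
  move: cvI cJ'; apply: filterS2 => w [K hK] cw; apply: continuous_withinP => s sT e e0.
  have [N hN] := small (e / 3) (divr_gt0 e0 (ltr0n _ 3)).
  pose k := maxn K N; have h1 := hK k (leq_maxl _ _); have h2 := hN k (leq_maxr _ _).
  have [r r0 hr] := within_continuousP (cw k) sT (divr_gt0 e0 (ltr0n _ 3)).
  exists r => // t tT ts; have hr' := hr t tT ts.
  have hs := h1 s sT; have ht := h1 t tT.
  have -> : I s w - I t w = (I s w - J k s w) + ((J k s w - J k t w) + (J k t w - I t w)) by ring.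
  rewrite distrC in hs; apply: le_trans (ler_normD _ _) _.
  apply: le_trans (lerD hs (ler_normD _ _)) _.
  apply: le_trans (lerD (lexx _) (lerD hr' ht)) _; move: h2.
  set q := 2 * _ => h2; lra.
have aI : adapted P T B I.
  move=> t tT; apply: (@measurable_wrt_ae_cvg _ _ _ P (Ft_gen P B t) _ (fun k => J k t)).
  - by move=> N; exact: Ft_negligible.
  - by move=> k; exact: aJ.
  - apply: filterS cvJ => w [K hK].
    by have [] := @cvg_geometric_increments (fun k => J k t w) K (fun k Kk => hK k Kk t tT).
exists I; split => //; exists S'; split; first exact: hS'.
  exact: (cvg_in_probability0_comp kphi SH).
apply: cvg_in_probability0_ae.
  move=> n e e0; apply: (measurable_sup_level (V := fun t w => `|J n t w - I t w|)).
    move=> t tT; apply/measurable_wrtP; apply: measurableT_comp => //; apply: measurable_funB; apply/measurable_wrtP.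
      exact: aJ.
    exact: aI.
  have := cJ n; move: cI; rewrite /continuous_paths; apply: filterS2 => w c1 c2.
  by apply: within_continuous_norm; apply: within_continuousD => //; exact: within_continuousN.
apply: filterS cvI => w [K hK] e e0; have [N hN] := small _ e0.
exists (maxn K N) => // k /=; rewrite geq_max => /andP[Kk Nk].
apply: (@le_lt_trans _ _ (2 * (1 / 2) ^+ k)%:E); last by rewrite lte_fin; exact: hN.
apply: ge_ereal_sup => x [t /=]; rewrite in_itv/= => tT <-.
by rewrite lee_fin; exact: hK.
Qed.

Lemma stochastic_integralP H : vpred H -> square_integrable_paths P T H ->
  is_stochastic_integral P T B H (stochastic_integral P T B H).
Proof.
move=> pH sH; have [I hI] := stochastic_integral_exists pH sH.
exact: (@xgetPex _ (fun _ _ => 0) [set I | is_stochastic_integral P T B H I] (ex_intro _ I hI)).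
Qed.

End existence.

(** * Exponentials of stochastic integrals *)

Section exp_martingale.
Context d (Omega : measurableType d) (R : realType) (P : probability Omega R).
Context (T : R) (m : nat) (B : R -> Omega -> 'cV[R]_m).
Hypothesis Pc : measure_is_complete P.
Hypothesis BM : brownian_motion P T B.
Hypothesis T0 : 0 < T.

Local Notation vpred := (mx_predictable P T B).
Local Notation adapted := (adapted P T B).
Local Notation stopping_time := (stopping_time P T B).
Local Notation simple_predictable := (simple_predictable P T B).
Local Notation simple_process := (@simple_process d Omega R m).
Local Notation leb := (@lebesgue_measure R).
Local Notation RT := (measurableTypeR R).
Local Notation is_stochastic_integral := (is_stochastic_integral P T B).
Local Notation pdist2 X Y w := (\int[leb]_(t in `[0%R, T]) (enorm (X t w - Y t w) ^+ 2)%:E)%E.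

Lemma adapted_continuous_dist (V W : R -> Omega -> R) : adapted V -> continuous_paths P T V ->
  adapted W -> continuous_paths P T W ->
  adapted (fun t w => `|V t w - W t w|) /\ continuous_paths P T (fun t w => `|V t w - W t w|).
Proof.
move=> aV cV aW cW; split.
  move=> t tT; apply/measurable_wrtP; apply: measurableT_comp => //.
  by apply: measurable_funB; apply/measurable_wrtP; [exact: aV|exact: aW].
move: cV cW; rewrite /continuous_paths; apply: filterS2 => w c1 c2.
by apply: within_continuous_norm; apply: within_continuousD => //; exact: within_continuousN.
Qed.

Lemma measurable_levels_sup (V : nat -> R -> Omega -> R) (W : R -> Omega -> R) :
  (forall n, adapted (V n)) -> (forall n, continuous_paths P T (V n)) ->
  adapted W -> continuous_paths P T W ->
  measurable_levels (fun n w => ereal_sup [set `|V n t w - W t w|%:E | t in `[0%R, T]]).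
Proof.
move=> aV cV aW cW n e e0.
have [a c] := adapted_continuous_dist (aV n) (cV n) aW cW.
exact: (measurable_sup_level Pc BM T0 e a c).
Qed.

(** The approximating simple processes are combined with the same coefficients. [I1] and [I2] are
    arbitrary versions, so a combination of chosen integrals is a legitimate integral of the
    combined integrand. *)
Lemma stochastic_integral_lincomb H1 H2 I1 I2 a1 a2 : vpred H1 -> vpred H2 ->
  is_stochastic_integral H1 I1 -> is_stochastic_integral H2 I2 ->
  is_stochastic_integral (fun t w => a1 *: H1 t w + a2 *: H2 t w)
    (fun t w => a1 * I1 t w + a2 * I2 t w).
Proof.
move=> pH1 pH2 [c1 ad1 [S1 [hS1 d1 s1]]] [c2 ad2 [S2 [hS2 d2 s2]]].
have /choice[S hS] k := sp_add (sp_scale_predictable a1 (hS1 k)) (sp_scale_predictable a2 (hS2 k)).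
have cI : continuous_paths P T (fun t w => a1 * I1 t w + a2 * I2 t w).
  move: c1 c2; rewrite /continuous_paths; apply: filterS2 => w c1 c2.
  by apply: within_continuousD; apply: within_continuousM => //; exact: within_continuous_cst.
have aI : adapted (fun t w => a1 * I1 t w + a2 * I2 t w).
  move=> t tT; apply/measurable_wrtP; apply: measurable_funD; apply: measurable_funM => //;
    apply/measurable_wrtP; [exact: ad1|exact: ad2].
have hS' k : simple_predictable (S k) by have [] := hS k.
have pS k : vpred (sp_eval (S k)) by exact: sp_eval_predictable (hS' k).
have pS1 k : vpred (sp_eval (S1 k)) by exact: sp_eval_predictable (hS1 k).
have pS2 k : vpred (sp_eval (S2 k)) by exact: sp_eval_predictable (hS2 k).
have pH : vpred (fun t w => a1 *: H1 t w + a2 *: H2 t w).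
  by apply: mx_predictableD; exact: mx_predictableZ.
(* A crude constant above the [|a_i|], needed for the integrals, and above the [2 a_i^2], needed for
   the squared distances. *)
pose c := 1 + `|a1| + `|a2| + 2 * a1 ^+ 2 + 2 * a2 ^+ 2.
have c0 : 0 < c by rewrite /c; have := sqr_ge0 a1; have := sqr_ge0 a2; have := normr_ge0 a1; have := normr_ge0 a2; lra.
split => //; exists S; split; first exact: hS'.
- apply: (cvg_in_probability0_le c0 _ _ _ _ d1 d2).
  + by apply: measurable_levelsW => n; exact: (@measurable_pdist2 _ _ _ _ _ _ _ Pc BM T0 _ _ (pS n) pH).
  + by apply: measurable_levelsW => n; exact: (@measurable_pdist2 _ _ _ _ _ _ _ Pc BM T0 _ _ (pS1 n) pH1).
  + by apply: measurable_levelsW => n; exact: (@measurable_pdist2 _ _ _ _ _ _ _ Pc BM T0 _ _ (pS2 n) pH2).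
  apply: aeW => w n; have [_ ev _] := hS n.
  have m1 := measurable_pdist2_path Pc BM T0 w (pS1 n) pH1.
  have m2 := measurable_pdist2_path Pc BM T0 w (pS2 n) pH2.
  have m3 := measurable_pdist2_path Pc BM T0 w (pS n) pH.
  apply: (@ge0_integral_le_lin _ _ _ leb _ _ _ _ c c (ltW c0) (ltW c0) (measurable_itv _) m1 m2 m3);
    try by move=> t _; rewrite lee_fin sqr_ge0.
  move=> t _; rewrite -!EFinM -EFinD lee_fin ev !sp_scale_eval opprD addrACA -!scalerBr.
  apply: le_trans (enorm2D_le _ _) _; rewrite !enormZ (mulrA 2 (a1 ^+ 2)) (mulrA 2 (a2 ^+ 2)).
  have h1 := sqr_ge0 a1; have h2 := sqr_ge0 a2; have h3 := normr_ge0 a1; have h4 := normr_ge0 a2.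
  by apply: lerD; apply: ler_wpM2r; rewrite ?sqr_ge0//; rewrite /c; lra.
- apply: (cvg_in_probability0_le c0 _ _ _ _ s1 s2).
  + apply: measurable_levels_sup; [move=> n; exact: adapted_sp_integral (hS' n)|move=> n; exact: (continuous_sp_integral BM (hS' n))|exact: aI|exact: cI].
  + apply: measurable_levels_sup; [move=> n; exact: adapted_sp_integral (hS1 n)|move=> n; exact: (continuous_sp_integral BM (hS1 n))|exact: ad1|exact: c1].
  + apply: measurable_levels_sup; [move=> n; exact: adapted_sp_integral (hS2 n)|move=> n; exact: (continuous_sp_integral BM (hS2 n))|exact: ad2|exact: c2].
  apply: aeW => w n; have [_ _ int] := hS n.
  apply: ge_ereal_sup => x [t /= tT] <-.
  rewrite int !sp_scale_integral.
  apply: (@le_trans _ _ (c%:E * `|sp_integral B (S1 n) t w - I1 t w|%:E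
                       + c%:E * `|sp_integral B (S2 n) t w - I2 t w|%:E)%E).
    rewrite -!EFinM -EFinD lee_fin opprD addrACA -!mulrBr.
    apply: le_trans (ler_normD _ _) _; rewrite !normrM.
    have h1 := sqr_ge0 a1; have h2 := sqr_ge0 a2; have h3 := normr_ge0 a1; have h4 := normr_ge0 a2.
    by apply: lerD; apply: ler_wpM2r => //; rewrite /c; lra.
  have c0' : (0 <= c%:E)%E by rewrite lee_fin ltW.
  by apply: leeD; apply: lee_wpmul2l => //; apply: ereal_sup_ubound; exists t.
Qed.

(** One subsequence serves both convergences of the definition; taking the union of the two bad
    events lets a single Borel-Cantelli argument suffice. *)
Lemma stochastic_integral_ae H I : vpred H -> is_stochastic_integral H I ->
  exists2 S : nat -> simple_process, forall k, simple_predictable (S k) &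
    \forall w \ae P, exists K, forall k, (K <= k)%N ->
      (pdist2 (sp_eval (S k)) H w < ((1 / 2) ^+ k)%:E)%E /\
      forall t, 0 <= t <= T -> `|sp_integral B (S k) t w - I t w| < (1 / 2) ^+ k.
Proof.
move=> pH [cI aI [S [hS dS sS]]].
pose A n w := pdist2 (sp_eval (S n)) H w.
pose V n w := ereal_sup [set `|sp_integral B (S n) t w - I t w|%:E | t in `[0%R, T]].
have pS n : vpred (sp_eval (S n)) by exact: sp_eval_predictable (hS n).
have mA n : measurable_fun setT (A n) by exact: (@measurable_pdist2 _ _ _ _ _ _ _ Pc BM T0 _ _ (pS n) pH).
have mA' := measurable_levelsW mA.
have mV : measurable_levels V.
  apply: measurable_levels_sup; [move=> n; exact: adapted_sp_integral (hS n)|move=> n; exact: (continuous_sp_integral BM (hS n))|exact: aI|exact: cI].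
pose F e n := [set w | e%:E <= A n w]%E `|` [set w | e%:E <= V n w]%E.
have mF (e : R) n : 0 < e -> measurable (F e n).
  by move=> e0; apply: measurableU; [exact: mA'|exact: mV].
have F0 (e : R) : 0 < e -> (fun n => P (F e n)) @ \oo --> 0%E.
  move=> e0; apply: (@squeeze_cvge _ _ _ _ (fun=> 0%E) _
    (fun n => P [set w | e%:E <= A n w]%E + P [set w | e%:E <= V n w]%E)%E).
  - by apply: nearW => n; rewrite measure_ge0/=; apply: measureU2; [exact: mA'|exact: mV].
  - exact: cvg_cst.
  - by rewrite -[X in _ --> X]adde0; apply: cvgeD => //; [exact: dS|exact: sS].
have [phi [kphi hphi]] := ae_subsequence mF F0.
exists (fun k => S (phi k)); first by move=> k; exact: hS.
apply: filterS hphi => w [K hK]; exists K => k Kk; have := hK k Kk.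
move=> /not_orP[/negP h1 /negP h2]; split; first by rewrite ltNge.
move=> t tT; rewrite -lte_fin; move: h2; rewrite -ltNge; apply: le_lt_trans.
by apply: ereal_sup_ubound; exists t => //=; rewrite in_itv.
Qed.

Lemma stochastic_integral0 H I : vpred H -> is_stochastic_integral H I ->
  \forall w \ae P, I 0 w = 0.
Proof.
move=> pH /(stochastic_integral_ae pH)[S hS hae].
apply: filterS hae => w [K hK].
apply/eqP; rewrite -normr_eq0 eq_le normr_ge0 andbT; apply/ler_addgt0Pr => e e0; rewrite add0r.
have : (fun k => (1 / 2 : R) ^+ k) @ \oo --> 0 by apply: cvg_expr; rewrite ger0_norm; lra.
move=> /cvgrPdist_lt/(_ _ e0)[N _ hN].
have [_ /(_ 0)] := hK (maxn K N) (leq_maxl _ _).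
rewrite lexx ltW// => /(_ isT); rewrite (sp_integral0 (hS _)) sub0r normrN => /ltW h.
apply: le_trans h _; have := hN _ (leq_maxr K N).
by rewrite sub0r normrN ger0_norm ?exprn_ge0//; exact: ltW.
Qed.

Lemma stopping_time_min tau tau' : stopping_time tau -> stopping_time tau' ->
  stopping_time (fun w => Num.min (tau w) (tau' w)).
Proof.
move=> [h1 h2] [h3 h4]; split.
  by move=> w; have /andP[? ?] := h1 w; have /andP[? ?] := h3 w; rewrite le_min ge_min; apply/andP; split; apply/andP || apply/orP; [split|left].
move=> t tT; rewrite (_ : [set w | _] = [set w | tau w <= t] `|` [set w | tau' w <= t]).
  by apply: (@measurableU _ (g_sigma_algebraType (Ft_gen P B t))); [exact: h2|exact: h4].
by apply/seteqP; split => w /=; rewrite ge_min => /orP.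
Qed.

Lemma half_expn_small (e : R) : 0 < e -> \forall k \near \oo, (1 / 2 : R) ^+ k < e.
Proof.
move=> e0; have : (fun k => (1 / 2 : R) ^+ k) @ \oo --> 0 by apply: cvg_expr; rewrite ger0_norm; lra.
move=> /cvgrPdist_lt/(_ _ e0); apply: filterS => k.
by rewrite sub0r normrN ger0_norm ?exprn_ge0//; lra.
Qed.

(** Left continuity at [s]; the assumption at time 0 covers [s = 0], where nothing precedes. *)
Lemma continuous_hitting_le (f : R -> R) (s c : R) : {within `[0, T], continuous f} ->
  f 0 <= c -> 0 <= s <= T -> (forall t, 0 <= t < s -> f t < c) -> f s <= c.
Proof.
move=> cf c0 sT h; rewrite leNgt; apply/negP => cs.
have e0 : 0 < (f s - c) / 2 by rewrite divr_gt0// subr_gt0.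
have [r r0 hr] := within_continuousP cf sT e0.
have s0 : 0 < s.
  have /andP[s0 _] := sT; rewrite lt_neqAle s0 andbT; apply/eqP => s0'.
  by move: cs; rewrite -s0' ltNge c0.
pose t := Num.max 0 (s - r / 2); have ts : t < s by rewrite gt_max s0 ltrBlDr ltrDl divr_gt0.
have t0 : 0 <= t by rewrite le_max lexx.
have tT : 0 <= t <= T by rewrite t0 (le_trans (ltW ts))//; case/andP: sT.
have : `|t - s| < r.
  rewrite ltr0_norm ?subr_lt0// opprB.
  have : s - r / 2 <= t by rewrite le_max lexx orbT.
  lra.
move=> /(hr t tT); rewrite ler_norml => /andP[_ h1].
have := h t; rewrite t0 ts => /(_ isT) h2; lra.
Qed.

(** [enorm2B_dist] is integrated in both directions, so that the error is relative to [Q] up to a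
    multiple of [q]. The second bound is relative to [sp_quad], which the first one replaces by [Q];
    the assumption [e <= 1] absorbs the products. *)
Lemma sp_quad_dist S H (s e q : R) w : simple_predictable S -> vpred H -> 0 <= s <= T -> 0 < e <= 1 ->
  (pdist2 (sp_eval S) H w <= q%:E)%E ->
  (\int[leb]_(t in `[0%R, s]) (enorm (H t w) ^+ 2)%:E < +oo)%E ->
  forall Q, Q = \int[leb]_(t in `[0, s]) enorm (H t w) ^+ 2 ->
  `|Q - sp_quad S s w| <= 2 * e * Q + 2 * (1 + e^-1) * q.
Proof.
move=> hS pH sT /andP[e0 e1] pd Hoo Q Qdef; have pS := sp_eval_predictable hS.
have /andP[s0 sT'] := sT.
have subs : `[0, s] `<=` `[0, T]%classic.
  by move=> t /=; rewrite !in_itv/= => /andP[-> /le_trans->].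
have mD : measurable (`[0, s] : set RT) by exact: measurable_itv.
have mH : measurable_fun (`[0, s] : set RT) (fun t => (enorm (H t w) ^+ 2)%:E).
  by apply/measurable_EFinP; exact: (predictable_path Pc BM T0 w (predictable_enorm2 pH) sT).
have mS : measurable_fun (`[0, s] : set RT) (fun t => (enorm (sp_eval S t w) ^+ 2)%:E).
  by apply/measurable_EFinP; exact: (predictable_path Pc BM T0 w (predictable_enorm2 pS) sT).
have mD2 := measurable_pdist2_path Pc BM T0 w pS pH.
have mSH : measurable_fun (`[0, s] : set RT) (fun t => (enorm (sp_eval S t w - H t w) ^+ 2)%:E).
  by apply: measurable_funS mD2 => //; exact: measurable_itv.
have pd' : (\int[leb]_(t in `[0%R, s]) (enorm (sp_eval S t w - H t w) ^+ 2)%:E <= q%:E)%E.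
  apply: le_trans pd; apply: ge0_subset_integral => //.
  by move=> t _; rewrite lee_fin sqr_ge0.
have QE : (\int[leb]_(t in `[0%R, s]) (enorm (H t w) ^+ 2)%:E = Q%:E)%E.
  rewrite Qdef /Rintegral fineK// ge0_fin_numE//.
  by apply: integral_ge0 => t _; rewrite lee_fin sqr_ge0.
have Q0 : 0 <= Q by rewrite -lee_fin -QE; apply: integral_ge0 => t _; rewrite lee_fin sqr_ge0.
have ei : 0 < e^-1 by rewrite invr_gt0.
have a0 : 0 <= 1 + e by lra.
have b0 : 0 <= 1 + e^-1 by lra.
have q0 : 0 <= q.
  rewrite -lee_fin; apply: le_trans pd'; apply: integral_ge0 => t _; by rewrite lee_fin sqr_ge0.
have h1 : sp_quad S s w <= (1 + e) * Q + (1 + e^-1) * q.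
  rewrite -lee_fin -(integral_sp_eval w hS s0).
  apply: (@le_trans _ _ ((1 + e)%:E * Q%:E + (1 + e^-1)%:E *
      (\int[leb]_(t in `[0%R, s]) (enorm (sp_eval S t w - H t w) ^+ 2)%:E))%E).
    rewrite -QE; apply: (@ge0_integral_le_lin _ _ _ leb _ _ _ _ _ _ a0 b0 mD mH mSH mS);
      try by move=> t _; rewrite lee_fin sqr_ge0.
    move=> t _; rewrite -!EFinM -EFinD lee_fin mulrDl mul1r.
    have := enorm2B_dist (sp_eval S t w) (H t w) e0; rewrite ler_norml => /andP[_]; lra.
  by rewrite [leRHS]EFinD (EFinM (1 + e)) (EFinM (1 + e^-1)) leeD// lee_wpmul2l.
have h2 : Q <= (1 + e) * sp_quad S s w + (1 + e^-1) * q.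
  rewrite -lee_fin -QE.
  apply: (@le_trans _ _ ((1 + e)%:E * (sp_quad S s w)%:E + (1 + e^-1)%:E *
      (\int[leb]_(t in `[0%R, s]) (enorm (sp_eval S t w - H t w) ^+ 2)%:E))%E).
    rewrite -(integral_sp_eval w hS s0); apply: (@ge0_integral_le_lin _ _ _ leb _ _ _ _ _ _ a0 b0 mD mS mSH mH);
      try by move=> t _; rewrite lee_fin sqr_ge0.
    move=> t _; rewrite -!EFinM -EFinD lee_fin mulrDl mul1r.
    have := enorm2B_dist (H t w) (sp_eval S t w) e0; rewrite -[H t w - _]opprB enormN.
    by rewrite ler_norml => /andP[_]; lra.
  by rewrite [leRHS]EFinD (EFinM (1 + e)) (EFinM (1 + e^-1)) leeD// lee_wpmul2l.
have q0' : 0 <= sp_quad S s w.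
  by rewrite -lee_fin -(integral_sp_eval w hS s0); apply: integral_ge0 => t _; rewrite lee_fin sqr_ge0.
move: h1 h2; set x := sp_quad S s w in q0' *; set r := (1 + e^-1) * q => h1 h2.
have r0 : 0 <= r by rewrite mulr_ge0.
have -> : 2 * (1 + e^-1) * q = 2 * r by rewrite mulrA.
have eQ : 0 <= e * Q by rewrite mulr_ge0// ltW.
have ex : e * x <= e * Q + e * (e * Q) + e * r.
  by have := ler_wpM2l (ltW e0) h1; lra.
have eeQ : e * (e * Q) <= e * Q by rewrite ler_piMl.
have er : e * r <= r by rewrite ler_piMl.
by rewrite ler_norml; apply/andP; split; lra.
Qed.

(** The simple exponentials are stopped at [sigma] and when their quadratic variation reaches [c].
    Their squares then have expectation at most [expR c], so the expectations, all equal to 1,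
    converge to that of the limit. *)
Lemma exp_stochastic_integral H I sigma (n : R) : vpred H -> is_stochastic_integral H I ->
  stopping_time sigma -> 0 <= n ->
  (\forall w \ae P, (\int[leb]_(t in `[0%R, sigma w]) (enorm (H t w) ^+ 2)%:E <= n%:E)%E) ->
  (\int[P]_w (expR (I (sigma w) w - (\int[leb]_(t in `[0, sigma w]) enorm (H t w) ^+ 2)%R / 2))%:E = 1)%E.
Proof.
move=> pH hI st n0 Qn; have [S hS hae] := stochastic_integral_ae pH hI.
(* The room of 1 above [n] makes the additional stopping inactive in the limit. *)
pose c := n + 1; have c0 : 0 < c by rewrite /c; lra.
have /choice[tau htau] k : exists tau, stopping_time tau /\ \forall w \ae P,
    (forall t, 0 <= t < tau w -> sp_quad (S k) t w < c) /\ (c <= sp_quad (S k) (tau w) w \/ tau w = T).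
  have cQ : continuous_paths P T (sp_quad (S k)) by apply: aeW => w; exact: continuous_sp_quad.
  have [tau h1 h2] := hitting_time T0 c (adapted_sp_quad (hS k)) cQ.
  by exists tau.
pose sk k w := Num.min (sigma w) (tau k w).
have stk k : stopping_time (sk k) by have [h _] := htau k; exact: stopping_time_min.
pose X k w := sp_exp B (S k) (sk k w) w.
pose Y w := expR (I (sigma w) w - (\int[leb]_(t in `[0, sigma w]) enorm (H t w) ^+ 2)%R / 2).
have mX k : measurable_fun setT (X k).
  by apply: (measurable_stopped Pc BM T0 (stk k)); [exact: adapted_sp_exp|exact: continuous_sp_exp].
have XY : \forall w \ae P, X ^~ w @ \oo --> Y w.
  have htau' : \forall w \ae P, forall k,
    (forall t, 0 <= t < tau k w -> sp_quad (S k) t w < c) /\ (c <= sp_quad (S k) (tau k w) w \/ tau k w = T).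
    by apply/ae_foralln => k; have [] := htau k.
  move: hae Qn htau'; apply: filterS3 => w [K hK] Qn ht.
  set s := sigma w in Qn *; have sT : 0 <= s <= T by have [h _] := st; exact: h.
  have Qoo : (\int[leb]_(t in `[0%R, s]) (enorm (H t w) ^+ 2)%:E < +oo)%E.
    by apply: le_lt_trans Qn _; exact: ltry.
  have Qn' : \int[leb]_(t in `[0, s]) enorm (H t w) ^+ 2 <= n.
    by rewrite -lee_fin /Rintegral fineK// ge0_fin_numE//; apply: integral_ge0 => t _; rewrite lee_fin sqr_ge0.
  pose Q := \int[leb]_(t in `[0, s]) enorm (H t w) ^+ 2.
  have cq : (fun k => sp_quad (S k) s w) @ \oo --> Q.
    (* [r] keeps the relative error [2 r Q] below [e / 2], as [Q <= n < c]; then [k] is taken so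
       large that the remaining [2 (1 + 1 / r) (1 / 2)^k] is below [e / 2]. *)
    apply/cvgrPdist_le => e e0; pose r := Num.min 1 (e / (4 * c)).
    have r0 : 0 < r by rewrite lt_min ltr01 divr_gt0// mulr_gt0.
    have r1 : r <= 1 by rewrite ge_min lexx.
    have rn : 2 * r * n <= e / 2.
      have : r <= e / (4 * c) by rewrite ge_min lexx orbT.
      rewrite ler_pdivlMr ?mulr_gt0// /c => h; have : r * n <= r * (n + 1) by rewrite ler_wpM2l ?(ltW r0)//; lra.
      by rewrite mulrA in h; lra.
    have k0 : 0 < e / 4 / (1 + r^-1) by rewrite !divr_gt0// addr_gt0// invr_gt0.
    near=> k; have Kk : (K <= k)%N by near: k; exact: nbhs_infty_ge.
    have [h1 _] := hK k Kk.
    have := sp_quad_dist (hS k) pH sT (e := r); rewrite r0 r1 => /(_ _ w isT (ltW h1) Qoo Q erefl) h.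
    apply: le_trans h _.
    have : (1 / 2 : R) ^+ k < e / 4 / (1 + r^-1) by near: k; exact: half_expn_small.
    rewrite ltr_pdivlMr; last by rewrite addr_gt0// invr_gt0.
    set qk := (1 / 2) ^+ k; set ri := 1 + r^-1 => h2.
    have : 2 * r * Q <= 2 * r * n by rewrite ler_wpM2l// mulr_ge0// ltW.
    by rewrite (_ : 2 * ri * qk = 2 * (qk * ri)); [move=> h3; lra|ring].
  have cJ : (fun k => sp_integral B (S k) s w) @ \oo --> I s w.
    apply/cvgrPdist_lt => e e0; near=> k.
    have Kk : (K <= k)%N by near: k; exact: nbhs_infty_ge.
    have [_ /(_ s sT)] := hK k Kk; rewrite distrC => /lt_trans; apply.
    by near: k; exact: half_expn_small.
  have : (fun k => sp_exp B (S k) s w) @ \oo --> Y w.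
    apply: (continuous_cvg _ (@continuous_expR _ _)).
    by apply: cvgB => //; apply: cvgMl.
  apply: cvg_trans; apply: near_eq_cvg; near=> k.
  (* The variation of [S k] at [s] tends to [Q <= n], so for large [k] it is below [c] and [tau k]
     has not occurred before [s]. *)
  suff sks : sk k w = s by rewrite /X sks.
  rewrite /sk -/s.
  have qc : sp_quad (S k) s w < c.
    have : `|Q - sp_quad (S k) s w| < 1 by near: k; exact: (cvgrPdist_lt _ _).1.
    rewrite ltr_norml /c => /andP[+ _]; move: Qn'; rewrite -/Q; lra.
  apply/min_idPl; rewrite leNgt; apply/negP => ts.
  have [_ [h|h]] := ht k.
    by have := le_trans h (sp_quad_le w (hS k) (ltW ts)); rewrite leNgt qc.
  by move: ts; rewrite h ltNge; case/andP: sT => _ ->.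
have mY : measurable_fun setT Y by exact: (measurable_fun_ae_cvg Pc mX XY).
have X2 k : (\int[P]_w (X k w ^+ 2)%:E <= (expR c)%:E)%E.
  have hS2 := sp_scale_predictable 2 (hS k).
  have m2 : measurable_fun setT (fun w => sp_exp B (sp_scale 2 (S k)) (sk k w) w).
    by apply: (measurable_stopped Pc BM T0 (stk k)); [exact: adapted_sp_exp|exact: continuous_sp_exp].
  apply: (@le_trans _ _ (\int[P]_w ((expR c)%:E * (sp_exp B (sp_scale 2 (S k)) (sk k w) w)%:E))%E).
    apply: ae_ge0_le_integral => //.
    - by move=> w _; rewrite lee_fin sqr_ge0.
    - by apply/measurable_EFinP; exact: measurable_funX.
    - by move=> w _; rewrite -EFinM lee_fin mulr_ge0 ?expR_ge0.
    - by apply: measurable_funeM; exact/measurable_EFinP.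
    - have [sttau h] := htau k; apply: filterS h => w [h _] _.
      rewrite -EFinM lee_fin /X sp_exp_sqr ler_wpM2r ?expR_ge0// ler_expR.
      have tT : 0 <= tau k w <= T by have [h' _] := sttau; exact: h'.
      have Q0 : sp_quad (S k) 0 w <= c by rewrite (sp_quad0 (hS k)) ltW.
      apply: le_trans (continuous_hitting_le (@continuous_sp_quad _ _ _ _ _ _ _ _ w (hS k)) Q0 tT h).
      by apply: (sp_quad_le w (hS k)); rewrite ge_min lexx orbT.
  rewrite ge0_integralZl//; try by [exact/measurable_EFinP|move=> w _; rewrite lee_fin expR_ge0|rewrite lee_fin expR_ge0].
  by rewrite (integral_sp_exp_stopped Pc BM T0 hS2 (stk k)) mule1.
have := l2_cvg mX mY (fun k w => expR_ge0 _) (fun w => expR_ge0 _) XY X2.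
have -> : (fun k => \int[P]_w (X k w)%:E)%E = fun=> 1%E.
  by apply/funext => k; exact: (integral_sp_exp_stopped Pc BM T0 (hS k) (stk k)).
by move=> /cvg_lim <-//; rewrite lim_cst.
Unshelve. all: by end_near. Qed.

End exp_martingale.

(** True of arbitrary functions, because the integral of a nonnegative function is the supremum over
    the simple functions below it. *)
Lemma ge0_integral_mono d (X : measurableType d) (R : realType)
    (mu : {measure set X -> \bar R}) (f g : X -> \bar R) :
  (forall x, 0 <= f x)%E -> (forall x, f x <= g x)%E -> (\int[mu]_x f x <= \int[mu]_x g x)%E.
Proof.
move=> f0 fg; have g0 x : (0 <= g x)%E by exact: le_trans (f0 x) (fg x).
rewrite !ge0_integralTE//; apply: le_ereal_sup => _ [h hf <-]; exists h => // x.
exact: le_trans (hf x) (fg x).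
Qed.

(** * Triviality at time 0, localization, and null sets of paths *)

Section localization.
Context d (Omega : measurableType d) (R : realType) (P : probability Omega R).
Context (T : R) (m : nat) (B : R -> Omega -> 'cV[R]_m).
Hypothesis Pc : measure_is_complete P.
Hypothesis BM : brownian_motion P T B.
Hypothesis T0 : 0 < T.

Local Notation Ft := (augmented_filtration P B).
Local Notation predictable := (predictable P T B).
Local Notation pred_system := (pred_system P T B).
Local Notation adapted := (adapted P T B).
Local Notation stopping_time := (stopping_time P T B).
Local Notation leb := (@lebesgue_measure R).
Local Notation RT := (measurableTypeR R).
Local Notation horizon := (@horizon d Omega R T).

(* [g] need not be measurable. *)
Lemma ge0_integral_ae_mono (f : Omega -> R) (g : Omega -> \bar R) :
  measurable_fun setT f -> (forall w, 0 <= f w) -> (forall w, 0 <= g w)%E ->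
  (\forall w \ae P, ((f w)%:E <= g w)%E) -> (\int[P]_w (f w)%:E <= \int[P]_w g w)%E.
Proof.
move=> mf f0 g0 [N [mN N0 fgN]].
have mNc : measurable_fun setT (\1_(~` N) : Omega -> R) by apply: measurable_indic; exact: measurableC.
have mfN : measurable_fun setT (fun w => f w * \1_(~` N) w) by exact: measurable_funM.
rewrite (@ae_eq_integral _ _ _ P setT (fun w => (f w * \1_(~` N) w)%:E))//.
- apply: ge0_integral_mono => w; rewrite indicE; first by rewrite lee_fin mulr_ge0.
  case: (boolP (w \in ~` N)) => [|_]; last by rewrite mulr0.
  by rewrite inE mulr1 => Nw; apply: contrapT => h; apply: Nw; exact: fgN.
- exact/measurable_EFinP.
- exact/measurable_EFinP.
- exists N; split => // w /= h; apply: contrapT => Nw; apply: h => _.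
  by rewrite indicE mem_set// mulr1.
Qed.

(** At time 0 the generators are negligible sets and events about [B 0], which is almost surely 0;
    the sets that are null or have null complement form a sigma-algebra. *)
Lemma Ft0_trivial E : Ft 0 E -> P.-negligible E \/ P.-negligible (~` E).
Proof.
have [_ B0 _ _] := BM.
suff h : Ft 0 `<=` [set E | P.-negligible E \/ P.-negligible (~` E)] by exact: h.
have sub : sigma_algebra setT [set E | P.-negligible E \/ P.-negligible (~` E)].
  split.
  - by left; exact: negligible_set0.
  - by move=> A /= [h|h]; rewrite setTD ?setCK; [right|left].
  - move=> A hA /=; have [[n hn]|hn] := pselect (exists n, P.-negligible (~` A n)).
      by right; apply: negligibleS hn; apply: subsetC; exact: bigcup_sup.
    left; apply: negligible_bigcup => n; case: (hA n) => // h.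
    by exfalso; apply: hn; exists n.
apply: smallest_sub => // E' [|]; last by left.
apply: (@smallest_sub _ _ _ _ sub) => E'' [s [i [A [/andP[s0 sle] mA ->]]]] /=.
have -> : s = 0 by apply/eqP; rewrite eq_le sle s0.
have [A0|A0] := pselect (A 0); [right|left]; apply: negligibleS B0 => w /= h; apply: contrapT => /contrapT Bw.
  by apply: h; rewrite Bw mxE.
by move: h; rewrite Bw mxE.
Qed.

(** Applied to [Y], this turns [Y 0] into a number, as the value formula requires: the value does
    not depend on the sample point. *)
Lemma adapted_time0_cst (X : R -> Omega -> R) : adapted X -> exists c, \forall w \ae P, X 0 w = c.
Proof.
move=> aX; pose A r := [set w | X 0 w <= r].
have tA r : P.-negligible (A r) \/ P.-negligible (~` A r).
  apply: Ft0_trivial.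
  have := aX 0; rewrite lexx ltW// => /(_ isT `]-oo, r]%classic (measurable_itv _)).
  by congr (Ft 0 _); apply/seteqP; split => w /=; rewrite in_itv.
have notall : ~ P.-negligible setT.
  move=> /(measure_negligible measurableT) h; have /eqP := etrans (esym h) (probability_setT P).
  by rewrite eqe eq_sym oner_eq0.
have sA r s : r <= s -> A r `<=` A s by move=> rs w /= /le_trans; apply.
(* The null lower level sets form a nonempty initial segment of the line that is bounded above,
   since every level event is null or has null complement; its supremum is the constant. *)
pose S := [set r | P.-negligible (A r)].
have S0 : S !=set0.
  apply: contrapT => hS; apply: notall.
  have -> : setT = \bigcup_n ~` A (- n%:R).
    apply/esym/seteqP; split => // w _; exists (Num.truncn (- X 0 w)).+1 => //= h.
    have := truncnS_gt (- X 0 w); rewrite /A/= in h; lra.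
  apply: negligible_bigcup => n; case: (tA (- n%:R)) => // h.
  by exfalso; apply: hS; exists (- n%:R).
have [n hn] : exists n : nat, ~ S n%:R.
  apply: contrapT => hS; apply: notall.
  have -> : setT = \bigcup_n A n%:R.
    apply/esym/seteqP; split => // w _; exists (Num.truncn (X 0 w)).+1 => //=.
    by rewrite /A/= ltW// truncnS_gt.
  apply: negligible_bigcup => k; apply: contrapT => h; apply: hS; by exists k.
have ubS : has_ubound S.
  exists n%:R => r Sr; rewrite leNgt; apply/negP => nr; apply: hn.
  by apply: negligibleS Sr; apply: sA; exact: ltW.
exists (sup S).
have i0 k : 0 < k.+1%:R^-1 :> R by rewrite invr_gt0.
have nb : P.-negligible (\bigcup_k (A (sup S - k.+1%:R^-1) `|` ~` A (sup S + k.+1%:R^-1))).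
  apply: negligible_bigcup => k; apply: negligibleU.
    have [r Sr hr] := sup_adherent (i0 k) (conj S0 ubS).
    by apply: negligibleS Sr; apply: sA; exact: ltW.
  case: (tA (sup S + k.+1%:R^-1)) => // h.
  have := ub_le_sup ubS h; rewrite gerDl leNgt i0//.
apply: negligibleS nb => w /= h; apply: contrapT => hw; apply: h.
apply/eqP; rewrite -subr_eq0 -normr_eq0 eq_le normr_ge0 andbT; apply/ler_addgt0Pr => e e0; rewrite add0r.
have [k hk] : exists k, k.+1%:R^-1 < e.
  exists (Num.truncn e^-1); rewrite invf_plt ?posrE//; exact: truncnS_gt.
apply: le_trans (ltW hk); set q := k.+1%:R^-1 in i0 *.
rewrite ler_norml; apply/andP; split.
  rewrite lerBrDr leNgt addrC; apply/negP => hlt; apply: hw; exists k => //; left; exact: ltW.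
rewrite lerBlDr addrC leNgt; apply/negP => hlt; apply: hw; exists k => //; right => /= hle.
by move: (lt_le_trans hlt hle); rewrite ltxx.
Qed.

(** [tau n] is the time at which the integral of [q] reaches [n], or [T]. The integral up to [T] is
    finite, so large levels are never reached. *)
Lemma localization (q : R -> Omega -> R) : predictable q -> (forall t w, 0 <= q t w) ->
  (\forall w \ae P, (\int[leb]_(t in `[0%R, T]) (q t w)%:E < +oo)%E) ->
  exists2 tau : nat -> Omega -> R, forall n, stopping_time (tau n) &
    \forall w \ae P, (forall n, (\int[leb]_(t in `[0%R, tau n w]) (q t w)%:E <= n%:R%:E)%E) /\
      exists K, forall n, (K <= n)%N -> tau n w = T.
Proof.
move=> pq q0 qoo; have TT : 0 <= T <= T by rewrite lexx ltW.
pose Q t w := \int[leb]_(s in `[0, t]) q s w.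
have aQ : adapted Q by apply: adapted_integral.
have mq w t : 0 <= t <= T -> measurable_fun (`[0, t] : set RT) (fun s => (q s w)%:E).
  by move=> tT; apply/measurable_EFinP; exact: (predictable_path Pc BM T0 w pq tT).
have qint w : (\int[leb]_(t in `[0%R, T]) (q t w)%:E < +oo)%E ->
    leb.-integrable `[0, T] (fun t => (q t w)%:E).
  move=> h; apply/integrableP; split; first exact: mq.
  by under eq_integral do rewrite gee0_abs ?lee_fin//.
have cQ : continuous_paths P T Q.
  by apply: filterS qoo => w /qint; exact: parameterized_integral_continuous (ltW T0).
have /choice[tau htau] n : exists tau, stopping_time tau /\ \forall w \ae P,
    (forall t, 0 <= t < tau w -> Q t w < n%:R) /\ (n%:R <= Q (tau w) w \/ tau w = T).
  by have [tau h1 h2] := hitting_time T0 n%:R aQ cQ; exists tau.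
exists tau; first by move=> n; have [] := htau n.
have h' : \forall w \ae P, forall n,
    (forall t, 0 <= t < tau n w -> Q t w < n%:R) /\ (n%:R <= Q (tau n w) w \/ tau n w = T).
  by apply/ae_foralln => n; have [] := htau n.
move: qoo cQ h'; rewrite /continuous_paths; apply: filterS3 => w woo cw hw.
have tauT n : 0 <= tau n w <= T by have [[h _] _] := htau n; exact: h.
have QE t : 0 <= t <= T -> (\int[leb]_(s in `[0%R, t]) (q s w)%:E = (Q t w)%:E)%E.
  move=> tT; rewrite /Q /Rintegral fineK// ge0_fin_numE; last by apply: integral_ge0 => s _; rewrite lee_fin.
  apply: le_lt_trans woo; apply: ge0_subset_integral => //.
  - exact: mq.
  - by move=> s _; rewrite lee_fin.
  - by move=> s /=; rewrite !in_itv/= => /andP[-> /le_trans->]//; case/andP: tT.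
have Qmono s t : s <= t -> 0 <= s -> t <= T -> Q s w <= Q t w.
  move=> st s0 tT; have t0 := le_trans s0 st; have sT := le_trans st tT.
  rewrite -lee_fin -!QE ?s0 ?t0 ?sT//; apply: ge0_subset_integral => //.
  - by apply: mq; rewrite t0.
  - by move=> r _; rewrite lee_fin.
  - by move=> r /=; rewrite !in_itv/= => /andP[-> /le_trans->].
split.
  move=> n; rewrite QE// lee_fin; have [h _] := hw n.
  apply: (continuous_hitting_le cw _ (tauT n) h).
  by rewrite /Q set_itv1 Rintegral_set1.
(* A level above the total integral cannot be hit, which leaves [tau n w = T]. *)
exists (Num.truncn (Q T w)).+1 => n hn; have [_ [h|//]] := hw n.
have /andP[t0 tT] := tauT n; have h1 := le_trans h (Qmono _ _ tT t0 (lexx T)).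
have h2 : (Num.truncn (Q T w)).+1%:R <= n%:R :> R by rewrite ler_nat.
by have := lt_le_trans (truncnS_gt (Q T w)) (le_trans h2 h1); rewrite ltxx.
Qed.

(** Fubini exchanges the two null sets: the indicator of [D] has integral zero in the product, hence
    zero time integral on almost every path. Admissibility gives the constraint time by time, while
    the argument integrates along paths. *)
Lemma ae_path D : pred_system D -> (forall t, 0 <= t <= T -> \forall w \ae P, ~ D (t, w)) ->
  \forall w \ae P, {ae leb, forall t, `[0%R, T]%classic t -> ~ D (t, w)}.
Proof.
move=> pD hD; have pX := predictable_set pD.
have mh : measurable (horizon : set (RT * Omega)) by exact: measurable_horizon.
have TT : 0 <= T <= T by rewrite lexx ltW.
pose f : RT * Omega -> \bar R := ((fun z : RT * Omega => (\1_D (z.1, z.2) : R)%:E) \_ (`[0%R, T] `*` setT))%E.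
have mf : measurable_fun setT f.
  have /measurable_EFinP mX := predictable_measurable Pc BM T0 pX.
  exact: (measurable_restrictT _ mh).1 mX.
have f0 z : (0 <= f z)%E by rewrite /f patchE; case: ifP => // _; rewrite lee_fin indicE.
have h1 : (\int[leb \x P]_z f z = 0)%E.
  transitivity (\int[leb]_t fubini_F P f t)%E; first exact: (@fubini_tonelli1 _ _ _ _ R leb P f mf f0).
  apply: integral0_eq => t _.
  rewrite /fubini_F; have [tT|tT] := boolP (0 <= t <= T); last first.
    apply: integral0_eq => w _; rewrite /f patchE memNset// => -[/=].
    by rewrite in_itv/= (negbTE tT).
  transitivity (\int[P]_(w in setT) (cst 0%E w))%E; last by rewrite integral0.
  apply: ae_eq_integral => //.
    have := measurable_fun_pair2 (t : RT) mf; exact.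
  apply: filterS (hD t tT) => w nD _; rewrite /f patchE; case: ifP => // _.
  by rewrite indicE/= memNset.
have h2 : (\int[P]_w \int[leb]_(t in `[0%R, T]) (\1_D (t, w) : R)%:E = 0)%E.
  rewrite -(tonelli_path Pc BM T0 pX); last by move=> t w; rewrite indicE.
  by rewrite integral_mkcond.
have mI := measurable_integral_predictable Pc BM T0 pX.
have : ae_eq P setT (fun w => \int[leb]_(t in `[0%R, T]) (\1_D (t, w) : R)%:E)%E (cst 0%E).
  apply/(ae_eq_integral_abs P measurableT mI).
  rewrite -[RHS]h2; apply: eq_integral => w _.
  by rewrite gee0_abs//; apply: integral_ge0 => t _; rewrite lee_fin indicE.
apply: filterS => w /(_ Logic.I) h.
have mp : measurable_fun (`[0, T] : set RT) (fun t => (\1_D (t, w) : R)%:E).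
  by apply/measurable_EFinP; exact: (predictable_path Pc BM T0 w pX TT).
have : ae_eq leb `[0%R, T]%classic (fun t => (\1_D (t, w) : R)%:E) (cst 0%E).
  apply/(ae_eq_integral_abs leb (measurable_itv _) mp).
  rewrite -[RHS]h; apply: eq_integral => t _.
  by rewrite gee0_abs// lee_fin indicE.
apply: filterS => t /= ht /ht; rewrite indicE => -[].
by case: (boolP (_ \in D)) => [_ /eqP|h' _ Dt]; [rewrite oner_eq0|apply: (negP h'); exact: mem_set].
Qed.

End localization.

(** * Predictable selection of projections *)

Section convex_projection.
Context (R : realType) (k m : nat).
Implicit Types (C : set 'cV[R]_k) (A : 'M[R]_(m, k)) (u v : 'cV[R]_k).

Lemma convex_comb C u v (l : R) : convex_set C -> 0 <= l <= 1 -> C u -> C v ->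
  C (l *: u + (1 - l) *: v).
Proof.
move=> cC /andP[l0 l1] Cu Cv.
have := cC u v (Itv01 l0 l1) (mem_set Cu) (mem_set Cv).
by rewrite inE.
Qed.

Lemma closed_entrywise C u : closed C ->
  (forall r, 0 < r -> exists2 v, C v & forall i, `|u i ord0 - v i ord0| < r) -> C u.
Proof.
move=> cC h; apply: cC => N /nbhs_ballP[e /= e0 eN].
have [v Cv hv] := h e e0; exists v; split => //; apply: eN; split => // i j.
by rewrite (ord1 j) /ball/=; exact: hv.
Qed.

(** For every box with rational centre and radius [1 / (n + 1)] one point of [C] in the box is
    chosen, if there is one. The boxes are countable, hence indexed by integers. *)
Lemma entrywise_dense C : C 0 -> exists2 c : nat -> 'cV[R]_k, forall n, C (c n) &
  forall u, C u -> forall r, 0 < r -> exists n, forall i, `|u i ord0 - c n i ord0| < r.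
Proof.
move=> C0; pose near (q : 'cV[rat]_k * nat) u := C u /\ forall i, `|u i ord0 - ratr (q.1 i ord0)| < q.2.+1%:R^-1.
(* The default 0 belongs to [C], so every chosen point does. *)
pose pt q := xget 0 [set u | near q u].
have Cpt q : C (pt q) by rewrite /pt; case: xgetP => [u -> []|_].
exists (fun n => if unpickle n is Some q then pt q else 0).
  by move=> n; case: unpickle.
(* The radius is below [r / 2], because both [u] and the chosen point are within it of the rational
   centre. *)
move=> u Cu r r0; pose N := Num.truncn (2 / r).
have N0 : 0 < N.+1%:R^-1 :> R by rewrite invr_gt0.
have hN : 2 * N.+1%:R^-1 < r.
  by rewrite ltr_pdivrMr// mulrC -ltr_pdivrMr//; exact: truncnS_gt.
have /choice[q hq] i : exists x : rat, `|u i ord0 - ratr x| < N.+1%:R^-1.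
  have [x] := @rat_in_itvoo R (u i ord0 - N.+1%:R^-1) (u i ord0 + N.+1%:R^-1) ltac:(set y := _^-1 in N0 *; lra).
  rewrite in_itv/= => /andP[h1 h2]; exists x; rewrite ltr_norml; move: h1 h2; set y := _^-1 in N0 *; move=> h1 h2.
  by apply/andP; split; lra.
pose Q := (\col_i q i, N).
exists (pickle Q) => i; rewrite pickleK.
have : near Q (pt Q) by apply: (xgetPex 0); exists u; split => // j; rewrite mxE.
move=> [_ /(_ i)]; rewrite mxE /= => h1; have h2 := hq i.
apply: lt_trans hN; rewrite -[u i ord0](subrK (ratr (q i))) -addrA.
apply: le_lt_trans (ler_normD _ _) _; rewrite mulr_natl mulr2n distrC in h1 *.
exact: ltrD.
Qed.

Lemma mulmx_entry_le (p q : nat) (L : 'M[R]_(p, q)) : exists2 S, 0 < S &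
  forall (v : 'cV[R]_q) r, 0 <= r -> (forall i, `|v i ord0| <= r) -> forall j, `|(L *m v) j ord0| <= S * r.
Proof.
exists (1 + \sum_i \sum_j `|L i j|).
  by rewrite ltr_pwDl// sumr_ge0// => i _; apply: sumr_ge0.
move=> v r r0 hv j; rewrite mxE; apply: le_trans (ler_norm_sum _ _ _) _.
apply: (@le_trans _ _ ((\sum_i `|L j i|) * r)).
  by rewrite mulr_suml; apply: ler_sum => i _; rewrite normrM ler_wpM2l.
apply: ler_wpM2r => //; rewrite (bigD1 j)//= addrCA lerDl addr_ge0// sumr_ge0// => i _.
exact: sumr_ge0.
Qed.

Lemma enorm2_entry_le (q : nat) (v : 'cV[R]_q) r : 0 <= r -> (forall i, `|v i ord0| <= r) ->
  enorm v ^+ 2 <= q%:R * r ^+ 2.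
Proof.
move=> r0 hv; rewrite enorm2 /dotv (_ : q%:R * _ = \sum_(i < q) r ^+ 2).
  by apply: ler_sum => i _; rewrite -expr2 -[_ ^+ 2]real_normK ?num_real// ler_pXn2r ?nnegrE.
by rewrite sumr_const card_ord mulr_natl.
Qed.

Lemma entry2_le (q : nat) (v : 'cV[R]_q) i : v i ord0 ^+ 2 <= enorm v ^+ 2.
Proof.
rewrite enorm2 /dotv (bigD1 i)//= -expr2 lerDl.
by apply: sumr_ge0 => j _; rewrite -expr2 sqr_ge0.
Qed.

Lemma enorm2_mulmx_continuous A (x : 'cV[R]_m) u e : 0 < e -> exists2 r, 0 < r &
  forall v, (forall i, `|u i ord0 - v i ord0| < r) -> `|enorm (x - A *m v) ^+ 2 - enorm (x - A *m u) ^+ 2| <= e.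
Proof.
move=> e0; set V := enorm (x - A *m u) ^+ 2; have V0 : 0 <= V := sqr_ge0 _.
have [S S0 hS] := mulmx_entry_le A.
pose h := e / (2 * (V + 1)); have h0 : 0 < h by rewrite divr_gt0// mulr_gt0// ltr_wpDl.
have hi0 : 0 < h^-1 by rewrite invr_gt0.
pose K := (1 + h^-1) * (m%:R * S ^+ 2).
have K0 : 0 <= K by rewrite mulr_ge0// ?mulr_ge0 ?sqr_ge0//; lra.
pose r := Num.min 1 (e / (2 * (K + 1))).
have r0 : 0 < r by rewrite lt_min ltr01 divr_gt0// mulr_gt0// ltr_wpDl.
have r1 : r <= 1 by rewrite ge_min lexx.
have Kr : K * r <= e / 2.
  have : r <= e / (2 * (K + 1)) by rewrite ge_min lexx orbT.
  rewrite ler_pdivlMr ?mulr_gt0 ?ltr_wpDl// => hr; nra.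
have hV : h * V <= e / 2.
  have : h * (2 * (V + 1)) = e by rewrite /h divfK// gt_eqF// mulr_gt0// ltr_wpDl.
  nra.
exists r => // v hv.
have hAuv : enorm (x - A *m v - (x - A *m u)) ^+ 2 <= m%:R * (S * r) ^+ 2.
  rewrite (_ : _ - _ = A *m (u - v)); last by rewrite mulmxBr opprB addrC addrA subrK.
  apply: enorm2_entry_le; first by rewrite mulr_ge0// ltW.
  by apply: hS; [exact: ltW|move=> i; rewrite !mxE ltW].
have h1 := enorm2B_dist (x - A *m v) (x - A *m u) h0; rewrite -/V in h1; apply: le_trans h1 _.
have h2 : (1 + h^-1) * enorm (x - A *m v - (x - A *m u)) ^+ 2 <= K * r.
  apply: (@le_trans _ _ (K * r ^+ 2)); last by rewrite ler_wpM2l// expr2 ler_piMl// ltW.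
  apply: (@le_trans _ _ ((1 + h^-1) * (m%:R * (S * r) ^+ 2))); first by rewrite ler_wpM2l//; lra.
  by rewrite /K le_eqVlt; apply/orP; left; apply/eqP; ring.
lra.
Qed.

(** The midpoint is written in the form in which [convex_comb] produces it. *)
Lemma parallelogram (q : nat) (u v : 'cV[R]_q) :
  enorm (u - v) ^+ 2 = 2 * enorm u ^+ 2 + 2 * enorm v ^+ 2 - 4 * enorm ((1 / 2) *: u + (1 - 1 / 2) *: v) ^+ 2.
Proof.
rewrite !enorm2 !(dotvDl, dotvDr, dotvZl, dotvZr, dotvNl, dotvNr) (dotvC v u); by field.
Qed.

(** The infimum [delta] over the dense sequence is a lower bound on [C] by continuity. By the
    parallelogram law the images under [A] of a minimizing sequence are Cauchy, and the left inverse
    [L] transfers this to the sequence itself, so that the minimizer is found in [C] and not only in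
    its image. *)
Lemma minimizing_cvg C A (L : 'M[R]_(k, m)) x (c : nat -> 'cV[R]_k) (mu : nat -> nat) (delta : R) :
  closed C -> convex_set C -> (forall n, C (c n)) ->
  (forall u, C u -> forall r, 0 < r -> exists n, forall i, `|u i ord0 - c n i ord0| < r) ->
  L *m A = 1%:M -> (forall n, delta <= enorm (x - A *m c n) ^+ 2) ->
  (forall n, enorm (x - A *m c (mu n)) ^+ 2 < delta + n.+1%:R^-1) ->
  (forall i, cvgn (fun n => c (mu n) i ord0)) /\
  let p := \col_i limn (fun n => c (mu n) i ord0) in
  C p /\ forall y, C y -> enorm (x - A *m p) ^+ 2 <= enorm (x - A *m y) ^+ 2.
Proof.
move=> clC cC Cc dc LA dle dmu.
have dC y : C y -> delta <= enorm (x - A *m y) ^+ 2.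
  move=> Cy; apply/ler_addgt0Pr => e e0; have [r r0 hr] := enorm2_mulmx_continuous A x y e0.
  have [n hn] := dc y Cy r r0; apply: le_trans (dle n) _.
  by have := hr _ hn; rewrite ler_norml => /andP[_]; rewrite lerBlDl.
pose u n := c (mu n).
have small e : 0 < e -> exists N : nat, forall n, (N <= n)%N -> n.+1%:R^-1 < e :> R.
  move=> e0; exists (Num.truncn e^-1) => n hn.
  rewrite invf_plt ?posrE//; apply: lt_le_trans (truncnS_gt _) _.
  by rewrite ler_nat ltnS.
(* The midpoint lies in [C], so its squared distance is at least [delta], which cancels against the
   two almost minimal terms. *)
have uu n l : enorm (A *m (u n - u l)) ^+ 2 <= 2 * (n.+1%:R^-1 + l.+1%:R^-1).
  have -> : A *m (u n - u l) = (x - A *m u l) - (x - A *m u n).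
    by rewrite mulmxBr opprB [RHS]addrC addrA subrK.
  rewrite parallelogram.
  have -> : (1 / 2) *: (x - A *m u l) + (1 - 1 / 2) *: (x - A *m u n) =
      x - A *m ((1 / 2) *: u l + (1 - 1 / 2) *: u n).
    rewrite mulmxDr -!scalemxAr !scalerBr addrACA -scalerDl -opprD.
    by rewrite (_ : 1 / 2 + _ = 1) ?scale1r//; field.
  have h12 : 0 <= (1 / 2 : R) <= 1 by apply/andP; split; lra.
  have := dC _ (convex_comb cC h12 (Cc (mu l)) (Cc (mu n))).
  have := dmu n; have := dmu l; 
  set a := _.+1%:R^-1; set b := _.+1%:R^-1; lra.
have [S S0 hS] := mulmx_entry_le L.
have cu i : cvgn (fun n => u n i ord0).
  apply: cauchy_cvg; apply: cauchy_exP => e e0.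
  (* The entries of [A (u N - u n)] are at most [r], and [L] enlarges entries by a factor of at most
     [S], so those of [u N - u n] are at most [e / 2]. *)
  pose r := e / (2 * S); have r0 : 0 < r by rewrite divr_gt0// mulr_gt0.
  have [N hN] := small (r ^+ 2 / 4) (divr_gt0 (exprn_gt0 2 r0) (ltr0n _ 4)).
  exists (u N i ord0); exists N => // n /= Nn; rewrite /ball/=.
  have hv j : `|(A *m (u N - u n)) j ord0| <= r.
    rewrite -(@ler_pXn2r _ 2)// ?nnegrE ?(ltW r0)// real_normK ?num_real//.
    apply: le_trans (entry2_le _ _) _; apply: le_trans (uu _ _) _.
    move: (hN N (leqnn N)) (hN n Nn); move: (N.+1%:R^-1) (n.+1%:R^-1) (r ^+ 2) => a b q h1 h2; lra.
  have := hS _ _ (ltW r0) hv i; rewrite mulmxA LA mul1mx !mxE => /le_lt_trans; apply.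
  have -> : S * r = e / 2 by rewrite /r; field; rewrite gt_eqF.
  by rewrite ltr_pdivrMr// mulr_natr mulr2n ltrDl.
split; first exact: cu.
move=> p.
have up r : 0 < r -> \forall n \near \oo, forall i, `|p i ord0 - u n i ord0| < r.
  move=> r0; apply: filter_forall => i; have /cvgrPdist_lt/(_ _ r0) := cu i.
  by apply: filterS => n; rewrite mxE.
split.
  apply: (closed_entrywise clC) => r /up[N _ hN]; exists (u N); first exact: Cc.
  by apply: hN => /=.
move=> y Cy; apply: le_trans (dC y Cy); apply/ler_addgt0Pr => e e0.
have e2 : 0 < e / 2 by rewrite divr_gt0.
have [r r0 hr] := enorm2_mulmx_continuous A x p e2.
near \oo => n.
have h1 : forall i, `|p i ord0 - u n i ord0| < r by near: n; exact: up.
have h2 : n.+1%:R^-1 < e / 2.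
  by near: n; have [N hN] := small _ e2; exists N => // k' /=; exact: hN.
have := dmu n; have := hr _ h1; rewrite -/(u n) ler_norml => /andP[+ _]; set a := n.+1%:R^-1 in h2 *; lra.
Unshelve. all: by end_near. Qed.

End convex_projection.

Section predictable_projection.
Context d (Omega : measurableType d) (R : realType) (P : probability Omega R).
Context (T : R) (m : nat) (B : R -> Omega -> 'cV[R]_m).
Hypothesis T0 : 0 < T.

Local Notation predictable := (predictable P T B).
Local Notation mx_predictable := (mx_predictable P T B).
Local Notation pred_system := (pred_system P T B).
Local Notation PT := (g_sigma_algebraType pred_system).
Local Notation horizon := (@horizon d Omega R T).

Lemma predictable_prod I (r : seq I) (X : I -> R -> Omega -> R) :
  (forall i, predictable (X i)) -> predictable (fun t w => \prod_(i <- r) X i t w).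
Proof.
move=> pX; elim: r => [|i r IH].
  apply: (@eq_predictable _ _ _ _ _ _ _ (fun _ _ => 1)); last exact: predictable_cst.
  by move=> t w _; rewrite big_nil.
apply: (@eq_predictable _ _ _ _ _ _ _ (fun t w => X i t w * \prod_(i <- r) X i t w)).
  by move=> t w _; rewrite big_cons.
exact: predictableM (pX i) IH.
Qed.

Lemma predictable_inv (X : R -> Omega -> R) : predictable X ->
  (forall t w, 0 <= t <= T -> X t w != 0) -> predictable (fun t w => (X t w)^-1).
Proof.
(* For nonzero [x], the identity [1 / x = x exp (- ln (x^2))] expresses the inverse through
   measurable maps. *)
move=> pX X0; apply: (@eq_predictable _ _ _ _ _ _ _ (fun t w => X t w * expR (- ln (X t w ^+ 2)))).
  move=> t w tT; have x0 := X0 t w tT.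
  rewrite expRN lnK ?posrE ?exprn_even_gt0//; field; exact: x0.
apply: predictableM => //.
apply: (@predictable_comp _ _ _ _ _ _ _ (fun x : R => expR (- ln (x ^+ 2)))) => //.
apply: measurableT_comp => //; apply: measurable_funN.
by apply: measurableT_comp => //; exact: measurable_funX.
Qed.

Lemma mx_predictable_tr p q (X : R -> Omega -> 'M[R]_(p, q)) :
  mx_predictable X -> mx_predictable (fun t w => (X t w)^T).
Proof. by move=> pX i j; apply: eq_predictable (pX j i) => t w _; rewrite mxE. Qed.

Lemma mx_predictable_mul p q r (X : R -> Omega -> 'M[R]_(p, q)) (Y : R -> Omega -> 'M[R]_(q, r)) :
  mx_predictable X -> mx_predictable Y -> mx_predictable (fun t w => X t w *m Y t w).
Proof.
move=> pX pY i j; apply: (@eq_predictable _ _ _ _ _ _ _ (fun t w => \sum_l X t w i l * Y t w l j)).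
  by move=> t w _; rewrite mxE.
by apply: predictable_sum => l; apply: predictableM; [exact: pX|exact: pY].
Qed.

Lemma predictable_det n (X : R -> Omega -> 'M[R]_n) : mx_predictable X -> predictable (fun t w => \det (X t w)).
Proof.
move=> pX; apply: predictable_sum => s; apply: predictableM; first exact: predictable_cst.
by apply: predictable_prod => i; exact: pX.
Qed.

(** Cramer's rule expresses the entries of the inverse by determinants. *)
Lemma mx_predictable_inv n (X : R -> Omega -> 'M[R]_n) : mx_predictable X ->
  (forall t w, 0 <= t <= T -> X t w \in unitmx) -> mx_predictable (fun t w => invmx (X t w)).
Proof.
move=> pX uX i j.
apply: (@eq_predictable _ _ _ _ _ _ _ (fun t w => (\det (X t w))^-1 * cofactor (X t w) j i)).
  by move=> t w tT; rewrite /invmx uX// !mxE.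
apply: predictableM.
  apply: predictable_inv; first exact: predictable_det.
  by move=> t w tT; rewrite -unitfE; exact: uX.
apply: predictableM; first exact: predictable_cst.
by apply: predictable_det => u v; apply: eq_predictable (pX (lift j u) (lift i v)) => t w _; rewrite !mxE.
Qed.

Lemma predictable_horizon (X : R -> Omega -> R) :
  measurable_fun (horizon : set PT) (fun z => X z.1 z.2) -> predictable X.
Proof.
have mh : measurable (horizon : set PT).
  by apply: sub_sigma_algebra; exact: pred_system_horizon.
move=> mX A mA; have := mX mh A mA.
rewrite (_ : measurable _ = <<s pred_system >> (horizon `&` (fun z => X z.1 z.2) @^-1` A))//.
by rewrite pred_systemE /pred_system/= setIA setIid.
Qed.

(** Measurable selection by a minimizing sequence from a countable dense subset of [C]. At step [n]
    the first index whose squared distance is within [1 / (n + 1)] of the infimum is a measurable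
    choice, and by [minimizing_cvg] the chosen points converge to the minimizer. *)
Lemma predictable_projection k (A : R -> Omega -> 'M[R]_(m, k)) (x : R -> Omega -> 'cV[R]_m)
    (C : set 'cV[R]_k) :
  mx_predictable A -> mx_predictable x ->
  (forall t w, 0 <= t <= T -> exists L, L *m A t w = 1%:M) ->
  closed C -> convex_set C -> C 0 ->
  exists2 p, mx_predictable p & forall t w, 0 <= t <= T -> C (p t w) /\
    forall y, C y -> enorm (x t w - A t w *m p t w) ^+ 2 <= enorm (x t w - A t w *m y) ^+ 2.
Proof.
move=> pA px LA clC cC C0; have [c Cc dc] := entrywise_dense C0.
pose D j (z : PT) := enorm (x z.1 z.2 - A z.1 z.2 *m c j) ^+ 2.
have mD j : measurable_fun setT (D j).
  have /predictableP : predictable (fun t w => enorm (x t w - A t w *m c j) ^+ 2).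
    apply: predictable_enorm2; apply: mx_predictableB => //; apply: mx_predictable_mul => //.
    exact: mx_predictable_cst.
  by [].
pose g (z : PT) := infs (D ^~ z) 0.
have lbD z : has_lbound (range (D ^~ z)) by exists 0 => _ [j _ <-]; exact: sqr_ge0.
have mg : measurable_fun setT g by apply: measurable_fun_infs => // z _.
have gD z j : g z <= D j z by apply: ge_inf; [exact: has_lbound_sdrop|exists j].
pose E n j (z : PT) := D j z < g z + n.+1%:R^-1.
have exE n z : exists j, E n j z.
  have n0 : 0 < n.+1%:R^-1 :> R by rewrite invr_gt0.
  have hi : has_inf (sdrop (D ^~ z) 0) by split; [exists (D 0%N z), 0%N|exact: has_lbound_sdrop].
  by have [_ [j _ <-] h] := inf_adherent n0 hi; exists j.
have mE n j : measurable ([set z | E n j z] : set PT).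
  have mb : measurable_fun setT (E n j) by apply: measurable_fun_ltr => //; exact: measurable_funD.
  by have := mb measurableT [set true] Logic.I; rewrite setTI.
pose mu n z := ex_minn (exE n z).
have Emu n z : E n (mu n z) z by rewrite /mu; case: ex_minnP.
have mmu n j : measurable ([set z | mu n z = j] : set PT).
  rewrite (_ : [set _ | _] = [set z | E n j z] `&` \bigcap_(i in [set i | (i < j)%N]) ~` [set z | E n i z]).
    apply: measurableI; first exact: mE.
    by apply: bigcap_measurableType => i _; apply: measurableC; exact: mE.
  apply/seteqP; split => z /=.
    move=> <-; split; first exact: Emu.
    by move=> i /=; rewrite /mu; case: ex_minnP => l _ hl il Ei; have := hl _ Ei; rewrite leqNgt il.
  move=> [Ej nE]; rewrite /mu; case: ex_minnP => l El /(_ _ Ej) lj.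
  by apply/eqP; rewrite eqn_leq lj leqNgt; apply/negP => /nE.
have mc n i : measurable_fun setT (fun z : PT => c (mu n z) i ord0).
  move=> _ S mS; rewrite setTI.
  rewrite (_ : _ @^-1` _ = \bigcup_(j in [set j | S (c j i ord0)]) [set z | mu n z = j]).
    by apply: bigcup_measurable => j _; exact: mmu.
  by apply/seteqP; split => z /=; [move=> h; exists (mu n z)|move=> [j /= h ->]].
pose p t w := \col_i limn (fun n => c (mu n (t, w)) i ord0).
have hp t w : 0 <= t <= T -> (forall i, cvgn (fun n => c (mu n (t, w)) i ord0)) /\
  (C (p t w) /\ forall y, C y -> enorm (x t w - A t w *m p t w) ^+ 2 <= enorm (x t w - A t w *m y) ^+ 2).
  move=> tT; have [L hL] := LA t w tT.
  apply: (minimizing_cvg clC cC Cc dc hL (delta := g (t, w)) (mu := fun n => mu n (t, w))).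
    by move=> n; exact: (gD (t, w)).
  by move=> n; exact: (Emu n (t, w)).
exists p; last by move=> t w tT; have [] := hp t w tT.
move=> i j; apply: predictable_horizon.
apply: (@measurable_fun_cvg _ PT R horizon (fun n z => c (mu n z) i ord0)).
  by move=> n; apply: measurable_funTS; exact: mc.
move=> [t w] [/=]; rewrite in_itv/= => tT _; rewrite mxE.
by have [/(_ i) h _] := hp t w tT; exact: h.
Qed.

End predictable_projection.

(** * Entropy *)

Section entropy.
Context d (Omega : measurableType d) (R : realType) (P : probability Omega R).
Implicit Types (u q : R).

(** The tangent to the exponential at [q u] lies below its values at [u] and at 0; the two
    inequalities are added with weights [q] and [1 - q]. *)
Lemma expR_convex_le q u : 0 <= q <= 1 -> expR (q * u) <= 1 - q + q * expR u.
Proof.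
move=> /andP[q0 q1]; set E := expR (q * u); have E0 : 0 < E := expR_gt0 _.
have h1 : E * (1 + (1 - q) * u) <= expR u.
  have -> : expR u = E * expR ((1 - q) * u) by rewrite -expRD; congr expR; ring.
  by rewrite ler_wpM2l ?(ltW E0)//; exact: expR_ge1Dx.
have h2 : E * (1 - q * u) <= 1.
  have e1 : E * expR (- (q * u)) = 1 by rewrite -expRD subrr expR0.
  by rewrite -[leRHS]e1 ler_wpM2l ?(ltW E0)//; exact: expR_ge1Dx.
have h1' := ler_wpM2l q0 h1; have q1' : 0 <= 1 - q by lra.
have h2' := ler_wpM2l q1' h2; move: h1' h2'; clear h1 h2.
have -> : q * (E * (1 + (1 - q) * u)) = q * E + E * (q * ((1 - q) * u)) by ring.
have -> : (1 - q) * (E * (1 - q * u)) = E - q * E - E * (q * ((1 - q) * u)) by ring.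
move: (E * _) => z h1 h2; lra.
Qed.

(** The quotient lies between [u] and [u] times the exponential at the step, both consequences of
    [1 + x <= exp x]. *)
Lemma expR_difference_quotient u : (fun k : nat => k.+1%:R * (expR (k.+1%:R^-1 * u) - 1)) @ \oo --> u.
Proof.
have kq (k : nat) : k.+1%:R * (k.+1%:R^-1 * u) = u by rewrite mulrA divff ?mul1r.
apply: (@squeeze_cvgr _ _ _ _ (fun=> u) (fun k : nat => u * expR (k.+1%:R^-1 * u))).
- apply: nearW => k; set q := k.+1%:R^-1; have k0 : 0 <= k.+1%:R :> R by [].
  apply/andP; split.
    by rewrite -{1}(kq k) ler_wpM2l// lerBrDl; exact: expR_ge1Dx.
  rewrite -{2}(kq k) -mulrA ler_wpM2l//; set x := k.+1%:R^-1 * u; rewrite -/q -/x.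
  have := expR_ge1Dx (- x); rewrite expRN => h.
  have E0 := expR_gt0 x; have h' := ler_wpM2l (ltW E0) h.
  by move: h'; rewrite divff ?gt_eqF//; lra.
- exact: cvg_cst.
- have h : (fun k : nat => expR (k.+1%:R^-1 * u)) @ \oo --> expR (0 * u).
    by apply: (continuous_cvg _ (@continuous_expR _ _)); apply: cvgMl; exact: cvg_harmonic.
  by rewrite -[X in _ --> X]mulr1; apply: cvgMr; rewrite mul0r expR0 in h.
Qed.

(** Here [exp l] is the variable [u] of the entropy argument. The hypothesis for [q] tending to 0
    gives [E exp l (W - l) >= 0], and Young's inequality with [p > 1] turns this into a bound of the
    entropy. Subtracting [u] and adding 1 makes the entropy integrand nonnegative. *)
Lemma entropy_bound (l W : Omega -> R) (p M : R) : measurable_fun setT l -> measurable_fun setT W ->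
  1 < p -> (\int[P]_w (expR (l w))%:E = 1)%E ->
  (forall q, (0 < q <= 1)%R -> 1 <= \int[P]_w (expR ((1 - q) * l w + q * W w))%:E)%E ->
  (\int[P]_w (expR (p * W w))%:E <= M%:E)%E ->
  (\int[P]_w (l w * expR (l w) - expR (l w) + 1)%:E <= (M / (p - 1))%:E)%E.
Proof.
move=> ml mW p1 El Eq EpW.
have icst (c : R) : (\int[P]_w c%:E = c%:E)%E.
  by rewrite integral_cst// [X in (_ * X)%E](probability_setT P) mule1.
have iD (f1 f2 : Omega -> R) : measurable_fun setT f1 -> measurable_fun setT f2 ->
    (forall w, 0 <= f1 w) -> (forall w, 0 <= f2 w) ->
    (\int[P]_w (f1 w + f2 w)%R%:E = \int[P]_w (f1 w)%:E + \int[P]_w (f2 w)%:E)%E.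
  move=> /measurable_EFinP m1 /measurable_EFinP m2 n1 n2.
  rewrite -ge0_integralD//; try by move=> w _; rewrite lee_fin.
have iZ (c : R) (f : Omega -> R) : 0 <= c -> measurable_fun setT f -> (forall w, 0 <= f w) ->
    (\int[P]_w (c * f w)%R%:E = c%:E * \int[P]_w (f w)%:E)%E.
  move=> c0 /measurable_EFinP mf n; rewrite -ge0_integralZl//.
  by move=> w _; rewrite lee_fin.
have me (f : Omega -> R) : measurable_fun setT f -> measurable_fun setT (fun w => expR (f w)).
  by move=> mf; exact: measurableT_comp.
have mE (f : Omega -> R) : measurable_fun setT f -> measurable_fun setT (fun w => (expR (f w))%:E).
  by move=> mf; apply/measurable_EFinP; exact: me.
have phi0 w : 0 <= l w * expR (l w) - expR (l w) + 1.
  have := expR_ge1Dx (- l w); rewrite expRN => h.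
  have E0 := expR_gt0 (l w); have := ler_wpM2l (ltW E0) h.
  by rewrite divff ?gt_eqF// mulrDr mulr1 mulrN (mulrC (expR _)); lra.
have mphi : measurable_fun setT (fun w => l w * expR (l w) - expR (l w) + 1).
  apply: measurable_funD => //; apply: measurable_funB; last exact: me.
  by apply: measurable_funM => //; exact: me.
(* [exp W] is integrable because [exp W <= exp (p W) + 1] when [p > 1]. *)
have [EW [EWE EW0]] : exists e : R, (\int[P]_w (expR (W w))%:E = e%:E)%E /\ 0 <= e.
  have f0 : (0 <= \int[P]_w (expR (W w))%:E)%E by apply: integral_ge0 => w _; rewrite lee_fin expR_ge0.
  have foo : (\int[P]_w (expR (W w))%:E <= (M + 1)%:E)%E.
    apply: (@le_trans _ _ (\int[P]_w ((expR (p * W w))%:E + 1%:E))%E).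
      apply: ge0_le_integral => //.
      - exact: mE.
      - by apply: emeasurable_funD => //; apply: mE; exact: measurable_funM.
      - move=> w _; rewrite -EFinD lee_fin.
        have [h|h] := leP 0 (W w).
          by apply: ler_wpDr => //; rewrite ler_expR; nra.
        by apply: ler_wpDl; [exact: expR_ge0|rewrite -expR0 ler_expR ltW].
    rewrite ge0_integralD//; last by apply: mE; exact: measurable_funM.
    by rewrite icst EFinD leeD.
  exists (fine (\int[P]_w (expR (W w))%:E)); split; last exact: fine_ge0.
  by rewrite fineK// ge0_fin_numE//; apply: le_lt_trans foo _; exact: ltry.
pose u w := W w - l w.
(* With [phi r = exp (l + r (W - l))], this is [phi 1 - phi 0] minus the difference quotient of
   [phi] at 0 with step [1 / (k + 1)]. Convexity makes it nonnegative, and [h] is the limit, with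
   the derivative in place of the quotient, so Fatou applies. *)
pose g (k : nat) w := expR (W w) - expR (l w) - expR (l w) * (k.+1%:R * (expR (k.+1%:R^-1 * u w) - 1)).
pose h w := expR (W w) - expR (l w) - expR (l w) * u w.
have mu : measurable_fun setT u by exact: measurable_funB.
have mg k : measurable_fun setT (g k).
  apply: measurable_funB; first by apply: measurable_funB; exact: me.
  apply: measurable_funM; first exact: me.
  by apply: measurable_funM => //; apply: measurable_funB => //; apply: me; exact: measurable_funM.
have mh : measurable_fun setT h.
  apply: measurable_funB; first by apply: measurable_funB; exact: me.
  by apply: measurable_funM => //; exact: me.
have We w : expR (W w) = expR (l w) * expR (u w) by rewrite -expRD; congr expR; rewrite /u; ring.
have q01 (k : nat) : 0 < (k.+1%:R^-1 : R) <= 1 by rewrite invr_gt0 ltr0n/= invf_le1// ler1n.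
have g0 k w : 0 <= g k w.
  have /andP[q0 q1] := q01 k; have q01' : 0 <= (k.+1%:R^-1 : R) <= 1 by rewrite (ltW q0).
  have h1 := expR_convex_le (u w) q01'.
  have : k.+1%:R * (expR (k.+1%:R^-1 * u w) - 1) <= expR (u w) - 1.
    rewrite mulrC -ler_pdivlMr//; move: h1; set q := _^-1; set a := expR _; set b := expR _ => h1; lra.
  move=> h2; have := ler_wpM2l (expR_ge0 (l w)) h2; rewrite /g We.
  by rewrite mulrBr mulr1; lra.
have h0 w : 0 <= h w.
  rewrite /h We; have := ler_wpM2l (expR_ge0 (l w)) (expR_ge1Dx (u w)); rewrite mulrDr mulr1; lra.
have gh : \forall w \ae P, g ^~ w @ \oo --> h w.
  apply: aeW => w; apply: cvgB; first exact: cvg_cst.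
  by apply: cvgMr; exact: expR_difference_quotient.
(* [E (g k) = EW - 1 - (k + 1) (E A - 1)], and [E A >= 1] by [Eq]. *)
have Eg k : (\int[P]_w (g k w)%:E <= (EW - 1)%:E)%E.
  have A1 := Eq _ (q01 k).
  have k0 : 0 <= k.+1%:R :> R by [].
  have mA : measurable_fun setT (fun w => (1 - k.+1%:R^-1) * l w + k.+1%:R^-1 * W w).
    by apply: measurable_funD; exact: measurable_funM.
  pose A w := expR ((1 - k.+1%:R^-1) * l w + k.+1%:R^-1 * W w).
  have nA w : 0 <= k.+1%:R * A w by rewrite mulr_ge0// expR_ge0.
  have mA' : measurable_fun setT A by exact: me.
  have mkA : measurable_fun setT (fun w => k.+1%:R * A w) by exact: measurable_funM.
  have mgA : measurable_fun setT (fun w => g k w + k.+1%:R * A w) by exact: measurable_funD.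
  have mkl : measurable_fun setT (fun w => k.+1%:R * expR (l w)) by apply: measurable_funM => //; exact: me.
  have E : (\int[P]_w (g k w)%:E + k.+1%:R%:E * (\int[P]_w (A w)%:E) + 1 = EW%:E + k.+1%:R%:E)%E.
    rewrite -[X in (_ + X = _)%E]El -iZ//; try by [exact: me|move=> w; exact: expR_ge0|move=> w; rewrite addr_ge0|move=> w; rewrite mulr_ge0 ?expR_ge0|exact: ltW|move=> _; exact: ltW].
    rewrite -iD//.
    rewrite -iD//; try by [exact: me|move=> w; exact: expR_ge0|move=> w; rewrite addr_ge0|move=> w; rewrite mulr_ge0 ?expR_ge0|exact: ltW|move=> _; exact: ltW].
    rewrite -[X in (_ = _ + X)%E]mule1 -El -iZ//; try by [exact: me|move=> w; exact: expR_ge0|move=> w; rewrite addr_ge0|move=> w; rewrite mulr_ge0 ?expR_ge0|exact: ltW|move=> _; exact: ltW].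
    rewrite -EWE -iD//; try by [exact: me|move=> w; exact: expR_ge0|move=> w; rewrite addr_ge0|move=> w; rewrite mulr_ge0 ?expR_ge0|exact: ltW|move=> _; exact: ltW].
    apply: eq_integral => w _; congr EFin; rewrite /g.
    have -> : A w = expR (l w) * expR (k.+1%:R^-1 * u w).
      by rewrite -expRD; congr expR; rewrite /u; set q := _^-1; ring.
    by set a := k.+1%:R; set e := expR (_ * u w); ring.
  have G0 : (0 <= \int[P]_w (g k w)%:E)%E by apply: integral_ge0 => w _; rewrite lee_fin.
  have : (\int[P]_w (g k w)%:E + k.+1%:R%:E + 1 <= EW%:E + k.+1%:R%:E)%E.
    rewrite -E; apply: leeD => //; apply: leeD => //.
    by rewrite -[leLHS]mule1 lee_wpmul2l.
  move: G0; case: (\int[P]_w (g k w)%:E)%E => [r| |] //.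
  by rewrite -!EFinD !lee_fin => _; set a := k.+1%:R; lra.
have Eh : (\int[P]_w (h w)%:E <= (EW - 1)%:E)%E by exact: ae_fatou_le gh Eg.
have p0 : 0 < p - 1 by rewrite subr_gt0.
have pge0 : 0 <= p by lra.
have H0 : (0 <= \int[P]_w (h w)%:E)%E by apply: integral_ge0 => w _; rewrite lee_fin.
have Phi0 : (0 <= \int[P]_w (l w * expR (l w) - expR (l w) + 1)%:E)%E.
  by apply: integral_ge0 => w _; rewrite lee_fin.
(* The integrated form of a pointwise inequality between nonnegative functions: [p exp W] is added
   on the left and [p h] used on the right, so that no difference of possibly infinite integrals
   appears. *)
have key : ((p - 1)%:E * (\int[P]_w (l w * expR (l w) - expR (l w) + 1)%:E) + p%:E * EW%:E <=
    p%:E * (EW - 1)%:E + M%:E + (p - 1)%:E)%E.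
  apply: (@le_trans _ _ (p%:E * (\int[P]_w (h w)%:E) + (\int[P]_w (expR (p * W w))%:E) + (p - 1)%:E)%E); last first.
    by apply: leeD => //; apply: leeD => //; apply: lee_wpmul2l => //; rewrite lee_fin; lra.
  have mpW : measurable_fun setT (fun w => (expR (p * W w))%:E) by apply: mE; exact: measurable_funM.
  have mphi' : measurable_fun setT (fun w => (l w * expR (l w) - expR (l w) + 1)%:E) by exact/measurable_EFinP.
  have mh' : measurable_fun setT (fun w => (h w)%:E) by exact/measurable_EFinP.
  have pE : (0 <= p%:E)%E by rewrite lee_fin; lra.
  have p1E : (0 <= (p - 1)%:E)%E by rewrite lee_fin ltW.
  have mW' := mE _ mW.
  pose phi w := l w * expR (l w) - expR (l w) + 1.
  have mpp : measurable_fun setT (fun w => (p - 1) * phi w) by exact: measurable_funM.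
  have mpW' : measurable_fun setT (fun w => p * expR (W w)) by apply: measurable_funM => //; exact: me.
  have mph : measurable_fun setT (fun w => p * h w) by exact: measurable_funM.
  have meW : measurable_fun setT (fun w => expR (p * W w)) by apply: me; exact: measurable_funM.
  have mphW : measurable_fun setT (fun w => p * h w + expR (p * W w)) by exact: measurable_funD.
  have n1 w : 0 <= (p - 1) * phi w by apply: mulr_ge0; [exact: ltW|exact: phi0].
  have n2 w : 0 <= p * expR (W w) by rewrite mulr_ge0 ?expR_ge0.
  have n3 w : 0 <= p * h w by rewrite mulr_ge0.
  have n4 w : 0 <= expR (p * W w) by exact: expR_ge0.
  have n5 w : 0 <= p * h w + expR (p * W w) by rewrite addr_ge0.
  rewrite -EWE -[X in (_ <= _ + X)%E]icst -iZ//; try by [exact: me|move=> w; exact: expR_ge0|move=> w; rewrite addr_ge0|move=> w; rewrite mulr_ge0 ?expR_ge0|exact: ltW|move=> _; exact: ltW].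
  rewrite -iZ//; try by [exact: me|move=> w; exact: expR_ge0|move=> w; rewrite addr_ge0|move=> w; rewrite mulr_ge0 ?expR_ge0|exact: ltW|move=> _; exact: ltW].
  rewrite -iZ//; try by [exact: me|move=> w; exact: expR_ge0|move=> w; rewrite addr_ge0|move=> w; rewrite mulr_ge0 ?expR_ge0|exact: ltW|move=> _; exact: ltW].
  rewrite -iD//; try by [exact: me|move=> w; exact: expR_ge0|move=> w; rewrite addr_ge0|move=> w; rewrite mulr_ge0 ?expR_ge0|exact: ltW|move=> _; exact: ltW].
  rewrite -iD//; try by [exact: me|move=> w; exact: expR_ge0|move=> w; rewrite addr_ge0|move=> w; rewrite mulr_ge0 ?expR_ge0|exact: ltW|move=> _; exact: ltW].
  rewrite -iD//; try by [exact: me|move=> w; exact: expR_ge0|move=> w; rewrite addr_ge0|move=> w; rewrite mulr_ge0 ?expR_ge0|exact: ltW|move=> _; exact: ltW].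
  apply: ge0_le_integral => //.
  - by move=> w _; rewrite lee_fin; apply: addr_ge0; [exact: n1|exact: n2].
  - by apply/measurable_EFinP; exact: measurable_funD.
  - by apply/measurable_EFinP; exact: measurable_funD.
  (* The difference of the two sides is [exp l (exp y - 1 - y)] with [y = p W - l]. *)
  move=> w _; rewrite lee_fin /phi /h /u.
  have hE : expR (p * W w) = expR (l w) * expR (p * W w - l w) by rewrite -expRD; congr expR; ring.
  have := ler_wpM2l (expR_ge0 (l w)) (expR_ge1Dx (p * W w - l w)); rewrite -hE.
  by set a := expR (l w); set b := expR (W w); set c := expR (p * W w); lra.
move: key Phi0; case: (\int[P]_w (l w * expR (l w) - expR (l w) + 1)%:E)%E => [r| |] //.
  rewrite -!EFinM -!EFinD !lee_fin => key _; rewrite ler_pdivlMr// mulrC; lra.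
by rewrite gt0_muley ?lte_fin// -!EFinM -!EFinD.
Qed.

End entropy.

(** * Utility maximization *)

Section euclidean_projection.
Context (R : realType) (k m : nat).
Implicit Types (C : set 'cV[R]_k) (A : 'M[R]_(m, k)) (x : 'cV[R]_m) (u v : 'cV[R]_k).

Lemma enorm_eq0 n (u : 'cV[R]_n) : enorm u ^+ 2 <= 0 -> u = 0.
Proof.
move=> h; apply/matrixP => i j; rewrite (ord1 j) mxE; apply/eqP.
by rewrite -sqrf_eq0 eq_le sqr_ge0 andbT (le_trans (entry2_le u i)).
Qed.

(** If the images differed, the parallelogram law would make the midpoint strictly closer to [x]. *)
Lemma projection_unique C A x u v : convex_set C -> C u -> C v ->
  (forall y, C y -> enorm (x - A *m u) ^+ 2 <= enorm (x - A *m y) ^+ 2) ->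
  enorm (x - A *m v) ^+ 2 <= enorm (x - A *m u) ^+ 2 -> A *m v = A *m u.
Proof.
move=> cC Cu Cv min vu; apply/eqP; rewrite -subr_eq0; apply/eqP; apply: enorm_eq0.
have -> : A *m v - A *m u = (x - A *m u) - (x - A *m v) by rewrite opprB [RHS]addrC addrA subrK.
rewrite parallelogram.
have -> : (1 / 2) *: (x - A *m u) + (1 - 1 / 2) *: (x - A *m v) = x - A *m ((1 / 2) *: u + (1 - 1 / 2) *: v).
  rewrite mulmxDr -!scalemxAr !scalerBr addrACA -scalerDl -opprD.
  by rewrite (_ : 1 / 2 + _ = 1) ?scale1r//; field.
have h12 : 0 <= (1 / 2 : R) <= 1 by apply/andP; split; lra.
have := min _ (convex_comb cC h12 Cu Cv); lra.
Qed.

Lemma ler_enorm2 n (u : 'cV[R]_n) n' (v : 'cV[R]_n') : (enorm u ^+ 2 <= enorm v ^+ 2) = (enorm u <= enorm v).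
Proof. by rewrite ler_sqr// nnegrE enorm_ge0. Qed.

Lemma edist_min C A x u : C u ->
  (forall y, C y -> enorm (x - A *m u) ^+ 2 <= enorm (x - A *m y) ^+ 2) ->
  Defs.edist [set A *m c | c in C] x = enorm (x - A *m u).
Proof.
move=> Cu min; apply/eqP; rewrite eq_le; apply/andP; split.
  by apply: ge_inf; [exists 0 => _ [y _ <-]; exact: enorm_ge0|exists (A *m u) => //; exists u].
apply: lb_le_inf; first by exists (enorm (x - A *m u)), (A *m u) => //; exists u.
by move=> _ [_ [y Cy <-] <-]; rewrite -ler_enorm2; exact: min.
Qed.

(** Uniqueness of the nearest point identifies the chosen projection with the image of any minimizer
    in [C]. *)
Lemma eproj_min C A x u : convex_set C -> C u ->
  (forall y, C y -> enorm (x - A *m u) ^+ 2 <= enorm (x - A *m y) ^+ 2) ->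
  eproj [set A *m c | c in C] x = A *m u.
Proof.
move=> cC Cu min; rewrite /eproj; case: xgetP => [z _ [[v Cv <-] minv]|/(_ (A *m u))].
  by apply: projection_unique min _ => //; rewrite ler_enorm2; apply: minv; exists u.
by case; split; [exists u|move=> _ [y Cy <-]; rewrite -ler_enorm2; exact: min].
Qed.

(** The algebra behind the generator: with [D] the squared distance to the constraint set, half the
    variation of the exponent, minus the drift of the wealth and the driver, equals the gap. *)
Lemma quadratic_completion (a D : R) (h z t : 'cV[R]_m) : a != 0 ->
  enorm ((- a) *: h + a *: z) ^+ 2 / 2 - a * dotv h t - a * (a / 2 * D - dotv z t - (2 * a)^-1 * enorm t ^+ 2)
  = a ^+ 2 / 2 * (enorm (z + a^-1 *: t - h) ^+ 2 - D).
Proof.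
move=> a0; rewrite !enorm2 !(dotvDl, dotvDr, dotvZl, dotvZr, dotvNl, dotvNr).
rewrite (dotvC t z) (dotvC t h) (dotvC z h); field; exact: a0.
Qed.

Lemma dotv_abs_le (u v : 'cV[R]_m) : `|dotv u v| <= enorm u ^+ 2 + enorm v ^+ 2.
Proof.
have h1 := dotv_le u v; have h2 := dotv_le (- u) v.
have u0 := dotvv_ge0 u; have v0 := dotvv_ge0 v.
by rewrite !enorm2 ler_norml; move: h2; rewrite !dotvNl dotvNr opprK => h2; apply/andP; split; lra.
Qed.

End euclidean_projection.

Section paths.
Context d (Omega : measurableType d) (R : realType) (P : probability Omega R).
Context (T : R) (m : nat) (B : R -> Omega -> 'cV[R]_m).
Hypothesis Pc : measure_is_complete P.
Hypothesis BM : brownian_motion P T B.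
Hypothesis T0 : 0 < T.
Local Notation predictable := (predictable P T B).
Local Notation leb := (@lebesgue_measure R).
Local Notation RT := (measurableTypeR R).

Lemma integrable_path (X q : R -> Omega -> R) (c w_c : R) w : predictable X -> predictable q ->
  (forall t w, 0 <= q t w) -> 0 <= c -> (forall t, 0 <= t <= T -> `|X t w| <= c * q t w + w_c) ->
  (\int[leb]_(t in `[0%R, T]) (q t w)%:E < +oo)%E ->
  leb.-integrable `[0, T] (fun t => (X t w)%:E).
Proof.
move=> pX pq q0 c0 Xq qoo; have TT : 0 <= T <= T by rewrite lexx ltW.
have mX : measurable_fun (`[0, T] : set RT) (fun t => (X t w)%:E).
  by apply/measurable_EFinP; exact: (predictable_path Pc BM T0 w pX TT).
have mq : measurable_fun (`[0, T] : set RT) (fun t => (q t w)%:E).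
  by apply/measurable_EFinP; exact: (predictable_path Pc BM T0 w pq TT).
have iq : leb.-integrable `[0, T] (fun t => (q t w)%:E).
  apply/integrableP; split => //; under eq_integral do rewrite gee0_abs ?lee_fin//.
  exact: qoo.
have ic : leb.-integrable `[0, T] (EFin \o cst w_c).
  apply/integrableP; split; first by apply/measurable_EFinP; exact: measurable_cst.
  have -> : (\int[leb]_(x in `[0%R, T]) `|(EFin \o cst w_c) x| = \int[leb]_(x in `[0%R, T]) cst (`|w_c|%:E) x)%E by [].
  rewrite integral_cst; last exact: measurable_itv.
  rewrite [X in (_ * X)%E](_ : _ = T%:E); first by rewrite -EFinM ltry.
  transitivity (leb `[0%R, T]%classic); first by [].
  by rewrite lebesgue_measure_itv/= lte_fin T0 oppr0 adde0.
have ig : leb.-integrable `[0, T] (fun t => c%:E * (q t w)%:E + w_c%:E)%E.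
  by apply: integrableD => //; exact: integrableZl.
have le t : `[0%R, T]%classic t -> (`|(X t w)%:E| <= `|c%:E * (q t w)%:E + w_c%:E|)%E.
  rewrite /= in_itv/= => tT; rewrite lee_fin.
  exact: le_trans (Xq t tT) (ler_norm _).
have /integrableP[mg goo] := ig; apply/integrableP; split => //; apply: le_lt_trans goo.
by apply: ge0_le_integral => //; exact: measurableT_comp.
Qed.

Lemma sub_interval t : t <= T -> `[0, t] `<=` `[0, T]%classic.
Proof. by move=> tT s /=; rewrite !in_itv/= => /andP[-> /le_trans->]. Qed.

Lemma integrable_sub (f : R -> R) t : t <= T -> leb.-integrable `[0, T] (fun t => (f t)%:E) ->
  leb.-integrable `[0, t] (fun t => (f t)%:E).
Proof. by move=> tT; apply: integrableS => //; exact: sub_interval. Qed.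

End paths.

Lemma ae_conj d (Omega : measurableType d) (R : realType) (P : probability Omega R) (A A' : Omega -> Prop) :
  (\forall w \ae P, A w) -> (\forall w \ae P, A' w) -> \forall w \ae P, A w /\ A' w.
Proof. by apply: filterS2. Qed.

Lemma Rintegral_ge0_ae d (X : measurableType d) (R : realType) (mu : {measure set X -> \bar R})
    (D : set X) (f : X -> R) : measurable D -> measurable_fun D f ->
  {ae mu, forall x, D x -> 0 <= f x} -> 0 <= \int[mu]_(x in D) f x.
Proof.
move=> mD mf f0; rewrite /Rintegral; apply: fine_ge0.
rewrite (@ae_eq_integral _ _ _ mu D (fun x => (Num.max (f x) 0)%:E))//.
- by apply: integral_ge0 => x _; rewrite lee_fin le_max lexx orbT.
- exact/measurable_EFinP.
- by apply/measurable_EFinP; apply: measurable_maxr.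
- by apply: filterS f0 => x h Dx; rewrite max_l// h.
Qed.

(** Transfers tail bounds from the family in [admissible], whose members equal a multiple of
    [utility] only almost everywhere, to a measurable version. *)
Lemma integral_tail_ae d (Omega : measurableType d) (R : realType) (P : probability Omega R)
    (X X' : Omega -> R) (c : R) : measurable_fun setT X -> (\forall w \ae P, X w = X' w) ->
  (\int[P]_(w in [set w | (c <= `|X w|)%R]) `|X w|%:E <= \int[P]_(w in [set w | (c <= `|X' w|)%R]) `|X' w|%:E)%E.
Proof.
move=> mX XX'.
have tailE (V : Omega -> R) : (\int[P]_(w in [set w | (c <= `|V w|)%R]) `|V w|%:E =
    \int[P]_w (`|V w| * \1_[set w | (c <= `|V w|)%R] w)%:E)%E.
  rewrite integral_mkcond; apply: eq_integral => w _; rewrite patchE indicE.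
  by case: (w \in _); rewrite ?mulr1 ?mulr0.
have mnX : measurable_fun setT (fun w => `|X w|) by exact: measurableT_comp.
rewrite !tailE; apply: ge0_integral_ae_mono.
- apply: measurable_funM => //; apply: measurable_indic.
  by rewrite -[X in measurable X]setTI; apply: measurable_fun_le.
- by move=> w; rewrite indicE mulr_ge0.
- by move=> w; rewrite lee_fin indicE mulr_ge0.
- apply: filterS XX' => w Xw; rewrite lee_fin !indicE Xw.
  have -> : (w \in [set w | c <= `|X w|]) = (w \in [set w | c <= `|X' w|]); last by [].
  by apply/idP/idP; rewrite !inE/= Xw.
Qed.

Section utility.
Context (disp : measure_display) (Omega : measurableType disp) (R : realType) (P : probability Omega R).
Context (T : R) (d m : nat) (alpha : R) (B : R -> Omega -> 'cV[R]_m).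
Context (b : R -> Omega -> 'cV[R]_d) (sigma : R -> Omega -> 'M[R]_(d, m)) (C : set 'cV[R]_d).
Context (F : Omega -> R) (p : nat) (eps : R) (Y : R -> Omega -> R) (Z : R -> Omega -> 'cV[R]_m).
Hypothesis Pc : measure_is_complete P.
Hypothesis T0 : 0 < T.
Hypothesis alpha0 : 0 < alpha.
Hypothesis BM : brownian_motion P T B.
Hypothesis pb : mx_predictable P T B b.
Hypothesis psigma : mx_predictable P T B sigma.
Hypothesis usigma : forall t w, 0 <= t <= T -> sigma t w *m (sigma t w)^T \in unitmx.
Hypothesis btheta : bounded_process T (theta b sigma).
Hypothesis clC : closed C.
Hypothesis cC : convex_set C.
Hypothesis C0 : C 0.
Hypothesis p1 : (1 < p)%N.
Hypothesis hY : bsde_solution P T B F (generator alpha b sigma C) Y Z.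
Hypothesis clY : bsde_class P T (p%:R * alpha) eps Y Z.

Local Notation predictable := (predictable P T B).
Local Notation vpred := (mx_predictable P T B).
Local Notation adapted := (adapted P T B).
Local Notation stopping_time := (stopping_time P T B).
Local Notation leb := (@lebesgue_measure R).
Local Notation RT := (measurableTypeR R).
Local Notation is_stochastic_integral := (is_stochastic_integral P T B).
Local Notation th := (theta b sigma).
Local Notation f := (generator alpha b sigma C).
Local Notation IZ := (stochastic_integral P T B Z).
Local Notation target := (fun t w => Z t w + alpha^-1 *: th t w).
Local Notation square_integrable := (square_integrable_paths P T).

Lemma theta_predictable : vpred th.
Proof.
have pt := mx_predictable_tr psigma; apply: mx_predictable_mul => //.
apply: mx_predictable_mul => //; apply: mx_predictable_inv => //; exact: mx_predictable_mul.
Qed.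

Lemma Z_predictable : vpred Z. Proof. by have [[]] := hY. Qed.

Lemma Z_square_integrable : square_integrable Z. Proof. by have [] := hY. Qed.

Lemma target_predictable : vpred target.
Proof. by apply: mx_predictableD; [exact: Z_predictable|apply: mx_predictableZ; exact: theta_predictable]. Qed.

Lemma optimal_exists : exists2 q : R -> Omega -> 'cV[R]_d, mx_predictable P T B q &
  forall t w, 0 <= t <= T -> C (q t w) /\ forall y, C y ->
    enorm (target t w - (sigma t w)^T *m q t w) ^+ 2 <= enorm (target t w - (sigma t w)^T *m y) ^+ 2.
Proof.
have LA t w : 0 <= t <= T -> exists L, L *m (sigma t w)^T = 1%:M.
  (* The left inverse of [sigma^T], available since [sigma sigma^T] is invertible. *)
  move=> tT; exists (invmx (sigma t w *m (sigma t w)^T) *m sigma t w).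
  by rewrite -mulmxA mulVmx// usigma.
have [q pq hq] := predictable_projection (mx_predictable_tr psigma) target_predictable LA clC cC C0.
by exists q.
Qed.

Variable q : R -> Omega -> 'cV[R]_d.
Hypothesis pq : mx_predictable P T B q.
Hypothesis qmin : forall t w, 0 <= t <= T -> C (q t w) /\ forall y, C y ->
    enorm (target t w - (sigma t w)^T *m q t w) ^+ 2 <= enorm (target t w - (sigma t w)^T *m y) ^+ 2.

Definition opt t w := (sigma t w)^T *m q t w.

(** The generator along [Z] with the distance written as the norm to the selected projection, a form
    in which predictability is evident. *)
Definition driver t w := alpha / 2 * enorm (target t w - opt t w) ^+ 2
  - dotv (Z t w) (th t w) - (2 * alpha)^-1 * enorm (th t w) ^+ 2.

Definition gap (H : R -> Omega -> 'cV[R]_m) t w :=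
  alpha ^+ 2 / 2 * (enorm (target t w - H t w) ^+ 2 - enorm (target t w - opt t w) ^+ 2).

Lemma driverE t w : 0 <= t <= T -> f t w (Z t w) = driver t w.
Proof. by move=> tT; have [Cq mq] := qmin w tT; rewrite /generator (edist_min Cq mq). Qed.

Lemma opt_predictable : vpred opt.
Proof. by apply: mx_predictable_mul => //; exact: mx_predictable_tr. Qed.

Lemma driver_predictable : predictable driver.
Proof.
have pt := theta_predictable; have pZ := Z_predictable.
apply: (@eq_predictable _ _ _ _ _ _ _ (fun t w => alpha / 2 * enorm (target t w - opt t w) ^+ 2
  + (- 1) * dotv (Z t w) (th t w) + (- (2 * alpha)^-1) * enorm (th t w) ^+ 2)).
  by move=> t w _; rewrite /driver mulN1r mulNr.
apply: predictableD; first apply: predictableD.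
- apply: predictableM; first exact: predictable_cst.
  exact: predictable_enorm2 (mx_predictableB target_predictable opt_predictable).
- apply: predictableM; [exact: predictable_cst|exact: predictable_dotv].
- apply: predictableM; [exact: predictable_cst|exact: predictable_enorm2].
Qed.

Lemma driver_integrable : \forall w \ae P, leb.-integrable `[0, T] (fun t => (driver t w)%:E).
Proof.
have [_ _ _ + _] := hY; apply: filterS => w h; apply/integrableP; split.
  have TT : 0 <= T <= T by rewrite lexx ltW.
  by apply/measurable_EFinP; exact: (predictable_path Pc BM T0 w driver_predictable TT).
have -> : (\int[leb]_(t in `[0%R, T]) `|(driver t w)%:E| = \int[leb]_(t in `[0%R, T]) `|f t w (Z t w)|%:E)%E; last exact: h.
by apply: eq_integral => t; rewrite inE/= in_itv/= => tT; rewrite driverE.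
Qed.

(** The backward equation at [t] minus that at 0 is a forward equation; at time [T] it returns the
    terminal condition. *)
Lemma bsde_increment : \forall w \ae P, (forall t, 0 <= t <= T ->
  Y t w - Y 0 w = IZ t w - \int[leb]_(s in `[0, t]) driver s w) /\ Y T w = F w.
Proof.
have TT : 0 <= T <= T by rewrite lexx ltW.
have OT : 0 <= (0 : R) <= T by rewrite lexx ltW.
have I0 := stochastic_integral0 Pc BM T0 Z_predictable
  (stochastic_integralP Pc BM T0 Z_predictable Z_square_integrable).
have [_ _ _ _ eqY] := hY; move: I0 driver_integrable eqY; apply: filterS3 => w I0 di eqY.
have fE t : 0 <= t -> \int[leb]_(s in `[t, T]) f s w (Z s w) = \int[leb]_(s in `[t, T]) driver s w.
  move=> t0; apply: eq_Rintegral => s; rewrite inE/= in_itv/= => /andP[ts sT].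
  by rewrite driverE// sT (le_trans t0).
split=> [t tT|]; last by rewrite eqY// set_itv1 Rintegral_set1 subrr subr0 addr0.
have /andP[t0 tT'] := tT.
rewrite (eqY t tT) (eqY 0 OT) I0 !fE//.
have : \int[leb]_(s in `[0, T]) driver s w - \int[leb]_(s in `[0, t]) driver s w =
    \int[leb]_(s in `[t, T]) driver s w.
  rewrite (@Rintegral_itvB _ (fun s => driver s w) (BLeft 0) (BRight T) t)//.
  apply: Rintegral_itv_obnd_cbnd; apply: integrableS di => //.
  by move=> s /=; rewrite !in_itv/= => /andP[/ltW ts ->]; rewrite (le_trans t0 ts).
lra.
Qed.

Section strategy.
Variables (H : R -> Omega -> 'cV[R]_m) (I : R -> Omega -> R).
Hypothesis pH : vpred H.
Hypothesis sH : square_integrable H.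
Hypothesis hI : is_stochastic_integral H I.

(** Localizing this sum controls the integrand [G], which combines [H] and [Z]. *)
Let energy t w := enorm (H t w) ^+ 2 + enorm (Z t w) ^+ 2.
Let G t w := (- alpha) *: H t w + alpha *: Z t w.
Let drift t w := \int[leb]_(s in `[0, t]) dotv (H s w) (th s w).

Definition utility t w := expR (- alpha * (I t w + \int[leb]_(s in `[0, t]) dotv (H s w) (th s w))
  + alpha * (Y t w - Y 0 w)).

Lemma energy_predictable : predictable energy.
Proof. by apply: predictableD; apply: predictable_enorm2 => //; exact: Z_predictable. Qed.

Lemma energy_ge0 t w : 0 <= energy t w.
Proof. by rewrite addr_ge0// sqr_ge0. Qed.

Lemma energy_integrable : \forall w \ae P, (\int[leb]_(t in `[0%R, T]) (energy t w)%:E < +oo)%E.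
Proof.
have TT : 0 <= T <= T by rewrite lexx ltW.
move: sH Z_square_integrable; apply: filterS2 => w h1 h2.
have me (X : R -> Omega -> 'cV[R]_m) : vpred X -> measurable_fun (`[0, T] : set RT) (fun t => (enorm (X t w) ^+ 2)%:E).
  by move=> pX; apply/measurable_EFinP; exact: (predictable_path Pc BM T0 w (predictable_enorm2 pX) TT).
under eq_integral do rewrite EFinD.
rewrite ge0_integralD//; try by [move=> t _; rewrite lee_fin sqr_ge0|exact: me|apply: me; exact: Z_predictable].
exact: lte_add_pinfty.
Qed.

Lemma G_predictable : vpred G.
Proof. by apply: mx_predictableD; apply: mx_predictableZ => //; exact: Z_predictable. Qed.

Lemma drift_integrable : \forall w \ae P, leb.-integrable `[0, T] (fun t => (dotv (H t w) (th t w))%:E).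
Proof.
have [K hK] := btheta; apply: filterS energy_integrable => w.
apply: (@integrable_path _ _ _ _ _ _ _ Pc BM T0 (fun t w => dotv (H t w) (th t w)) energy 1 (K ^+ 2)).
- by apply: predictable_dotv => //; exact: theta_predictable.
- exact: energy_predictable.
- exact: energy_ge0.
- by [].
- move=> t tT; apply: le_trans (dotv_abs_le _ _) _; rewrite mul1r lerD//.
    by rewrite lerDl sqr_ge0.
  rewrite ler_sqr ?nnegrE ?enorm_ge0//; first exact: hK.
  exact: le_trans (enorm_ge0 _) (hK t w tT).
Qed.

Lemma G_le t w : enorm (G t w) ^+ 2 <= 2 * alpha ^+ 2 * energy t w.
Proof. by apply: le_trans (enorm2D_le _ _) _; rewrite !enormZ sqrrN /energy; lra. Qed.

Lemma G_integrable : \forall w \ae P, leb.-integrable `[0, T] (fun t => (enorm (G t w) ^+ 2)%:E).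
Proof.
apply: filterS energy_integrable => w.
apply: (@integrable_path _ _ _ _ _ _ _ Pc BM T0 (fun t w => enorm (G t w) ^+ 2) energy (2 * alpha ^+ 2) 0).
- exact: predictable_enorm2 G_predictable.
- exact: energy_predictable.
- exact: energy_ge0.
- by rewrite mulr_ge0// sqr_ge0.
- by move=> t tT; rewrite addr0 ger0_norm ?sqr_ge0//; exact: G_le.
Qed.

(** The forward equation replaces the increment of [Y] by the integral of [Z] and the driver. By
    [quadratic_completion] under the time integral, what remains is half the variation of [G] and
    the gap. *)
Lemma utilityE : \forall w \ae P, forall t, 0 <= t <= T ->
  utility t w = expR ((- alpha * I t w + alpha * IZ t w) - (\int[leb]_(s in `[0, t]) enorm (G s w) ^+ 2) / 2
    + \int[leb]_(s in `[0, t]) gap H s w).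
Proof.
move: bsde_increment (ae_conj driver_integrable (ae_conj drift_integrable G_integrable)).
apply: filterS2 => w [Yt _] [di [dri Gi]] t tT; congr expR.
have /andP[t0 tT'] := tT; rewrite Yt//.
have mt : measurable (`[0, t] : set RT) by exact: measurable_itv.
have i1 := integrable_sub tT' di; have i2 := integrable_sub tT' dri; have i3 := integrable_sub tT' Gi.
have -> : \int[leb]_(s in `[0, t]) gap H s w =
    2^-1 * (\int[leb]_(s in `[0, t]) enorm (G s w) ^+ 2) - alpha * drift t w
      - alpha * \int[leb]_(s in `[0, t]) driver s w.
  have j1 : leb.-integrable `[0, t] (fun s => (alpha * driver s w)%:E) by exact: (integrableZl mt alpha i1).
  have j2 : leb.-integrable `[0, t] (fun s => (alpha * dotv (H s w) (th s w))%:E) by exact: (integrableZl mt alpha i2).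
  have j3 : leb.-integrable `[0, t] (fun s => (2^-1 * enorm (G s w) ^+ 2)%:E) by exact: (integrableZl mt 2^-1 i3).
  have j4 : leb.-integrable `[0, t] (fun s => (2^-1 * enorm (G s w) ^+ 2 - alpha * dotv (H s w) (th s w))%:E).
    exact: (integrableB mt j3 j2).
  rewrite -!RintegralZl// -(RintegralB mt j3 j2) -(RintegralB mt j4 j1).
  apply: eq_Rintegral => s; rewrite inE/= in_itv/= => /andP[s0 st].
  rewrite /gap -quadratic_completion ?gt_eqF// /driver /G; ring.
rewrite /drift; ring.
Qed.

Lemma Y_adapted : adapted Y.
Proof. by apply: predictable_adapted; have [[]] := hY. Qed.

Lemma IZ_integral : is_stochastic_integral Z IZ.
Proof. exact: (stochastic_integralP Pc BM T0 Z_predictable Z_square_integrable). Qed.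

Lemma utility_adapted : adapted utility.
Proof.
move=> t tT; have /andP[t0 _] := tT; have [_ aI _] := hI.
have aD : adapted drift by apply: adapted_integral; apply: predictable_dotv => //; exact: theta_predictable.
have O0 : 0 <= (0 : R) <= T by rewrite lexx ltW.
have mY0 := measurable_wrt_FtS t0 (Y_adapted O0).
apply/measurable_wrtP; apply: measurableT_comp => //.
apply: measurable_funD; apply: measurable_funM => //.
  by apply: measurable_funD; apply/measurable_wrtP; [exact: aI|exact: aD].
by apply: measurable_funB; apply/measurable_wrtP; [exact: Y_adapted|exact: mY0].
Qed.

Lemma utility_continuous : continuous_paths P T utility.
Proof.
have [cI _ _] := hI; have [_ cY _ _ _] := hY.
move: cI (ae_conj cY drift_integrable); rewrite /continuous_paths; apply: filterS2 => w {}cI [{}cY di].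
have cc (g : R -> R) (a : R) : {within `[0, T], continuous g} -> {within `[0, T], continuous (fun t => a * g t)}.
  by move=> cg; apply: within_continuousM => //; exact: within_continuous_cst.
apply: within_continuous_expR; apply: within_continuousD; apply: cc; apply: within_continuousD => //.
  exact: (parameterized_integral_continuous (ltW T0) di).
by apply: within_continuousN; exact: within_continuous_cst.
Qed.

(** The stochastic exponential of the integral of [G], for the version that
    [stochastic_integral_lincomb] supplies. *)
Let density t w := expR ((- alpha * I t w + alpha * IZ t w) - (\int[leb]_(s in `[0, t]) enorm (G s w) ^+ 2) / 2).

Lemma density_stopped_measurable tau : stopping_time tau -> measurable_fun setT (fun w => density (tau w) w).
Proof.
have [cI aI _] := hI; have [cIZ aIZ _] := IZ_integral.
move=> st; apply: (measurable_stopped Pc BM T0 st).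
  move=> t tT; apply/measurable_wrtP; apply: measurableT_comp => //.
  have aQ : adapted (fun t w => \int[leb]_(s in `[0, t]) enorm (G s w) ^+ 2).
    by apply: adapted_integral; exact: predictable_enorm2 G_predictable.
  apply: measurable_funB; last by apply: measurable_funM => //; apply/measurable_wrtP; exact: aQ.
  by apply: measurable_funD; apply: measurable_funM => //; apply/measurable_wrtP; [exact: aI|exact: aIZ].
move: cI (ae_conj cIZ G_integrable); rewrite /continuous_paths; apply: filterS2 => w {}cI [{}cIZ gi].
have cc (g : R -> R) (a : R) : {within `[0, T], continuous g} -> {within `[0, T], continuous (fun t => a * g t)}.
  by move=> cg; apply: within_continuousM => //; exact: within_continuous_cst.
apply: within_continuous_expR; apply: within_continuousD.
  by apply: within_continuousD; exact: cc.
apply: within_continuousN; apply: within_continuousM; last exact: within_continuous_cst.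
exact: (parameterized_integral_continuous (ltW T0) gi).
Qed.

Lemma integral_density tau (n : R) : stopping_time tau -> 0 <= n ->
  (\forall w \ae P, (\int[leb]_(t in `[0%R, tau w]) (energy t w)%:E <= n%:E)%E) ->
  (\int[P]_w (density (tau w) w)%:E = 1)%E.
Proof.
move=> st n0 hn.
have hG := stochastic_integral_lincomb Pc BM T0 (- alpha) alpha pH Z_predictable hI IZ_integral.
apply: (exp_stochastic_integral Pc BM T0 (n := 2 * alpha ^+ 2 * n) G_predictable hG st).
  by rewrite mulr_ge0// mulr_ge0// sqr_ge0.
apply: filterS hn => w hw.
have tT : 0 <= tau w <= T by have [h _] := st; exact: h.
have mG : measurable_fun (`[0, tau w] : set RT) (fun t => (enorm (G t w) ^+ 2)%:E).
  by apply/measurable_EFinP; exact: (predictable_path Pc BM T0 w (predictable_enorm2 G_predictable) tT).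
have mE : measurable_fun (`[0, tau w] : set RT) (fun t => (energy t w)%:E).
  by apply/measurable_EFinP; exact: (predictable_path Pc BM T0 w energy_predictable tT).
have a0 : 0 <= 2 * alpha ^+ 2 by rewrite mulr_ge0// sqr_ge0.
apply: (@le_trans _ _ (\int[leb]_(t in `[0%R, tau w]) ((2 * alpha ^+ 2)%:E * (energy t w)%:E))%E).
  apply: ge0_le_integral => //.
  - by move=> t _; rewrite lee_fin sqr_ge0.
  - exact: measurable_funeM.
  - by move=> t _; rewrite -EFinM lee_fin; exact: G_le.
rewrite ge0_integralZl//; last by move=> t _; rewrite lee_fin; exact: energy_ge0.
by rewrite [leRHS]EFinM lee_wpmul2l.
Qed.

Lemma gap_predictable : predictable (gap H).
Proof.
apply: predictableM; first exact: predictable_cst.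
apply: (@eq_predictable _ _ _ _ _ _ _ (fun t w => enorm (target t w - H t w) ^+ 2
  + (-1) * enorm (target t w - opt t w) ^+ 2)); first by move=> t w _; rewrite mulN1r.
apply: predictableD; first exact: predictable_enorm2 (mx_predictableB target_predictable pH).
apply: predictableM; first exact: predictable_cst.
exact: predictable_enorm2 (mx_predictableB target_predictable opt_predictable).
Qed.

Lemma integral_utility_ge tau (n : R) : stopping_time tau -> 0 <= n ->
  (\forall w \ae P, (\int[leb]_(t in `[0%R, tau w]) (energy t w)%:E <= n%:E)%E) ->
  (\forall w \ae P, {ae leb, forall t, `[0%R, T]%classic t -> 0 <= gap H t w}) ->
  (1 <= \int[P]_w (utility (tau w) w)%:E)%E.
Proof.
move=> st n0 hn hgap; rewrite -(integral_density st n0 hn).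
apply: (ge0_integral_ae_mono (density_stopped_measurable st)).
- by move=> w; exact: expR_ge0.
- by move=> w; rewrite lee_fin expR_ge0.
move: utilityE hgap; apply: filterS2 => w uE gw.
have tT : 0 <= tau w <= T by have [h _] := st; exact: h.
rewrite lee_fin uE// ler_expR lerDl.
apply: Rintegral_ge0_ae; first exact: measurable_itv.
  exact: (predictable_path Pc BM T0 w gap_predictable tT).
have [N [mN N0 sub]] := gw; exists N; split => //; apply: subset_trans sub => t /= h1 h2; apply: h1 => ht.
by apply: h2; apply: sub_interval ht; case/andP: tT.
Qed.

Lemma integral_utility_eq tau (n : R) : stopping_time tau -> 0 <= n ->
  (\forall w \ae P, (\int[leb]_(t in `[0%R, tau w]) (energy t w)%:E <= n%:E)%E) ->
  (forall t w, 0 <= t <= T -> gap H t w = 0) ->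
  (\int[P]_w (utility (tau w) w)%:E = 1)%E.
Proof.
move=> st n0 hn hgap; rewrite -(integral_density st n0 hn).
apply: ae_eq_integral => //.
- by apply/measurable_EFinP; exact: (measurable_stopped Pc BM T0 st utility_adapted utility_continuous).
- by apply/measurable_EFinP; exact: density_stopped_measurable.
apply: filterS utilityE => w uE _.
have tT : 0 <= tau w <= T by have [h _] := st; exact: h.
rewrite uE// (_ : \int[leb]_(s in _) gap H s w = 0) ?addr0//.
rewrite /Rintegral integral0_eq// => s; rewrite /= in_itv/= => /andP[s0 st'].
by rewrite hgap// s0 (le_trans st')//; case/andP: tT.
Qed.

End strategy.

Lemma utility_gt0 H I t w : 0 < utility H I t w. Proof. exact: expR_gt0. Qed.

Lemma utility_stopped_measurable H I tau : vpred H -> square_integrable H -> is_stochastic_integral H I ->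
  stopping_time tau -> measurable_fun setT (fun w => utility H I (tau w) w).
Proof.
move=> pH sH hI st.
exact: (measurable_stopped Pc BM T0 st (utility_adapted pH hI) (utility_continuous pH sH hI)).
Qed.

Lemma stopping_time_cst t : 0 <= t <= T -> stopping_time (fun=> t).
Proof.
move=> tT; split => // s sT; have [ts|st] := leP t s.
  by rewrite (_ : [set _ | _] = setT); [exact: g_sigma_algebraT|apply/seteqP; split].
by rewrite (_ : [set _ | _] = set0); [exact: sigma_algebra0|apply/seteqP; split].
Qed.

Lemma energy_localization H I : vpred H -> square_integrable H -> is_stochastic_integral H I ->
  exists tau : nat -> Omega -> R, [/\ forall n, stopping_time (tau n),
    forall n, \forall w \ae P, (\int[leb]_(t in `[0%R, tau n w]) (enorm (H t w) ^+ 2 + enorm (Z t w) ^+ 2)%:E <= n%:R%:E)%E &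
    \forall w \ae P, exists K, forall n, (K <= n)%N -> tau n w = T].
Proof.
move=> pH sH hI.
have [tau st h] := localization Pc BM T0 (energy_predictable pH) (@energy_ge0 H) (energy_integrable pH sH).
exists tau; split => //; first by move=> n; apply: filterS h => w [/(_ n)].
by apply: filterS h => w [].
Qed.

(** The factor [r0] stands for the initial value [exp (- alpha (x - Y 0))], since admissibility
    speaks of [utility] multiplied by it. *)
Lemma utility_ui_cvg H I (r0 : R) : vpred H -> square_integrable H -> is_stochastic_integral H I -> 0 <= r0 ->
  (forall e, 0 < e -> exists c : R, forall tau, stopping_time tau ->
    (\int[P]_(w in [set w | (c <= `|r0 * utility H I (tau w) w|)%R]) `|r0 * utility H I (tau w) w|%:E <= e%:E)%E) ->
  forall tau : nat -> Omega -> R, (forall n, stopping_time (tau n)) ->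
    (\forall w \ae P, exists K, forall n, (K <= n)%N -> tau n w = T) ->
  (fun n => \int[P]_w (r0 * utility H I (tau n w) w)%:E)%E @ \oo --> (\int[P]_w (r0 * utility H I T w)%:E)%E.
Proof.
move=> pH sH hI r0ge ui tau st hT; have TT : 0 <= T <= T by rewrite lexx ltW.
apply: (@ui_cvg _ _ _ P (fun n w => r0 * utility H I (tau n w) w) (fun w => r0 * utility H I T w)).
- by move=> n; apply: measurable_funM => //; exact: utility_stopped_measurable.
- by apply: measurable_funM => //; exact: (utility_stopped_measurable pH sH hI (stopping_time_cst TT)).
- by move=> n w; rewrite mulr_ge0// expR_ge0.
- by move=> w; rewrite mulr_ge0// expR_ge0.
- apply: filterS hT => w [K hK]; apply: cvg_near_cst; exists K => // n /= /hK h.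
  by rewrite h.
- by move=> e /ui[c hc]; exists c => n; exact: hc.
Qed.

Lemma utility_terminal_ge H I (r0 : R) : vpred H -> square_integrable H -> is_stochastic_integral H I -> 0 < r0 ->
  (\forall w \ae P, {ae leb, forall t, `[0%R, T]%classic t -> 0 <= gap H t w}) ->
  (forall e, 0 < e -> exists c : R, forall tau, stopping_time tau ->
    (\int[P]_(w in [set w | (c <= `|r0 * utility H I (tau w) w|)%R]) `|r0 * utility H I (tau w) w|%:E <= e%:E)%E) ->
  (1 <= \int[P]_w (utility H I T w)%:E)%E.
Proof.
move=> pH sH hI r0gt hgap ui; have TT : 0 <= T <= T by rewrite lexx ltW.
have [tau [st en hT]] := energy_localization pH sH hI.
have cv := utility_ui_cvg pH sH hI (ltW r0gt) ui st hT.
have mu tau' : stopping_time tau' -> measurable_fun setT (fun w => (utility H I (tau' w) w)%:E).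
  by move=> st'; apply/measurable_EFinP; exact: utility_stopped_measurable.
have r0E : (0 <= r0%:E)%E by rewrite lee_fin ltW.
have fac tau' : stopping_time tau' -> (\int[P]_w (r0 * utility H I (tau' w) w)%:E =
    r0%:E * \int[P]_w (utility H I (tau' w) w)%:E)%E.
  move=> st'; rewrite -ge0_integralZl//; first exact: mu.
  by move=> w _; rewrite lee_fin ltW// utility_gt0.
have : (r0%:E * 1 <= \int[P]_w (r0 * utility H I T w)%:E)%E.
  rewrite -(cvg_lim _ cv)//; apply: lime_ge; first by apply/cvg_ex; eexists; exact: cv.
  apply: nearW => n; rewrite fac//; apply: lee_wpmul2l => //.
  exact: (integral_utility_ge pH sH hI (st n) (ler0n _ n) (en n) hgap).
rewrite (fac (fun=> T) (stopping_time_cst TT)); apply: contraTT; rewrite -!ltNge.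
by rewrite lte_pmul2l.
Qed.

(** As 0 is a competitor, [opt] is at most as far from the target as 0 is. Hence
    [|opt|^2 <= 4 |target|^2], which gives the factor 8 on [Z] and on [theta / alpha]. *)
Lemma opt_square_integrable : square_integrable opt.
Proof.
have [K hK] := btheta; have ai0 : 0 < alpha^-1 by rewrite invr_gt0.
apply: filterS Z_square_integrable => w hZ.
have : leb.-integrable `[0, T] (fun t => (enorm (opt t w) ^+ 2)%:E).
  apply: (@integrable_path _ _ _ _ _ _ _ Pc BM T0 (fun t w => enorm (opt t w) ^+ 2)
    (fun t w => enorm (Z t w) ^+ 2) 8 (8 * (alpha^-1 ^+ 2 * K ^+ 2))) => //.
  - exact: predictable_enorm2 opt_predictable.
  - exact: predictable_enorm2 Z_predictable.
  - by move=> t w'; exact: sqr_ge0.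
  - move=> t tT; rewrite ger0_norm ?sqr_ge0//.
    have [Cq /(_ 0 C0)] := qmin w tT; rewrite mulmx0 subr0 => h1.
    have h2 := enorm2D_le (target t w) (- (target t w - opt t w)).
    rewrite enormN opprB addrC subrK in h2.
    have h3 := enorm2D_le (Z t w) (alpha^-1 *: th t w); rewrite enormZ in h3.
    have h4 : enorm (th t w) ^+ 2 <= K ^+ 2.
      by rewrite ler_sqr ?nnegrE ?enorm_ge0//; [exact: hK|exact: le_trans (enorm_ge0 _) (hK t w tT)].
    have h5 := ler_wpM2l (sqr_ge0 alpha^-1) h4.
    rewrite -/(opt t w) in h1; move: h1 h2 h3 h5.
    move: (enorm (opt t w) ^+ 2) (enorm (target t w) ^+ 2) (enorm (Z t w) ^+ 2) => a x z.
    move: (enorm (target t w - opt t w) ^+ 2) (alpha^-1 ^+ 2 * _) (alpha^-1 ^+ 2 * _) => y u v; lra.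
move=> /integrableP[_]; under eq_integral do rewrite gee0_abs ?lee_fin ?sqr_ge0//.
exact.
Qed.

Local Notation IO := (stochastic_integral P T B opt).

Lemma IO_integral : is_stochastic_integral opt IO.
Proof. exact: (stochastic_integralP Pc BM T0 opt_predictable opt_square_integrable). Qed.

(** The stopped value of [Y] is below its supremum over time, and [Y 0] is a constant. The integrand
    [g] contains a supremum over uncountably many times, so the comparison goes through
    [ge0_integral_ae_mono]. *)
Lemma class_bound : exists M : R, forall tau, stopping_time tau ->
  (\int[P]_w (expR (p%:R * (alpha * (Y (tau w) w - Y 0 w))))%:E <= M%:E)%E.
Proof.
have [y0 hy0] := adapted_time0_cst BM T0 Y_adapted.
pose g w := ((expR (p%:R * alpha * sup [set Num.max (Y t w) 0 | t in `[0%R, T]]))%:E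
      + (expR (eps * sup [set Num.max (- Y t w) 0 | t in `[0%R, T]]))%:E
      + \int[leb]_(s in `[0%R, T]) (enorm (Z s w) ^+ 2)%:E)%E.
have g0 w : (0 <= g w)%E.
  by apply: adde_ge0; [rewrite -EFinD lee_fin addr_ge0// expR_ge0|apply: integral_ge0 => t _; rewrite lee_fin sqr_ge0].
have goo : (\int[P]_w g w < +oo)%E by exact: clY.
have gfin : (\int[P]_w g w = (fine (\int[P]_w g w))%:E)%E.
  by rewrite fineK// ge0_fin_numE//; apply: integral_ge0 => w _; exact: g0.
have a0 : 0 <= p%:R * alpha by rewrite mulr_ge0// ltW.
have [_ cY _ _ _] := hY.
exists (expR (- (p%:R * alpha * y0)) * fine (\int[P]_w g w)%E) => tau st.
have mY : measurable_fun setT (fun w => Y (tau w) w).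
  exact: (measurable_stopped Pc BM T0 st Y_adapted cY).
have me : measurable_fun setT (fun w => expR (p%:R * alpha * Y (tau w) w)).
  by apply: measurableT_comp => //; exact: measurable_funM.
have O0 : 0 <= (0 : R) <= T by rewrite lexx ltW.
rewrite (@ae_eq_integral _ _ _ P setT (fun w => ((expR (- (p%:R * alpha * y0)))%:E * (expR (p%:R * alpha * Y (tau w) w))%:E)%E))//; first last.
- apply: filterS hy0 => w -> _; rewrite -EFinM -expRD; congr ((expR _)%:E); ring.
- by apply: measurable_funeM; exact/measurable_EFinP.
- apply/measurable_EFinP; apply: measurableT_comp => //; apply: measurable_funM => //; apply: measurable_funM => //.
  by apply: measurable_funB => //; exact: (adapted_measurable Pc BM Y_adapted O0).
rewrite ge0_integralZl//; try by [exact/measurable_EFinP|move=> w _; rewrite lee_fin expR_ge0|rewrite lee_fin expR_ge0].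
rewrite EFinM -gfin; apply: lee_wpmul2l; first by rewrite lee_fin expR_ge0.
apply: ge0_integral_ae_mono => //.
apply: filterS cY => w cw; have tT : 0 <= tau w <= T by have [h _] := st; exact: h.
apply: (@le_trans _ _ (expR (p%:R * alpha * sup [set Num.max (Y t w) 0 | t in `[0%R, T]]))%:E).
  rewrite lee_fin ler_expR ler_wpM2l//; apply: (@le_trans _ _ (Num.max (Y (tau w) w) 0)).
    by rewrite le_max lexx.
  apply: ub_le_sup; last by exists (tau w) => //=; rewrite in_itv.
  have [x _ hx] := EVT_max (ltW T0) cw.
  by exists (Num.max (Y x w) 0) => _ [t tT' <-]; rewrite ge_max !le_max lexx orbT andbT hx.
rewrite /g -addeA leeDl//; apply: adde_ge0; first by rewrite lee_fin expR_ge0.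
by apply: integral_ge0 => t _; rewrite lee_fin sqr_ge0.
Qed.

Lemma gap_opt t w : gap opt t w = 0. Proof. by rewrite /gap subrr mulr0. Qed.

Lemma scaled_opt (l : R) : 0 <= l <= 1 -> exists H I,
  [/\ vpred H, square_integrable H, is_stochastic_integral H I,
      forall t w, H t w = l *: opt t w &
      (forall t w, 0 <= t <= T -> 0 <= gap H t w) /\
      \forall w \ae P, forall t, 0 <= t <= T -> utility H I t w =
        expR (l * ln (utility opt IO t w) + (1 - l) * (alpha * (Y t w - Y 0 w)))].
Proof.
move=> l01; have /andP[l0 l1] := l01.
(* The multiple 0 of [opt] is only there to fit a combination of two integrands. *)
have hI := stochastic_integral_lincomb Pc BM T0 l 0 opt_predictable opt_predictable IO_integral IO_integral.
have HE t w : l *: opt t w + 0 *: opt t w = l *: opt t w by rewrite scale0r addr0.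
exists (fun t w => l *: opt t w + 0 *: opt t w), (fun t w => l * IO t w + 0 * IO t w).
have pH : vpred (fun t w => l *: opt t w + 0 *: opt t w).
  by apply: mx_predictableD; apply: mx_predictableZ; exact: opt_predictable.
split => //; last split.
- apply: filterS opt_square_integrable => w; apply: le_lt_trans.
  have TT : 0 <= T <= T by rewrite lexx ltW.
  have me (X : R -> Omega -> 'cV[R]_m) : vpred X -> measurable_fun (`[0, T] : set RT) (fun t => (enorm (X t w) ^+ 2)%:E).
    by move=> pX; apply/measurable_EFinP; exact: (predictable_path Pc BM T0 w (predictable_enorm2 pX) TT).
  apply: ge0_le_integral => //.
  + by move=> t _; rewrite lee_fin sqr_ge0.
  + exact: (me _ pH).
  + exact: me opt_predictable.
  + move=> t _; rewrite lee_fin HE enormZ ler_piMl ?sqr_ge0//.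
    by rewrite expr2 mulr_ile1.
- move=> t w tT; rewrite /gap HE mulr_ge0//; first by rewrite divr_ge0 ?sqr_ge0.
  have [Cq h] := qmin w tT; rewrite subr_ge0.
  have := h _ (convex_comb cC l01 Cq C0); rewrite scaler0 addr0 -scalemxAr; exact.
apply: filterS (drift_integrable opt_predictable opt_square_integrable) => w di t tT.
have /andP[_ tT'] := tT; rewrite /utility expRK; congr expR.
have -> : \int[leb]_(s in `[0, t]) dotv (l *: opt s w + 0 *: opt s w) (th s w) =
    l * \int[leb]_(s in `[0, t]) dotv (opt s w) (th s w).
  rewrite -(RintegralZl _ _ (integrable_sub tT' di)); last exact: measurable_itv.
  by apply: eq_Rintegral => s _; rewrite HE dotvZl.
ring.
Qed.

(** [entropy_bound] is applied at [tau] stopped further at a localizing time, with [u] and its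
    scaled versions there. The constant does not depend on the localization, and Fatou removes it
    because the entropy integrand is nonnegative. *)
Lemma entropy_stopped : exists2 M : R, 0 <= M & forall tau, stopping_time tau ->
  (\int[P]_w (ln (utility opt IO (tau w) w) * utility opt IO (tau w) w - utility opt IO (tau w) w + 1)%:E <= M%:E)%E.
Proof.
have [M hM] := class_bound.
have pr1 : 1 < p%:R :> R by rewrite ltr1n.
have M0 : 0 <= M.
  have TT : 0 <= T <= T by rewrite lexx ltW.
  rewrite -lee_fin; apply: le_trans (hM _ (stopping_time_cst TT)).
  by apply: integral_ge0 => w _; rewrite lee_fin expR_ge0.
exists (M / (p%:R - 1)); first by rewrite divr_ge0// subr_ge0 ltW.
move=> tau st; have [tn [stn en hT]] := energy_localization opt_predictable opt_square_integrable IO_integral.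
pose sn n w := Num.min (tau w) (tn n w).
have stsn n : stopping_time (sn n) by exact: stopping_time_min.
pose u n w := utility opt IO (sn n w) w.
pose phi x : R := ln x * x - x + 1.
have mphi (v : Omega -> R) : measurable_fun setT v -> measurable_fun setT (fun w => phi (v w)).
  move=> mv; apply: measurable_funD => //; apply: measurable_funB => //; apply: measurable_funM => //.
  exact: measurableT_comp.
have phi0 x : 0 < x -> 0 <= phi x.
  move=> x0; have h := expR_ge1Dx (- ln x); rewrite expRN lnK// in h.
  by have := ler_wpM2l (ltW x0) h; rewrite divff ?gt_eqF// mulrDr mulr1 mulrN (mulrC x) /phi; lra.
have mu tau' : stopping_time tau' -> measurable_fun setT (fun w => utility opt IO (tau' w) w).
  by move=> st'; exact: (utility_stopped_measurable opt_predictable opt_square_integrable IO_integral st').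
have esn n : \forall w \ae P, (\int[leb]_(t in `[0%R, sn n w]) (enorm (opt t w) ^+ 2 + enorm (Z t w) ^+ 2)%:E <= n%:R%:E)%E.
  apply: filterS (en n) => w; apply: le_trans.
  have tT : 0 <= tn n w <= T by have [h _] := stn n; exact: h.
  apply: ge0_subset_integral => //.
  - by apply/measurable_EFinP; exact: (predictable_path Pc BM T0 w (energy_predictable opt_predictable) tT).
  - by move=> t _; rewrite lee_fin addr_ge0// sqr_ge0.
  - by apply: sub_interval; rewrite ge_min lexx orbT.
have bound n : (\int[P]_w (phi (u n w))%:E <= (M / (p%:R - 1))%:E)%E.
  have O0 : 0 <= (0 : R) <= T by rewrite lexx ltW.
  have [_ cY _ _ _] := hY.
  have mW : measurable_fun setT (fun w => alpha * (Y (sn n w) w - Y 0 w)).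
    apply: measurable_funM => //; apply: measurable_funB.
      exact: (measurable_stopped Pc BM T0 (stsn n) Y_adapted cY).
    exact: (adapted_measurable Pc BM Y_adapted O0).
  have ml : measurable_fun setT (fun w => ln (u n w)).
    by apply: measurableT_comp => //; exact: mu (stsn n).
  have ue w : expR (ln (u n w)) = u n w by rewrite lnK// posrE utility_gt0.
  have := @entropy_bound _ _ _ P (fun w => ln (u n w)) (fun w => alpha * (Y (sn n w) w - Y 0 w)) p%:R M ml mW pr1.
  under eq_integral do rewrite ue; under [X in _ -> _ -> _ -> (X <= _)%E]eq_integral do rewrite ue.
  apply.
  - apply: (integral_utility_eq opt_predictable opt_square_integrable IO_integral (stsn n) (ler0n _ n) (esn n)).
    by move=> t w _; exact: gap_opt.
  (* The strategy scaled by [1 - r] has utility [u^(1-r) exp (r W)], and its gap is nonnegative. *)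
  - move=> r /andP[r0 r1]; have l01 : 0 <= 1 - r <= 1 by apply/andP; split; lra.
    have [H [I [pH sH hI HE [gH uE]]]] := scaled_opt l01.
    have := @integral_utility_ge H I pH sH hI (sn n) n%:R (stsn n) (ler0n _ n).
    rewrite (@ae_eq_integral _ _ _ P setT (fun w => (expR ((1 - r) * ln (u n w) + r * (alpha * (Y (sn n w) w - Y 0 w))))%:E))//; first last.
    + apply: filterS uE => w uE _; congr EFin; rewrite uE; last by have [h _] := stsn n; exact: h.
      by rewrite subKr.
    + by apply/measurable_EFinP; apply: measurableT_comp => //; apply: measurable_funD; exact: measurable_funM.
    + by apply/measurable_EFinP; exact: (utility_stopped_measurable pH sH hI (stsn n)).
    apply; last by apply: aeW => w; apply: aeW => t; rewrite /= in_itv/=; exact: gH.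
    (* Scaling by at most 1 decreases the energy, so the same times localize the scaled
       strategies. *)
    apply: filterS (esn n) => w; apply: le_trans.
    have tT : 0 <= sn n w <= T by have [h _] := stsn n; exact: h.
    apply: ge0_le_integral => //.
    + by move=> t _; rewrite lee_fin addr_ge0// sqr_ge0.
    + by apply/measurable_EFinP; exact: (predictable_path Pc BM T0 w (energy_predictable pH) tT).
    + by apply/measurable_EFinP; exact: (predictable_path Pc BM T0 w (energy_predictable opt_predictable) tT).
    + move=> t _; rewrite lee_fin lerD2r HE enormZ ler_piMl ?sqr_ge0//.
      by have /andP[? ?] := l01; rewrite expr2 mulr_ile1.
  - exact: hM (stsn n).
apply: (@ae_fatou_le _ _ _ P (fun n w => phi (u n w)) (fun w => phi (utility opt IO (tau w) w))).
- by move=> n; apply: mphi; exact: mu.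
- by apply: mphi; exact: mu.
- by move=> n w; apply: phi0; exact: utility_gt0.
- by move=> w; apply: phi0; exact: utility_gt0.
- apply: filterS hT => w [K hK]; apply: cvg_near_cst; exists K => // n /= /hK h.
  rewrite /u /sn h (_ : Num.min (tau w) T = tau w)//; apply/min_idPl.
  by have [/(_ w) /andP[]] := st.
- exact: bound.
Qed.

Lemma optimal_ui (r0 e : R) : 0 < r0 -> 0 < e -> exists c : R, forall tau X, stopping_time tau ->
  (\forall w \ae P, X w = r0 * utility opt IO (tau w) w) ->
  (\int[P]_(w in [set w | (c <= `|X w|)%R]) `|X w|%:E <= e%:E)%E.
Proof.
(* On the tail [ln u >= 1 + s], so [s u <= u ln u - u], and the tail integral is at most [r0 M / s],
   which is at most [e] by the choice of [s]. *)
move=> r0gt e0; have [M M0 hM] := entropy_stopped.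
pose s := r0 * M / e + 1; have s0 : 0 < s by rewrite ltr_wpDl// divr_ge0// ?mulr_ge0// ltW.
exists (r0 * expR (1 + s)) => tau X st hX.
have mu := utility_stopped_measurable opt_predictable opt_square_integrable IO_integral st.
have mX : measurable_fun setT X.
  apply: (measurable_fun_ae_eq Pc (f := fun w => r0 * utility opt IO (tau w) w)).
    exact: measurable_funM.
  by apply: filterS hX => w ->.
have mnX : measurable_fun setT (fun w => `|X w|) by exact: measurableT_comp.
set D := [set w | _]; have mD : measurable D.
  by rewrite -[D]setTI; apply: measurable_fun_le.
pose phi w := ln (utility opt IO (tau w) w) * utility opt IO (tau w) w - utility opt IO (tau w) w + 1.
have phi0 w : 0 <= phi w.
  have x0 := utility_gt0 opt IO (tau w) w.
  have h := expR_ge1Dx (- ln (utility opt IO (tau w) w)); rewrite expRN lnK// in h.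
  by have := ler_wpM2l (ltW x0) h; rewrite divff ?gt_eqF// mulrDr mulr1 mulrN mulrC /phi; lra.
have mphi : measurable_fun setT phi.
  apply: measurable_funD => //; apply: measurable_funB => //; apply: measurable_funM => //.
  exact: measurableT_comp.
have rs0 : 0 <= r0 / s by rewrite divr_ge0// ltW.
rewrite integral_mkcond.
rewrite (_ : ((fun w => `|X w|%:E) \_ D)%E = fun w => (`|X w| * \1_D w)%:E); last first.
  by apply/funext => w; rewrite patchE indicE; case: (w \in D); rewrite ?mulr1 ?mulr0.
apply: (@le_trans _ _ (\int[P]_w ((r0 / s)%:E * (phi w)%:E))%E).
  apply: ge0_integral_ae_mono.
  - by apply: measurable_funM => //; exact: measurable_indic.
  - by move=> w; rewrite indicE mulr_ge0.
  - by move=> w; rewrite -EFinM lee_fin mulr_ge0.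
  apply: filterS hX => w Xw; rewrite -EFinM lee_fin indicE.
  case: (boolP (w \in D)) => [|_]; last by rewrite mulr0 mulr_ge0.
  rewrite inE /D/= Xw mulr1; set u := utility opt IO (tau w) w.
  have u0 : 0 < u := utility_gt0 _ _ _ _.
  rewrite normrM !gtr0_norm// ler_pM2l// => hu.
  have lu : 1 + s <= ln u by rewrite -ler_expR lnK.
  rewrite -mulrA ler_pM2l// mulrC ler_pdivlMr// /phi -/u.
  have := ler_wpM2r (ltW u0) lu; lra.
rewrite ge0_integralZl//; try by [exact/measurable_EFinP|move=> w _; rewrite lee_fin].
apply: (@le_trans _ _ ((r0 / s)%:E * M%:E)%E); first by apply: lee_wpmul2l => //; exact: hM.
rewrite -EFinM lee_fin mulrAC ler_pdivrMr// /s mulrDr mulr1 mulrCA divff ?gt_eqF// mulr1.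
by rewrite lerDl ltW.
Qed.

(** At each time the projection is at least as close to the target as [H] almost surely; [ae_path]
    is applied to the predictable set where the gap is negative. *)
Lemma gap_ge0_ae H : vpred H ->
  (forall t, 0 <= t <= T -> \forall w \ae P, constraint sigma C t w (H t w)) ->
  \forall w \ae P, {ae leb, forall t, `[0%R, T]%classic t -> 0 <= gap H t w}.
Proof.
move=> pH hC; pose D := (`[0%R, T] `*` setT) `&` [set tw : R * Omega | `]-oo, 0[%classic (gap H tw.1 tw.2)].
have pD : pred_system P T B D.
  apply: pred_systemW; last by move=> tw [].
  by apply: (gap_predictable pH); exact: measurable_itv.
have : \forall w \ae P, {ae leb, forall t, `[0%R, T]%classic t -> ~ D (t, w)}.
  apply: (ae_path Pc BM T0 pD) => t tT; apply: filterS (hC t tT) => w [c Cc HE] [_] /=.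
  rewrite in_itv/= => /lt_geF; rewrite /gap mulr_ge0// ?divr_ge0 ?sqr_ge0//.
  by rewrite subr_ge0 -HE; have [_] := qmin w tT; exact.
apply: filterS => w [N [mN N0 sub]]; exists N; split => //; apply: subset_trans sub => t ngap h.
apply: ngap => tT; rewrite leNgt; apply/negP => g0.
by apply: (h tT); split => //=; rewrite in_itv/=.
Qed.

Variable y0 : R.
Hypothesis Y0 : \forall w \ae P, Y 0 w = y0.

Section wealth.
Variables (x : R) (pi : R -> Omega -> 'cV[R]_d).
Let H t w := (sigma t w)^T *m pi t w.
Hypothesis ppi : mx_predictable P T B pi.
Hypothesis spi : square_integrable H.
Let IH := stochastic_integral P T B H.
Let r0 := expR (- alpha * (x - y0)).

Lemma wealth_integrand_predictable : vpred H.
Proof. by apply: mx_predictable_mul => //; exact: mx_predictable_tr. Qed.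

Let pH := wealth_integrand_predictable.

Lemma wealth_integral : is_stochastic_integral H IH.
Proof. exact: stochastic_integralP. Qed.

Lemma wealth_utility : \forall w \ae P, forall t,
  expR (- alpha * (wealth P T B b sigma x pi t w - Y t w)) = r0 * utility H IH t w.
Proof.
apply: filterS Y0 => w Yw t; rewrite /r0 /utility /wealth Yw -expRD; congr expR.
rewrite -/H -/IH; ring.
Qed.

(** [F] equals [Y T] almost surely, so the payoff is the utility process at the terminal time. *)
Lemma expected_utilityE : expected_utility P T B alpha b sigma F x pi =
  (- (r0%:E * \int[P]_w (utility H IH T w)%:E))%E.
Proof.
have TT : 0 <= T <= T by rewrite lexx ltW.
have mu := utility_stopped_measurable pH spi wealth_integral (stopping_time_cst TT).
have mru : measurable_fun setT (fun w => - (r0 * utility H IH T w)).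
  by apply: measurableT_comp => //; exact: measurable_funM.
have eq : \forall w \ae P, - (r0 * utility H IH T w) = - expR (- alpha * (wealth P T B b sigma x pi T w - F w)).
  by move: wealth_utility bsde_increment; apply: filterS2 => w /(_ T) <- [_ ->].
rewrite /expected_utility unlock.
rewrite (@ae_eq_integral _ _ _ P setT (fun w => - (r0 * utility H IH T w)%:E)%E) => [| | | |].
- rewrite integral_ge0N; last by move=> w _; rewrite lee_fin mulr_ge0// expR_ge0.
  congr (- _)%E; rewrite -ge0_integralZl//.
  + exact/measurable_EFinP.
  + by move=> w _; rewrite lee_fin expR_ge0.
  + by rewrite lee_fin expR_ge0.
- exact: measurableT.
- apply/measurable_EFinP; exact: (measurable_fun_ae_eq Pc mru eq).
- exact/measurable_EFinP.
- by apply: filterS eq => w <- _.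
Qed.

End wealth.

(** Admissibility supplies both the nonnegative gap and the uniform integrability that give
    expectation at least 1 at time [T]; the sign of the exponential utility reverses the
    inequality. *)
Lemma expected_utility_le x pi : admissible P T B alpha b sigma C Y x pi ->
  (expected_utility P T B alpha b sigma F x pi <= (- expR (- alpha * (x - y0)))%:E)%E.
Proof.
move=> [ppi spi Cpi ui]; have pH := wealth_integrand_predictable ppi.
rewrite (expected_utilityE x ppi spi) EFinN leeN2.
have hI := wealth_integral ppi spi.
have /(lee_wpmul2l (x := (expR (- alpha * (x - y0)))%:E)) : (1 <= \int[P]_w
    (utility (fun t w => ((sigma t w)^T *m pi t w)%R) (stochastic_integral P T B (fun t w => ((sigma t w)^T *m pi t w)%R)) T w)%:E)%E.
  apply: (utility_terminal_ge pH spi hI (expR_gt0 (- alpha * (x - y0)))).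
    by apply: gap_ge0_ae => // t tT; apply: filterS (Cpi t tT) => w Cw; exists (pi t w).
  move=> e /ui[c hc]; exists c => tau st.
  apply: le_trans (hc _ (ex_intro2 _ _ tau st erefl)); apply: integral_tail_ae.
    by apply: measurable_funM => //; exact: utility_stopped_measurable.
  by apply: filterS (wealth_utility x pi) => w ->.
by rewrite mule1; apply; rewrite lee_fin expR_ge0.
Qed.

Lemma expected_utility_opt x : admissible P T B alpha b sigma C Y x q /\
  (expected_utility P T B alpha b sigma F x q = (- expR (- alpha * (x - y0)))%:E)%E.
Proof.
have TT : 0 <= T <= T by rewrite lexx ltW.
split; first split => //.
- exact: opt_square_integrable.
- by move=> t tT; apply: aeW => w; have [] := qmin w tT.
- move=> e e0; have [c hc] := optimal_ui (expR_gt0 (- alpha * (x - y0))) e0.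
  exists c => _ [tau st <-]; apply: hc st _.
  by apply: filterS (wealth_utility x q) => w.
rewrite (expected_utilityE x pq opt_square_integrable) -/opt.
suff -> : (\int[P]_w (utility opt IO T w)%:E = 1)%E by rewrite mule1.
have [tau [st en hT]] := energy_localization opt_predictable opt_square_integrable IO_integral.
have cv := utility_ui_cvg opt_predictable opt_square_integrable IO_integral ler01 _ st hT.
have : (fun n => \int[P]_w (1 * utility opt IO (tau n w) w)%:E)%E @ \oo --> (\int[P]_w (1 * utility opt IO T w)%:E)%E.
  apply: cv => e e0; have [c hc] := optimal_ui ltr01 e0; exists c => tau' st'.
  by apply: hc st' _; exact: aeW.
under eq_fun do under eq_integral do rewrite mul1r.
under [X in _ --> X]eq_integral do rewrite mul1r.
under eq_fun => n do rewrite (integral_utility_eq opt_predictable opt_square_integrable IO_integral (st n) (ler0n _ n) (en n) (fun t w _ => gap_opt t w)).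
by move/cvg_lim => <-//; rewrite lim_cst.
Qed.

Lemma value_opt x : value P T B alpha b sigma C F Y x = (- expR (- alpha * (x - y0)))%:E.
Proof.
have [aq <-] := expected_utility_opt x; apply/eqP; rewrite eq_le; apply/andP; split.
  apply: ge_ereal_sup => _ [pi api <-]; have [_ ->] := expected_utility_opt x.
  exact: expected_utility_le.
by apply: ereal_sup_ubound; exists q.
Qed.

End utility.

Theorem theorem4p2 (disp : measure_display) (Omega : measurableType disp)
  (R : realType) (P : probability Omega R) (T : R) (d m : nat) (alpha : R)
  (B : R -> Omega -> 'cV[R]_m)
  (b : R -> Omega -> 'cV[R]_d) (sigma : R -> Omega -> 'M[R]_(d, m))
  (C : set 'cV[R]_d)
  (F : Omega -> R) (p : nat) (eps : R)
  (Y : R -> Omega -> R) (Z : R -> Omega -> 'cV[R]_m) :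
  measure_is_complete P ->
  0 < T -> (1 <= d <= m)%N -> 0 < alpha ->
  brownian_motion P T B ->
  mx_predictable P T B b -> bounded_process T b ->
  mx_predictable P T B sigma -> bounded_process T sigma ->
  (forall t w, 0 <= t <= T -> sigma t w *m (sigma t w)^T \in unitmx) ->
  bounded_process T (theta b sigma) ->
  closed C -> convex_set C -> C 0 ->
  measurable_wrt (augmented_filtration P B T) F ->
  (1 < p)%N -> 0 < eps ->
  (\int[P]_w (expR (p%:R * alpha * Num.max (F w) 0))%:E < +oo)%E ->
  (\int[P]_w (expR (eps * Num.max (- F w) 0))%:E < +oo)%E ->
  bsde_solution P T B F (generator alpha b sigma C) Y Z ->
  bsde_class P T (p%:R * alpha) eps Y Z ->
  (forall x : R, \forall w \ae P,
     value P T B alpha b sigma C F Y x = (- expR (- alpha * (x - Y 0 w)))%:E) /\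
  (exists pi : R -> Omega -> 'cV[R]_d,
     (forall x : R,
        admissible P T B alpha b sigma C Y x pi /\
        expected_utility P T B alpha b sigma F x pi
          = value P T B alpha b sigma C F Y x) /\
     (forall t, 0 <= t <= T -> \forall w \ae P,
        (sigma t w)^T *m pi t w
          = eproj (constraint sigma C t w) (Z t w + alpha^-1 *: theta b sigma t w))).
Proof.
move=> Pc T0 _ alpha0 BM pb _ psigma _ usigma btheta clC cC C0 _ p1 _ _ _ hY clY.
have [q pq qmin] := optimal_exists pb psigma usigma clC cC C0 hY.
(* The value is deterministic, so it is computed with the constant [y0] and compared with [Y 0]
   almost surely. *)
have [y0 Y0] := adapted_time0_cst BM T0 (Y_adapted hY).
have val x : value P T B alpha b sigma C F Y x = (- expR (- alpha * (x - y0)))%:E.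
  exact: (value_opt Pc T0 alpha0 BM pb psigma usigma btheta cC C0 p1 hY clY pq qmin Y0 x).
split=> [x|]; first by apply: filterS Y0 => w ->; exact: val.
exists q; split=> [x|t tT]; last first.
  by apply: aeW => w; have [Cq mq] := qmin t w tT; rewrite (eproj_min cC Cq mq).
have [aq eq] : admissible P T B alpha b sigma C Y x q /\
    (expected_utility P T B alpha b sigma F x q = (- expR (- alpha * (x - y0)))%:E)%E.
  exact: (expected_utility_opt Pc T0 alpha0 BM pb psigma usigma btheta cC C0 p1 hY clY pq qmin Y0 x).
by rewrite val.
Qed.
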